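(* Let $d\ge 2$, let $B=\{B_t,\ t\ge 0\}$ be a $d$-dimensional Wiener process starting from $0$, and let $\lambda:\mathbb{R}^d\to(0,\infty)$ be a measurable function such that: (1) $1/\lambda$ is locally integrable on $\mathbb{R}^d$; (2) there exist $2^d$ real numbers $\lambda_\alpha>0$, $\alpha\in\{0,1\}^d$, such that for every $\alpha\in\{0,1\}^d$ $$\lim_{\substack{\|x\|\to\infty\\ x\in\Delta_\alpha}}\lambda(x)=\lambda_\alpha ;$$ (3) if $d=2$, there exists some $\gamma\in(0,1/2)$ such that for every $R>0$ $$\int_{\{\|x\|\le R\}}\lambda^{-1}(x)\,\|x\|^{-2\gamma}\,dx<\infty ;$$ if $d>2$, then for every $R>0$ $$\int_{\{\|x\|\le R\}}\lambda^{-1}(x)\,\|x\|^{2-d}\,dx<\infty ;$$ (4) $\int_0^\infty \frac{ds}{\lambda(B_s)}=+\infty$ almost surely. Let $S_B(u)=\int_0^u\frac{ds}{\lambda(B_s)}$ and $\tau_t=\inf\{u>0: S_B(u)>t\}$. Let $W$ be a $d$-dimensional Wiener process starting from $0$, and set $$\upsilon(x)=\sum_{\alpha\in\{0,1\}^d}\frac{1}{\lambda_\alpha}\mathbf{1}_{\Delta_\alpha}(x),\qquad \nu(t)=\int_0^t\upsilon(W_s)\,ds ,$$ with $\nu^{-1}$ the inverse function of $t\mapsto\nu(t)$. Then for every $T>0$, $$\left\{\frac{B_{\tau_{nt}}}{\sqrt n},\ t\in[0,T]\right\}\Longrightarrow\left\{W(\nu^{-1}(t)),\ t\in[0,T]\right\}\qquad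 (n\to\infty).$$
   Context: $\|\cdot\|$ is the Euclidean norm. For $\alpha\in\{0,1\}^d$, $\Delta_\alpha=\{\sum_{i=1}^d(-1)^{\alpha_i}t_ie_i:\ t_1,\dots,t_d>0\}$ denotes the open octant of $\mathbb{R}^d$ indexed by $\alpha$, where $e_1,\dots,e_d$ is the canonical basis. The limit in (2) means: for every $\epsilon>0$ there is $A>0$ such that $|\lambda(x)-\lambda_\alpha|<\epsilon$ for all $x\in\Delta_\alpha$ with $\|x\|>A$. The symbol $\Longrightarrow$ denotes weak convergence of the laws of the (continuous-path) processes, as probability measures on the space of continuous functions $[0,T]\to\mathbb{R}^d$ with the uniform topology. The additive functional $S_B$ is a.s. continuous and strictly increasing, so $\tau$ is a.s. finite and continuous with $\tau_0=0$; $\nu$ is a.s. continuous, strictly increasing and tends to $\infty$, so $\nu^{-1}$ is a.s. well defined and continuous on $[0,\infty)$. By convention $\inf\emptyset=+\infty$. *)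

(* Defs.v *)
From HB Require Import structures.
From mathcomp Require Import all_boot all_order all_algebra.
From mathcomp Require Import all_classical all_reals all_analysis.
From mathcomp Require Import measurable_realfun.

Set Implicit Arguments.
Unset Strict Implicit.
Unset Printing Implicit Defensive.

Import Order.TTheory GRing.Theory Num.Theory.
Import numFieldNormedType.Exports.

Local Open Scope classical_set_scope.
Local Open Scope ring_scope.

Definition borel (X : ptopologicalType) := g_sigma_algebraType (@open X).

HB.instance Definition _ (X : ptopologicalType) := Measurable.on (borel X).

(** The topology of ['rV[R]_d] is that of the sup norm, hence the Euclidean
    one; the Euclidean norm itself has to be written out. *)
Definition enorm (R : realType) (d : nat) (x : 'rV[R]_d) : R :=
  Num.sqrt (\sum_(i < d) x ord0 i ^+ 2).

Section lebesgue_measure_rV.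
Variable R : realType.

Fixpoint lebesgue_tuple (n : nat) : set (n.-tuple R) -> \bar R :=
  match n with
  | 0 => fun A => dirac [tuple] A
  | n'.+1 => pushforward
      (@lebesgue_measure R \x lebesgue_tuple (n := n'))%E
      (fun p : R * n'.-tuple R => [tuple of p.1 :: p.2])
  end.

Lemma lebesgue_tuple_sigma_finite_measure (n : nat) :
  exists m : {sigma_finite_measure set (n.-tuple R) -> \bar R},
    m = @lebesgue_tuple n :> (set (n.-tuple R) -> \bar R).
Proof.
elim: n => [|n [m mE]].
  by exists (dirac ([tuple] : 0.-tuple R)).
pose c (p : R * n.-tuple R) : n.+1.-tuple R := [tuple of p.1 :: p.2].
pose c' (t : n.+1.-tuple R) : R * n.-tuple R := (thead t, [tuple of behead t]).
have cK p : c' (c p) = p by case: p => x t; congr pair; exact: val_inj.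
have mc : measurable_fun setT c by exact: measurable_cons.
have mc' : measurable_fun setT c'.
  by apply/measurable_fun_pair; [exact: measurable_tnth|exact: measurable_behead].
pose mu : {measure set (n.+1.-tuple R) -> \bar R} :=
  measure_function_pushforward__canonical__measure_function_Measure
    (@lebesgue_measure R \x m)%E mc.
have sf : sigma_finite setT mu.
  have /sigma_finiteP[F [TF ndF Foo]] :=
    sigma_finiteT (@lebesgue_measure R : {sigma_finite_measure set _ -> \bar R}).
  have /sigma_finiteP[G [TG ndG Goo]] := sigma_finiteT m.
  exists (fun k => c' @^-1` (F k `*` G k)).
    rewrite -preimage_bigcup (_ : \bigcup_k _ = setT) ?preimage_setT//.
    apply/seteqP; split=> // -[x t] _.
    have [i _ Fix] : (\bigcup_k F k) x by rewrite -TF.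
    have [j _ Gjt] : (\bigcup_k G k) t by rewrite -TG.
    exists (maxn i j) => //; split => /=.
      by move: x Fix; exact/subsetPset/ndF/leq_maxl.
    by move: t Gjt; exact/subsetPset/ndG/leq_maxr.
  move=> k; have [mF Fk] := Foo k; have [mG Gk] := Goo k; split.
    by rewrite -[X in measurable X]setTI; apply: mc' => //; exact: measurableX.
  rewrite /mu /= /pushforward -comp_preimage.
  rewrite (_ : c' \o c = id) ?preimage_id; last first.
    by apply/funext => p; exact: cK.
  by rewrite product_measure1E// lte_mul_pinfty// ge0_fin_numE.
pose S := HB.pack_for (sigma_finite_measure (n.+1.-tuple R) R)
  (mu : set _ -> \bar R) (Measure.on mu) (Measure_isSigmaFinite.Build _ _ _ mu sf).
by exists S; rewrite /= /mu /= /pushforward mE.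
Qed.

Lemma rV_of_tuple_measurable (d : nat) :
  measurable_fun [set: d.-tuple R]
    (fun t => (\row_i tnth t i) : borel 'rV[R]_d).
Proof.
apply: (@measurability _ _ _ (borel 'rV[R]_d) _ _ (@open 'rV[R]_d)) => //.
move=> _ [U oU <-]; rewrite setTI.
pose c (qk : 'rV[rat]_d * nat) : 'rV[R]_d := \row_i ratr (qk.1 ord0 i).
pose e (qk : 'rV[rat]_d * nat) : R := qk.2.+1%:R^-1.
have e0 qk : 0 < e qk by rewrite invr_gt0.
pose V qk := [set t : d.-tuple R | forall i, ball (c qk ord0 i) (e qk) (tnth t i)].
pose F qk := if `[< ball (c qk) (e qk) `<=` U >] then V qk else set0.
rewrite (_ : _ @^-1` U = \bigcup_qk F qk).
  apply: countable_bigcupT_measurable => // qk; rewrite /F; case: ifP => // _.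
  rewrite (_ : V qk = \bigcap_(i in [set: 'I_d])
      ((fun t => tnth t i) @^-1` ball (c qk ord0 i) (e qk))); last first.
    by apply/seteqP; split=> [t Vt i _|t Vt i]; [exact: Vt|exact: Vt].
  apply: fin_bigcap_measurable => // i _; rewrite -[X in measurable X]setTI.
  by apply: measurable_tnth => //; exact: measurable_ball.
apply/seteqP; split=> [t Ut|t [qk _]]; last first.
  rewrite /F; case: asboolP => // UF Vt; apply: UF; split=> //.
  move=> j0 j; rewrite (ord1 j0) [X in _ X]mxE; exact: Vt.
have /nbhs_ballP[r /= r0 rU] := open_nbhs_nbhs (conj oU Ut).
have r2 : 0 < r / 2 by rewrite divr_gt0.
have [k _ /(_ k (leqnn k)) /= kr] := near_infty_natSinv_lt (PosNum r2).
have /choice[q qP] (i : 'I_d) : exists q : rat,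
    ratr q \in `]tnth t i, (tnth t i + k.+1%:R^-1)[.
  by apply: rat_in_itvoo; rewrite ltrDl invr_gt0.
pose qk : 'rV[rat]_d * nat := (\row_i q i, k).
have Vt i : ball (c qk ord0 i) (e qk) (tnth t i).
  have /itvP qi := qP i.
  rewrite !mxE /ball /= ger0_norm ?subr_ge0 ?qi//.
  by rewrite /e /= ltrBlDl qi.
exists qk => //; rewrite /F; case: asboolP => // -[] x [_ cx].
apply: rU; split=> // i j; rewrite ord1 mxE (splitr r).
apply: (@ball_triangle _ _ (c qk ord0 j)).
  by apply: ball_sym; apply: le_ball (Vt j); exact: ltW.
by apply: le_ball (cx ord0 j); exact: ltW.
Qed.

Definition lebesgue_rV (d : nat) : set (borel 'rV[R]_d) -> \bar R :=
  pushforward (@lebesgue_tuple d) (fun t => (\row_i tnth t i) : borel 'rV[R]_d).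

Let lebesgue_rV_measure (d : nat) :
  exists m : {measure set (borel 'rV[R]_d) -> \bar R},
    m = @lebesgue_rV d :> (set _ -> \bar R).
Proof.
have [m mE] := lebesgue_tuple_sigma_finite_measure d.
exists (measure_function_pushforward__canonical__measure_function_Measure
  m (@rV_of_tuple_measurable d)).
by rewrite /= /lebesgue_rV /pushforward mE.
Qed.

Let lebesgue_rV0 d : @lebesgue_rV d set0 = 0%E.
Proof. by have [m <-] := lebesgue_rV_measure d; exact: measure0. Qed.

Let lebesgue_rV_ge0 d A : (0 <= @lebesgue_rV d A)%E.
Proof. by have [m <-] := lebesgue_rV_measure d; exact: measure_ge0. Qed.

Let lebesgue_rV_sigma_additive d : semi_sigma_additive (@lebesgue_rV d).
Proof.
by have [m <-] := lebesgue_rV_measure d; exact: measure_semi_sigma_additive.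
Qed.

HB.instance Definition _ (d : nat) := isMeasure.Build _ _ _ (@lebesgue_rV d)
  (@lebesgue_rV0 d) (@lebesgue_rV_ge0 d) (@lebesgue_rV_sigma_additive d).

Lemma lebesgue_rV_box (d : nat) (A : 'I_d -> set R) :
  (forall i, measurable (A i)) ->
  lebesgue_rV [set x : 'rV[R]_d | forall i, A i (x ord0 i)] =
  (\prod_(i < d) lebesgue_measure (A i))%E.
Proof.
move=> mA; rewrite /lebesgue_rV /pushforward.
rewrite (_ : _ @^-1` _ = [set t : d.-tuple R | forall i, A i (tnth t i)]).
  2: by apply/seteqP; split=> t At i; have := At i; rewrite /= mxE.
elim: d A mA => [|n IH] A mA.
  by rewrite big_ord0 /= diracE mem_set// => -[].
rewrite big_ord_recl /= /pushforward.
have [m mE] := lebesgue_tuple_sigma_finite_measure n.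
pose A' (i : 'I_n) : set R := A (lift ord0 i).
rewrite (_ : _ @^-1` _ =
  A ord0 `*` [set t : n.-tuple R | forall i, A' i (tnth t i)]); last first.
  apply/seteqP; split=> -[x t] /=.
    move=> At; split=> [|i]; first exact: (At ord0).
    by have := At (lift ord0 i); rewrite tnthS.
  by move=> [Ax At] i; have [j ->|->//] := unliftP ord0 i; rewrite tnthS; exact: At.
have mA' : measurable [set t : n.-tuple R | forall i, A' i (tnth t i)].
  rewrite (_ : mkset _ = \bigcap_(i in [set: 'I_n])
      ((fun t => tnth t i) @^-1` A' i)); last first.
    by apply/seteqP; split=> [t Vt i _|t Vt i]; exact: Vt.
  apply: fin_bigcap_measurable => // i _; rewrite -[X in measurable X]setTI.
  by apply: measurable_tnth => //; exact: mA.
rewrite -mE; etransitivity.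
  exact: (product_measure1E lebesgue_measure m (mA ord0) mA').
congr (_ * _)%E.
by rewrite [LHS](congr1 (fun f => f _) mE) IH// => i; exact: mA.
Qed.

End lebesgue_measure_rV.
Arguments lebesgue_rV {R d}.

Section path_space.
Import ArrowAsUniformType.
Variables (R : realType) (d : nat) (T : R).

(** The continuous functions from [[0, T]] to [R^d], with the topology of
    uniform convergence. *)
Definition path_space := continuousType (set_type `[0%R, T]%classic) 'rV[R]_d.

HB.instance Definition _ := Uniform.on path_space.
HB.instance Definition _ :=
  isPointed.Build path_space
    (cst 0 : continuousType (set_type `[0%R, T]%classic) 'rV[R]_d).

End path_space.

Definition weak_cvg (R : realType) (X : ptopologicalType)
    (mu : nat -> probability (borel X) R) (nu : probability (borel X) R) : Prop :=
  forall f : X -> R, continuous f -> (exists M, forall x, `|f x| <= M) ->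
    (\int[mu n]_x f x) @[n --> \oo] --> \int[nu]_x f x.

Section processes.
Context (R : realType) (d : nat).
Context (dO : measure_display) (Om : measurableType dO) (P : probability Om R).

(** [A i] may be [setT], so this covers all finite subfamilies. *)
Definition mutually_independent (k : nat) (X : 'I_k -> Om -> 'rV[R]_d) : Prop :=
  forall A : 'I_k -> set (borel 'rV[R]_d), (forall i, measurable (A i)) ->
    P [set w | forall i, A i (X i w)] = (\prod_(i < k) P (X i @^-1` A i))%E.

(** Time is indexed by [R], only nonnegative times being relevant. *)
Definition wiener_process (B : R -> Om -> 'rV[R]_d) : Prop :=
  [/\ forall t, 0 <= t -> measurable_fun [set: Om] (B t : Om -> borel 'rV[R]_d),
      {ae P, forall w, B 0 w = 0},
      {ae P, forall w, {within `[0, +oo[, continuous (B ^~ w)}},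
      forall (k : nat) (t : nat -> R),
        0 <= t 0 -> (forall i, t i <= t i.+1) ->
        mutually_independent (fun (i : 'I_k) w => B (t i.+1) w - B (t i) w) &
      forall s t : R, 0 <= s -> s < t ->
        forall A : 'I_d -> set R, (forall i, measurable (A i)) ->
        P [set w | forall i, A i ((B t w - B s w) ord0 i)] =
        (\prod_(i < d) normal_prob 0 (Num.sqrt (t - s)) (A i))%E].

Definition path_version (T : R) (X : R -> Om -> 'rV[R]_d)
    (Y : {RV P >-> borel (path_space d T)}) : Prop :=
  {ae P, forall w, forall t : set_type `[0%R, T]%classic,
    (Y w : path_space d T) t = X (\val t) w}.

End processes.

(** The processes only have continuous paths almost surely, so their laws are
    those of path-space valued random variables indistinguishable from them. *)
Definition weak_cvg_paths (R : realType) (d : nat) (T : R)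
    (d1 d2 : measure_display) (Om : measurableType d1) (Om' : measurableType d2)
    (P : probability Om R) (P' : probability Om' R)
    (X : nat -> R -> Om -> 'rV[R]_d) (X' : R -> Om' -> 'rV[R]_d) : Prop :=
  exists (Y : nat -> {RV P >-> borel (path_space d T)})
         (Y' : {RV P' >-> borel (path_space d T)}),
    [/\ forall n, path_version (X n) (Y n),
        path_version X' Y' &
        weak_cvg (fun n => distribution P (Y n)) (distribution P' Y')].

Section time_change.
Context (R : realType) (d : nat).
Implicit Types (lam : 'rV[R]_d -> R) (b : R -> 'rV[R]_d).

Definition octant (al : {ffun 'I_d -> bool}) : set 'rV[R]_d :=
  [set x | exists t : 'I_d -> R, (forall i, 0 < t i) /\
    x = \sum_(i < d) ((-1) ^+ al i * t i) *: delta_mx ord0 i].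

Definition additive_functional lam b (u : R) : \bar R :=
  (\int[lebesgue_measure]_(s in `[0%R, u]) ((lam (b s))^-1)%:E)%E.

(** [ereal_inf set0 = +oo]. *)
Definition time_change lam b (t : R) : \bar R :=
  ereal_inf [set u%:E | u in
    [set u : R | 0 < u /\ (t%:E < additive_functional lam b u)%E]].

Definition upsilon (la : {ffun 'I_d -> bool} -> R) (x : 'rV[R]_d) : R :=
  \sum_(al : {ffun 'I_d -> bool}) (la al)^-1 * \1_(octant al) x.

Definition nu la b (t : R) : R :=
  \int[lebesgue_measure]_(s in `[0, t]) upsilon la (b s).

Definition nu_inv la b : R -> R := 'pinv_(fun=> 0) `[0, +oo[ (nu la b).

End time_change.

(* Main.v *)
From HB Require Import structures.
Require Import Defs.
From mathcomp Require Import all_boot all_order all_algebra.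
From mathcomp Require Import all_classical all_reals all_analysis.
From mathcomp Require Import measurable_realfun ring lra.

Set Implicit Arguments.
Unset Strict Implicit.
Unset Printing Implicit Defensive.

Import Order.TTheory GRing.Theory Num.Theory.
Import numFieldNormedType.Exports.

Local Open Scope classical_set_scope.
Local Open Scope ring_scope.

(** A continuous version X of B scales to X_n(s) = X(n s) / sqrt n, again a Wiener
    process, and B(tau(n t)) / sqrt n = X_n(p_n(t)) where p_n is the inverse of the
    clock F_n(u) = int_0^u 1 / lambda(sqrt n X_n(s)) ds; in the same way the limit
    is W(p(t)), where p is the inverse of G(u) = int_0^u upsilon(W(s)) ds.  As X_n
    and W have the same law on path space, one may put W in place of X_n.  All
    processes then live on the same space and no tightness argument is needed: it
    is enough that F_n - G tends to 0 in L^1, uniformly on compact time intervals.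
    As upsilon is scale invariant, |F_n - G| on [0, U] is bounded by the integral
    of |1 / lambda - upsilon|(sqrt n W(s)) over [0, U], whose expectation is computed
    from the Gaussian density p_v.  Off the coordinate hyperplanes, which are not
    charged, the integrand is small outside a large ball, by (2); inside the ball
    the bound p_v(x) <= C |x|^(2 b - d) (v + |x|^2)^(- b), for b <= d / 2, makes the
    time integral of p_(n s)(x) over [0, U] at most C |x|^a / sqrt n, with a the
    exponent of (3).  Since G has slope at least min_alpha 1 / lambda_alpha, p_n is
    then uniformly close to p, and the uniform continuity of W concludes. *)

(** * Borel sets and Lebesgue measure on R^d *)

(** Putting W in place of X_n requires every statement about X_n to be an event or a measurable
    function on a space of paths, and this shapes the construction. The sigma-algebra of evaluations
    is used because a Wiener law is unique on it. The time change has to be a total measurable map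
    into the path space, so it is defined on the event that the clock is finite, unbounded and does
    not stop, and is the null path elsewhere. Almost sure facts proved along B then hold along W.
    The finiteness of F_n itself is deduced from the finite expectation of the gap. The exponent b
    depends on the dimension. For d > 2, b = 3/2 makes the time integral of (v + |x|^2)^(- b)
    converge at infinity. For d = 2 the constraint b <= 1 forbids this and b = 1 would give a
    logarithm, so b = 1 - gamma, at the price of a factor n^gamma against the 1/n of the time
    scaling. Convergence in L^1 only gives closeness in probability, while the modulus of continuity
    of the path is random. The threshold below which the gap is harmless therefore depends on the
    path, and the event where this threshold is too small is cut off. *)

Section rV_borel.
Context {R : realType} {d : nat}.

Lemma continuous_borel_measurable (X : ptopologicalType) (f : X -> R) :
  continuous f -> measurable_fun [set: borel X] (f : borel X -> R).
Proof.
move=> /continuousP cf; apply: (measurability _ (RGenOpens.measurableE R)).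
by move=> _ [_ [a [b ->] <-]]; rewrite setTI; apply: sub_sigma_algebra; exact/cf/interval_open.
Qed.

Lemma measurable_rV_coord (i : 'I_d) :
  measurable_fun [set: borel 'rV[R]_d] (fun x : borel 'rV[R]_d => x ord0 i : R).
Proof.
apply: continuous_borel_measurable; exact: coord_continuous.
Qed.

(** The function factors through tuples, from which the map to row vectors is Borel; the Borel sets
    of the topology thus contain nothing that the coordinates do not see. *)
Lemma measurable_fun_rV d1 (T1 : measurableType d1) (f : T1 -> 'rV[R]_d) :
  (forall i, measurable_fun [set: T1] (fun w => f w ord0 i)) ->
  measurable_fun [set: T1] (f : T1 -> borel 'rV[R]_d).
Proof.
move=> mf.
have -> : f = (fun t : d.-tuple R => \row_i tnth t i) \o (fun w => [tuple f w ord0 i | i < d]).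
  by apply/funext => w /=; apply/rowP => i; rewrite mxE tnth_mktuple.
apply: (measurableT_comp (@rV_of_tuple_measurable R d)).
apply/measurable_fun_tnthP => i.
rewrite (_ : _ \o _ = (fun w => f w ord0 i)); first exact: mf.
by apply/funext => w; rewrite /= tnth_mktuple.
Qed.

(** A Wiener process has the law of its increments prescribed on these boxes only. They are stable
    under intersection and generate the Borel sets, hence determine a finite measure. *)
Definition rV_boxes : set (set 'rV[R]_d) :=
  [set [set x : 'rV[R]_d | forall i, A i (x ord0 i)] |
     A in [set A : 'I_d -> set R | forall i, measurable (A i)]].

Lemma rV_boxesI : setI_closed rV_boxes.
Proof.
move=> _ _ [A mA <-] [B mB <-]; exists (fun i => A i `&` B i) => /=.
  by move=> i; exact: measurableI.
apply/seteqP; split=> x /=; first by move=> H; split=> i; case: (H i).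
by move=> [HA HB] i; split.
Qed.

Lemma measurable_rV_box (A : 'I_d -> set R) : (forall i, measurable (A i)) ->
  measurable ([set x | forall i, A i (x ord0 i)] : set (borel 'rV[R]_d)).
Proof.
move=> mA.
rewrite [X in measurable X](_ : _ = \bigcap_(i in [set: 'I_d])
    ((fun x : borel 'rV[R]_d => x ord0 i) @^-1` A i)); last first.
  by apply/seteqP; split=> [t Vt i _|t Vt i]; exact: Vt.
apply: fin_bigcap_measurable => // i _; rewrite -[X in measurable X]setTI.
by apply: measurable_rV_coord => //; exact: mA.
Qed.

Lemma borel_rVE :
  (@measurable _ (borel 'rV[R]_d)) = <<s rV_boxes >> :> set (set (borel 'rV[R]_d)).
Proof.
apply/seteqP; split; last first.
  apply: smallest_sub; first exact: sigma_algebra_measurable.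
  by move=> _ [A mA <-]; exact: measurable_rV_box.
(* [measurable_fun_rV] holds over any measurable space; over the one generated by the boxes it makes
   the identity measurable, which is the missing inclusion. *)
have mid : measurable_fun [set: g_sigma_algebraType rV_boxes]
   (id : g_sigma_algebraType rV_boxes -> borel 'rV[R]_d).
  apply: (@measurable_fun_rV _ (g_sigma_algebraType rV_boxes)) => i _ A mA; rewrite setTI.
  apply: sub_sigma_algebra.
  exists (fun j => if j == i then A else setT) => /=.
    by move=> j; case: ifP.
  apply/seteqP; split=> x /=; first by move=> /(_ i); rewrite eqxx.
  by move=> Ax j; case: eqP => [->|].
by move=> A mA; have := mid measurableT _ mA; rewrite setTI.
Qed.

Lemma borel_rV_measure_unique (m1 m2 : {measure set (borel 'rV[R]_d) -> \bar R}) :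
  (m1 setT < +oo)%E ->
  (forall A : 'I_d -> set R, (forall i, measurable (A i)) ->
     m1 [set x : 'rV[R]_d | forall i, A i (x ord0 i)] =
     m2 [set x : 'rV[R]_d | forall i, A i (x ord0 i)]) ->
  forall A, measurable A -> m1 A = m2 A.
Proof.
move=> m1oo m12 A mA.
have bT : rV_boxes setT.
  by exists (fun=> setT) => //; apply/seteqP; split.
apply: (@measure_unique _ R (borel 'rV[R]_d) rV_boxes (fun=> setT) borel_rVE
  rV_boxesI (fun=> bT) _ m1 m2) => //.
- by apply/seteqP; split=> // x _; exists 0.
- by move=> _ [B mB <-]; exact: m12.
Qed.

End rV_borel.

Section density.
Local Open Scope ereal_scope.
Import HBNNSimple.
Context {R : realType} d (T : measurableType d).

(** By monotone convergence both sides are limits along simple functions increasing to [h], and for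
    an indicator the identity is the hypothesis on [nu]. *)
Lemma ge0_integral_density (m nu : {measure set T -> \bar R}) (p : T -> R)
    (h : T -> \bar R) :
  measurable_fun setT p -> (forall x, (0 <= p x)%R) ->
  (forall A, measurable A -> nu A = \int[m]_(x in A) (p x)%:E) ->
  measurable_fun setT h -> (forall x, 0 <= h x) ->
  \int[nu]_x h x = \int[m]_x (h x * (p x)%:E).
Proof.
move=> mp p0 nup mh h0.
pose g := nnsfun_approx measurableT mh.
have hg x : h x = limn (fun n => (EFin \o g n) x).
  by apply/esym/cvg_lim => //; exact: cvg_nnsfun_approx.
have mg n : measurable_fun setT (EFin \o g n) by exact/measurable_EFinP.
have mpE : measurable_fun setT (EFin \o p) by exact/measurable_EFinP.
have ndg x : {homo (fun n => (EFin \o g n) x) : a b / (a <= b)%N >-> a <= b}.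
  by move=> a b ab; rewrite lee_fin; exact/lefP/nd_nnsfun_approx.
have -> : \int[nu]_x h x = limn (fun n => \int[nu]_x (EFin \o g n) x).
  under eq_integral do rewrite hg.
  by apply: monotone_convergence => // n x _; rewrite lee_fin.
have -> : \int[m]_x (h x * (p x)%:E) =
    limn (fun n => \int[m]_x ((EFin \o g n) x * (p x)%:E)).
  have hpg x : h x * (p x)%:E = limn (fun n => (EFin \o g n) x * (p x)%:E).
    by apply/esym/cvg_lim => //; apply: cvgeZr => //; exact: cvg_nnsfun_approx.
  under eq_integral do rewrite hpg.
  apply: monotone_convergence => //.
  - by move=> n; exact: (emeasurable_funM (mg n) mpE).
  - by move=> n x _; rewrite mule_ge0// lee_fin.
  - by move=> x _ a b ab; rewrite lee_wpmul2r ?lee_fin// -lee_fin; exact: ndg.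
congr (limn _); apply/funext => n.
transitivity (\int[nu]_x
   (\sum_(y \in range (g n)) (y * \1_(g n @^-1` [set y]) x)%:E)).
  by apply: eq_integral => t _; rewrite /= fimfunE -fsumEFin.
have mind r : measurable_fun setT (fun x => (r * \1_(g n @^-1` [set r]) x)%:E).
  by apply/measurable_EFinP; exact: measurable_funM.
rewrite ge0_integral_fsum//; last by move=> y x _; exact: nnfun_muleindic_ge0.
transitivity (\int[m]_x (\sum_(y \in range (g n))
    (y * \1_(g n @^-1` [set y]) x)%:E * (p x)%:E)); last first.
  apply: eq_integral => x _.
  rewrite -ge0_mule_fsuml => [|y]; last exact: nnfun_muleindic_ge0.
  by rewrite fsumEFin// -(fimfunE _ x).
rewrite ge0_integral_fsum//; last 2 first.
- by move=> y; exact: (emeasurable_funM (mind y) mpE).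
- by move=> y x _; rewrite mule_ge0 ?lee_fin// -lee_fin nnfun_muleindic_ge0.
apply: eq_fsbigr => r rgn.
have r0 : (0 <= r)%R by move: rgn; rewrite inE => -[x _ <-].
under eq_integral do rewrite EFinM.
rewrite ge0_integralZl//; last first.
  by apply/measurable_EFinP.
under [in RHS]eq_integral do rewrite EFinM -muleA.
rewrite ge0_integralZl//; last 2 first.
- apply: (emeasurable_funM _ mpE).
  exact/measurable_EFinP.
- by move=> x _; rewrite mule_ge0// lee_fin.
congr (_ * _); rewrite integral_indic// setIT nup//.
rewrite integral_mkcond; apply: eq_integral => x _.
by rewrite patchE indicE; case: ifP => _; rewrite ?mul1e ?mul0e.
Qed.

End density.

(** * Gaussian marginals *)

Section lebesgue_rV_integral.
Local Open Scope ereal_scope.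
Context {R : realType}.

(** [lebesgue_tuple] is a bare set function, known to coincide with some sigma-finite measure; the
    measure [m] and the equation are therefore carried as arguments. *)
Lemma integral_lebesgue_rV (d : nat) (m : {measure set (d.-tuple R) -> \bar R})
    (f : 'rV[R]_d -> \bar R) :
  m = @lebesgue_tuple R d :> (set _ -> \bar R) ->
  measurable_fun [set: borel 'rV[R]_d] (f : borel 'rV[R]_d -> \bar R) ->
  (forall x, 0 <= f x) ->
  \int[lebesgue_rV]_x (f : borel 'rV[R]_d -> \bar R) x =
  \int[m]_t f (\row_i tnth t i).
Proof.
move=> mE mf f0.
rewrite (eq_measure_integral (measure_function_pushforward__canonical__measure_function_Measure
  m (@rV_of_tuple_measurable R d))); last first.
  by move=> A mA _; rewrite /= /lebesgue_rV /pushforward mE.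
by rewrite (ge0_integral_pushforward (@rV_of_tuple_measurable R d)).
Qed.

(** Induction on the dimension: the measure is an iterated product and Tonelli splits off its first
    factor. *)
Lemma integral_lebesgue_tuple_prod (d : nat)
    (m : {measure set (d.-tuple R) -> \bar R}) (f : 'I_d -> R -> R) :
  m = @lebesgue_tuple R d :> (set _ -> \bar R) ->
  (forall i, measurable_fun setT (f i)) -> (forall i x, (0 <= f i x)%R) ->
  \int[m]_t (\prod_(i < d) f i (tnth t i))%:E =
  \prod_(i < d) \int[lebesgue_measure]_x (f i x)%:E.
Proof.
elim: d m f => [|n IH] m f mE mf f0.
  rewrite [RHS]big_ord0; under eq_integral do rewrite big_ord0.
  by rewrite integral_cst// mE /= diracT mul1e.
have [m' m'E] := lebesgue_tuple_sigma_finite_measure R n.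
pose c (p : measurableTypeR R * n.-tuple R) : n.+1.-tuple R := [tuple of p.1 :: p.2].
have mc : measurable_fun setT c by exact: measurable_cons.
pose mu : {measure set (measurableTypeR R * n.-tuple R) -> \bar R} :=
  (@lebesgue_measure R \x m').
rewrite (eq_measure_integral (measure_function_pushforward__canonical__measure_function_Measure
  mu mc)); last first.
  by move=> A mA _; rewrite mE /= m'E.
have mprod k (g : 'I_k -> R -> R) : (forall i, measurable_fun setT (g i)) ->
    measurable_fun setT (fun t : k.-tuple R => (\prod_(i < k) g i (tnth t i))%:E).
  move=> mg; apply/measurable_EFinP.
  apply: (@measurable_prod _ _ _ _ _ _ (fun (i : 'I_k) (t : k.-tuple R) => g i (tnth t i))) => i _.
  by apply: measurableT_comp => //; exact: measurable_tnth.
rewrite [LHS](ge0_integral_pushforward mc mu)//; last 2 first.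
- exact: mprod.
- by move=> t _; rewrite lee_fin prodr_ge0.
rewrite /mu fubini_tonelli1; last 2 first.
- by apply: measurableT_comp => //; exact: mprod.
- by move=> t; rewrite lee_fin prodr_ge0.
rewrite big_ord_recl /fubini_F.
have mf' : forall i : 'I_n, measurable_fun setT (f (lift ord0 i)) by [].
rewrite -(IH m' (fun i => f (lift ord0 i)))//.
rewrite -ge0_integralZr//; last 3 first.
- by have /measurable_EFinP h := mf ord0; exact: h.
- by move=> x _; rewrite lee_fin.
- by apply: integral_ge0 => t _; rewrite lee_fin prodr_ge0.
apply: eq_integral => x _.
rewrite -ge0_integralZl//; last 3 first.
- exact: (mprod n (fun i => f (lift ord0 i))).
- by move=> t _; rewrite lee_fin prodr_ge0.
- by rewrite lee_fin.
apply: eq_integral => t _; rewrite -EFinM /= big_ord_recl; congr (_ * _)%:E.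
by apply: eq_bigr => i _; rewrite tnthS.
Qed.

Lemma integral_lebesgue_rV_prod (d : nat) (f : 'I_d -> R -> R) :
  (forall i, measurable_fun setT (f i)) -> (forall i x, (0 <= f i x)%R) ->
  \int[lebesgue_rV]_x (\prod_(i < d) f i ((x : 'rV[R]_d) ord0 i))%:E =
  \prod_(i < d) \int[lebesgue_measure]_x (f i x)%:E.
Proof.
move=> mf f0.
have [m mE] := lebesgue_tuple_sigma_finite_measure R d.
rewrite (integral_lebesgue_rV mE)//; last 2 first.
- apply/measurable_EFinP.
  apply: (@measurable_prod _ _ _ _ _ _
    (fun (i : 'I_d) (t : borel 'rV[R]_d) => f i ((t : 'rV[R]_d) ord0 i))) => i _.
  by apply: measurableT_comp => //; exact: measurable_rV_coord.
- by move=> x; rewrite lee_fin prodr_ge0.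
rewrite -(integral_lebesgue_tuple_prod mE)//.
by apply: eq_integral => t _; congr EFin; apply: eq_bigr => i _; rewrite mxE.
Qed.

End lebesgue_rV_integral.

Lemma ae_iff_measure (R : realType) dO (Om : measurableType dO)
    (P : {measure set Om -> \bar R}) (A B : set Om) :
  measurable A -> measurable B -> {ae P, forall w, A w <-> B w} -> P A = P B.
Proof.
move=> mA mB [N [mN N0 AB]].
have le (C D : set Om) : measurable C -> measurable D ->
    ~` [set w | C w <-> D w] `<=` N -> (P C <= P D)%E.
  move=> mC mD CDN; rewrite -(measureU0 mD mN N0).
  apply: le_measure; rewrite ?inE//; first exact: measurableU.
  move=> w Cw; have [Dw|Dw] := pselect (D w); [by left|right].
  by apply: CDN => -[/(_ Cw)].
apply/eqP; rewrite eq_le !le// => w h; apply: AB => -[h1 h2]; exact: h.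
Qed.

Section gaussian_marginal.
Local Open Scope ereal_scope.
Context {R : realType} {d : nat}.

Definition gauss_pdf (s : R) (x : 'rV[R]_d) : R :=
  \prod_(i < d) normal_pdf 0 (Num.sqrt s) (x ord0 i).

Lemma gauss_pdf_ge0 s x : (0 <= gauss_pdf s x)%R.
Proof. by apply: prodr_ge0 => i _; exact: normal_pdf_ge0. Qed.

Lemma measurable_gauss_pdf s :
  measurable_fun [set: borel 'rV[R]_d] (gauss_pdf s : borel 'rV[R]_d -> R).
Proof.
apply: (@measurable_prod _ _ _ _ _ _
  (fun (i : 'I_d) (t : borel 'rV[R]_d) => normal_pdf 0 (Num.sqrt s) ((t : 'rV[R]_d) ord0 i))) => i _.
by apply: measurableT_comp; [exact: measurable_normal_pdf|exact: measurable_rV_coord].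
Qed.

Context dO (Om : measurableType dO) (P : probability Om R).
Context (B : R -> Om -> 'rV[R]_d) (hB : wiener_process P B).

Lemma wiener_measurable t : (0 <= t)%R ->
  measurable_fun [set: Om] (B t : Om -> borel 'rV[R]_d).
Proof. by case: hB => + _ _ _ _; exact. Qed.

Lemma wiener_law_box t : (0 < t)%R ->
  forall A : 'I_d -> set R, (forall i, measurable (A i)) ->
  P [set w | forall i, A i (B t w ord0 i)] =
  \prod_(i < d) normal_prob 0 (Num.sqrt t) (A i).
Proof.
move=> t0 A mA; have [mB _ _ _ inc] := hB.
have := inc 0%R t (lexx _) t0 A mA; rewrite subr0 => <-.
have mE (C : Om -> 'rV[R]_d) : measurable_fun setT (C : Om -> borel 'rV[R]_d) ->
    measurable [set w | forall i, A i (C w ord0 i)].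
  move=> mC; rewrite -[X in measurable X]setTI.
  by apply: (mC measurableT _ (measurable_rV_box mA)).
have m1 : measurable [set w | forall i, A i (B t w ord0 i)].
  by apply: mE; apply: mB; exact: ltW.
have m2 : measurable [set w | forall i, A i ((B t w - B 0 w)%R ord0 i)].
  apply: mE; apply: measurable_fun_rV => i.
  rewrite (_ : (fun w => _) = (fun w => B t w ord0 i - B 0 w ord0 i)%R); last first.
    by apply/funext => w; rewrite !mxE.
  apply: measurable_funB; apply: (measurableT_comp (measurable_rV_coord i)); apply: mB => //.
  exact: ltW.
apply: ae_iff_measure => //; have [_ h _ _ _] := hB.
by apply: filterS h => w /= ->; rewrite subr0.
Qed.

Lemma wiener_expectation t (h : 'rV[R]_d -> \bar R) : (0 < t)%R ->
  measurable_fun [set: borel 'rV[R]_d] (h : borel 'rV[R]_d -> \bar R) ->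
  (forall x, 0 <= h x) ->
  \int[P]_w h (B t w) =
  \int[lebesgue_rV]_x (h x * (gauss_pdf t x)%:E).
Proof.
move=> t0 mh h0.
have mB := wiener_measurable (ltW t0).
transitivity (\int[pushforward P (B t : Om -> borel 'rV[R]_d)]_x h x).
  by rewrite (ge0_integral_pushforward mB).
apply: ge0_integral_density => //.
- exact: measurable_gauss_pdf.
- exact: gauss_pdf_ge0.
- move=> A mA.
have mp : measurable_fun [set: borel 'rV[R]_d] (fun x : borel 'rV[R]_d => (gauss_pdf t x)%:E).
  by apply/measurable_EFinP; exact: measurable_gauss_pdf.
(* The density is turned into a measure, so that its agreement with the law of [B t] on boxes
   extends to all Borel sets. *)
pose q (A : set (borel 'rV[R]_d)) := \int[lebesgue_rV]_(x in A) (gauss_pdf t x)%:E.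
have q0 : q set0 = 0 by rewrite /q integral_set0.
have qge0 A' : 0 <= q A' by apply: integral_ge0 => x _; rewrite lee_fin gauss_pdf_ge0.
have qadd : semi_sigma_additive q.
  move=> F mF tF mUF; rewrite /q ge0_integral_bigcup//; last 2 first.
  - exact: measurable_funTS.
  - by move=> x _; rewrite lee_fin gauss_pdf_ge0.
  by apply: is_cvg_ereal_nneg_natsum_cond => n _ _; exact: qge0.
pose Q := HB.pack_for (measure (borel 'rV[R]_d) R) q
  (isMeasure.Build _ _ _ q q0 qge0 qadd).
apply: (@borel_rV_measure_unique R d
  (measure_function_pushforward__canonical__measure_function_Measure P mB) Q) => //.
  by rewrite /= /pushforward preimage_setT probability_setT ltry.
move=> C mC; transitivity (P [set w | forall i, C i (B t w ord0 i)]) => //.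
rewrite wiener_law_box// /= /q.
rewrite integral_mkcond.
(* The indicator of a box is a product over the coordinates, like the density, so the integral
   factors. *)
transitivity (\int[lebesgue_rV]_x (\prod_(i < d)
   (\1_(C i) (x ord0 i) * normal_pdf 0 (Num.sqrt t) (x ord0 i)))%:E).
  rewrite (@integral_lebesgue_rV_prod R d (fun i y => (\1_(C i) y * normal_pdf 0 (Num.sqrt t) y)%R)).
  - apply: eq_bigr => i _; rewrite /normal_prob integral_mkcond.
    apply: eq_integral => y _; rewrite patchE indicE.
    by case: ifP => _; rewrite ?mul1r ?mul0r.
  - move=> i; apply: measurable_funM; last exact: measurable_normal_pdf.
    exact: measurable_indic.
  - by move=> i y; rewrite mulr_ge0// normal_pdf_ge0.
apply: eq_integral => x _; rewrite patchE big_split /= -/(gauss_pdf t x).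
have [Cx|nCx] := boolP (x \in _).
  rewrite big1 ?mul1r// => i _; rewrite indicE mem_set//.
  by move: Cx; rewrite inE => /(_ i).
move: nCx; rewrite notin_setE /= => /existsNP[i nC].
by rewrite (bigD1 i)//= indicE memNset// !mul0r.
Qed.

End gaussian_marginal.

(** * Time integrals of powers and a pointwise bound on the Gaussian density *)

Section power_integral.
Context {R : realType}.
Local Notation mu := (@lebesgue_measure R).

Lemma is_derive_powR_affine (n q p s : R) : 0 < n * s + q ->
  is_derive s 1 (fun s => (n * s + q) `^ p) (n * (p * (n * s + q) `^ (p - 1))).
Proof.
move=> h.
have h1 : is_derive s 1 (fun s => n * s + q) n.
  have := is_deriveD (is_deriveZ n (is_derive_id (s : R^o) 1)) (is_derive_cst (q : R^o) s 1).
  by rewrite addr0 /GRing.scale/= mulr1.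
have h2 := is_derive1_powR p h.
have := @is_derive1_comp R _ (fun s : R => n * s + q) s _ _ h2 h1.
by rewrite mulrC.
Qed.

(** The excluded exponent 1 is the one with a logarithmic primitive; [0 < q] keeps the integrand
    smooth up to time 0. *)
Lemma integral_powR_affine (n q b U : R) : 0 < n -> 0 < q -> b != 1 -> 0 < U ->
  (\int[mu]_(s in `[0%R, U]) ((n * s + q) `^ (- b))%:E =
  (((n * U + q) `^ (1 - b) - q `^ (1 - b)) / (n * (1 - b)))%:E)%E.
Proof.
move=> n0 q0 b1 U0.
pose F (s : R) := (n * (1 - b))^-1 * (n * s + q) `^ (1 - b).
have pos (s : R) : 0 <= s -> 0 < n * s + q.
  by move=> s0; rewrite ltr_wpDl// mulr_ge0// ltW.
have c0 : n * (1 - b) != 0.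
  by rewrite mulf_neq0 ?(gt_eqF n0)// subr_eq0 eq_sym.
have dF (s : R) : 0 <= s -> is_derive s 1 F ((n * s + q) `^ (- b)).
  move=> s0; have h := is_derive_powR_affine (1 - b) (pos _ s0).
  have := @is_deriveZ _ _ _ _ (n * (1 - b))^-1 _ _ _ h.
  rewrite (_ : _ *: _ = (n * s + q) `^ (- b)) //.
  rewrite (_ : 1 - b - 1 = - b); last by ring.
  by rewrite /GRing.scale/= [n * (_ * _)]mulrA mulKf.
rewrite (@continuous_FTC2 R (fun s => (n * s + q) `^ (- b)) F 0 U U0).
- rewrite -EFinB /F mulr0 add0r; congr EFin.
  by rewrite -mulrBr mulrC.
- apply: derivable_within_continuous => s; rewrite in_itv/= => /andP[s0 _].
  by have [] := is_derive_powR_affine (- b) (pos _ s0).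
- have cF (s : R) : 0 <= s -> {for s, continuous F}.
    by move=> /dF[+ _] => /derivable1_diffP/differentiable_continuous.
  split.
  + by move=> s; rewrite in_itv/= => /andP[s0 _]; case: (dF s (ltW s0)).
  + by apply: cvg_at_right_filter; exact: cF.
  + by apply: cvg_at_left_filter; apply: cF; exact: ltW.
- move=> s; rewrite in_itv/= => /andP[s0 _].
  by rewrite derive1E; case: (dF s (ltW s0)) => _ ->.
Qed.

End power_integral.

Section gaussian_bound.
Context {R : realType} {d : nat}.

Definition sqnorm (x : 'rV[R]_d) : R := \sum_(i < d) x ord0 i ^+ 2.

Lemma sqnorm_ge0 x : 0 <= sqnorm x.
Proof. by apply: sumr_ge0 => i _; exact: sqr_ge0. Qed.

Lemma sqr_enorm (x : 'rV[R]_d) : enorm x ^+ 2 = sqnorm x.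
Proof. by rewrite sqr_sqrtr// sqnorm_ge0. Qed.

(* Each of the d factors receives 1/d of the exponential, and
   exp (y / d) >= (1 + y) / d with y = |x|^2 / v. *)
Lemma gauss_pdf_le (v : R) (x : 'rV[R]_d) : (0 < d)%N -> 0 < v ->
  gauss_pdf v x <= Num.sqrt (d%:R / (v + sqnorm x)) ^+ d.
Proof.
move=> d0 v0; have r0 := sqnorm_ge0 x.
have sv0 : Num.sqrt v != 0 by rewrite gt_eqF// sqrtr_gt0.
have vv : Num.sqrt v ^+ 2 = v by rewrite sqr_sqrtr// ltW.
have dR : (0 : R) < d%:R by rewrite ltr0n.
pose E : R := expR (- (sqnorm x / (v * 2 * d%:R))).
have -> : gauss_pdf v x = (normal_peak (Num.sqrt v) * E) ^+ d.
  rewrite /gauss_pdf /E exprMn -expRM_natl.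
  under eq_bigr do rewrite normal_pdfE//.
  rewrite big_split /= prodr_const card_ord; congr (_ * _).
  rewrite /normal_fun -expR_sum vv; congr expR.
  rewrite mulrN; have -> : d%:R * (sqnorm x / (v * 2 * d%:R)) = sqnorm x / (v * 2).
    by field; rewrite !gt_eqF.
  rewrite /sqnorm -mulNr -sumrN mulr_suml; apply: eq_bigr => i _.
  by rewrite subr0 mulr_natr.
have p0 : 0 <= normal_peak (Num.sqrt v) by exact: normal_peak_ge0.
have E0 : 0 < E by exact: expR_gt0.
apply: lerXn2r; rewrite ?nnegrE ?sqrtr_ge0//; first by rewrite mulr_ge0// ltW.
rewrite -(@ger0_norm _ (_ * E)) ?mulr_ge0// ?(ltW E0)// -sqrtr_sqr ler_wsqrtr//.
rewrite exprMn /normal_peak exprVn sqr_sqrtr; last first.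
  by rewrite mulrn_wge0// mulr_ge0 ?sqr_ge0// pi_ge0.
rewrite vv -expRM_natl mulrN expRN -invfM.
rewrite -[d%:R / _]invf_div lef_pV2 ?posrE; last 2 first.
- by rewrite mulr_gt0 ?expR_gt0// mulrn_wgt0// mulr_gt0// pi_gt0.
- by rewrite divr_gt0// ltr_wpDr.
have -> : (2%:R : R) * (sqnorm x / (v * 2 * d%:R)) = sqnorm x / (v * d%:R).
  by field; rewrite !gt_eqF.
set y := sqnorm x / (v * d%:R).
have y0 : 0 <= y by rewrite divr_ge0// mulr_ge0// ltW.
have h1 : 1 + y <= expR y by exact: expR_ge1Dx.
apply: (@le_trans _ _ (v * expR y)); last first.
  rewrite ler_wpM2r ?expR_ge0// -mulrnAr -{1}[v]mulr1 ler_pM2l//.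
  by have := @pi_ge2 R; rewrite -mulr_natr => h; lra.
apply: (@le_trans _ _ (v * (1 + y))); last by rewrite ler_pM2l.
rewrite mulrDr mulr1.
have -> : v * y = sqnorm x / d%:R by rewrite /y; field; rewrite !gt_eqF.
rewrite mulrDl lerD2r ler_pdivrMr// -{1}[v]mulr1 ler_pM2l//.
by rewrite ler1n.
Qed.

(** The power - d / 2 of v + |x|^2 is split as (b - d / 2) - b. The first exponent is nonpositive,
    so v may be dropped there; the second is left for the integration in time. *)
Lemma gauss_pdf_le_powR (v b : R) (x : 'rV[R]_d) : (0 < d)%N -> 0 < v ->
  0 < sqnorm x -> b <= d%:R / 2 ->
  gauss_pdf v x <=
    d%:R `^ (d%:R / 2) * sqnorm x `^ (b - d%:R / 2) * (v + sqnorm x) `^ (- b).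
Proof.
move=> d0 v0 x0 bd; have dR : (0 : R) < d%:R by rewrite ltr0n.
have vx : 0 < v + sqnorm x by rewrite addr_gt0.
apply: (le_trans (gauss_pdf_le x d0 v0)).
rewrite -powR_mulrn ?sqrtr_ge0// -powR12_sqrt; last by rewrite divr_ge0// ltW.
rewrite -powRrM powRM ?invr_ge0 ?(ltW dR) ?(ltW vx)//.
rewrite [2^-1 * _]mulrC -mulrA ler_wpM2l ?powR_ge0//.
rewrite -powR_inv1 ?(ltW vx)// -powRrM mulN1r.
rewrite [X in _ `^ X <= _](_ : - (d%:R / 2) = (b - d%:R / 2) + - b :> R); last by ring.
rewrite powRD; last by rewrite (gt_eqF vx) implybT.
rewrite ler_wpM2r ?powR_ge0// -[b - _]opprB !powRN.
rewrite lef_pV2 ?posrE ?powR_gt0//.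
by apply: ge0_ler_powR; rewrite ?nnegrE ?subr_ge0 ?lerDr ?(ltW x0) ?(ltW vx) ?(ltW v0).
Qed.

End gaussian_bound.

(** * The path space and the law of a Wiener process *)

Section canonical_space.
Context {R : realType} {d : nat}.

Definition cpath := continuousType R 'rV[R]_d.
HB.instance Definition _ := Choice.on cpath.
HB.instance Definition _ := isPointed.Build cpath
  (cst 0 : continuousType R 'rV[R]_d).

(** Paths are total functions on [R], of which only the restriction to
    [[0, +oo[] is observed. *)
Definition evaluation_events : set (set cpath) :=
  \bigcup_(s in [set s | 0 <= s])
    preimage_set_system setT (fun c : cpath => c s) (@measurable _ (borel 'rV[R]_d)).

Definition mpath := g_sigma_algebraType evaluation_events.
HB.instance Definition _ := Measurable.on mpath.

Lemma measurable_eval (s : R) : 0 <= s ->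
  measurable_fun [set: mpath] ((fun c => (c : cpath) s) : mpath -> borel 'rV[R]_d).
Proof.
by move=> s0 _ A mA; apply: sub_sigma_algebra; exists s => //; exists A.
Qed.

Lemma measurable_fun_mpath dO (Om : measurableType dO) (X : Om -> cpath) :
  (forall s, 0 <= s -> measurable_fun setT ((fun w => X w s) : Om -> borel 'rV[R]_d)) ->
  measurable_fun setT (X : Om -> mpath).
Proof.
move=> mX; apply: (@measurability _ _ Om mpath setT X evaluation_events) => //.
move=> _ [_ [s s0 [A mA <-]] <-]; rewrite !setTI.
by rewrite -[X in measurable X]setTI; exact: mX.
Qed.

(** By continuity the value at a time is the limit of the values at the times rounded down to
    multiples of [k.+1%:R^-1], and each approximation glues countably many evaluations at fixed
    times. Negative times are sent to 0 because the sigma-algebra does not observe them. *)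
Lemma measurable_joint_eval_coord (i : 'I_d) :
  measurable_fun [set: mpath * measurableTypeR R]
    (fun p : mpath * measurableTypeR R => (p.1 : cpath) (Num.max 0 p.2) ord0 i).
Proof.
pose r (k : nat) (s : R) : R := (Num.truncn (Num.max 0 s * k.+1%:R))%:R / k.+1%:R.
have x0 (s : R) k : 0 <= Num.max 0 s * k.+1%:R by rewrite mulr_ge0// le_max lexx.
apply: (@measurable_fun_cvg _ _ _ _
  (fun k (p : mpath * measurableTypeR R) => (p.1 : cpath) (r k p.2) ord0 i)).
- move=> k; rewrite (_ : setT = \bigcup_j
    [set p : mpath * measurableTypeR R | Num.truncn (Num.max 0 p.2 * k.+1%:R) = j]); last first.
    by apply/seteqP; split=> // p _; exists (Num.truncn (Num.max 0 p.2 * k.+1%:R)).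
  have mE j : measurable [set p : mpath * measurableTypeR R | Num.truncn (Num.max 0 p.2 * k.+1%:R) = j].
    rewrite (_ : [set _ | _] = (fun p : mpath * measurableTypeR R => Num.max 0 p.2 * k.+1%:R) @^-1`
        `[j%:R, j.+1%:R[%classic).
      rewrite -[X in measurable X]setTI.
      apply: measurable_funM => //.
      by apply: measurable_maxr => //; exact: measurable_snd.
    apply/seteqP; split=> p /=; rewrite in_itv/=.
      by move=> /eqP; rewrite truncn_eq.
    by move=> h; apply/eqP; rewrite truncn_eq.
  apply/measurable_fun_bigcup => // j.
  apply: (eq_measurable_fun (fun p : mpath * measurableTypeR R => (p.1 : cpath) (j%:R / k.+1%:R) ord0 i)).
    by move=> p; rewrite inE /= /r => ->.
  apply: measurable_funTS.
  have mj := measurable_eval (divr_ge0 (ler0n R j) (ler0n R k.+1)).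
  exact: (measurableT_comp (measurable_rV_coord i) (measurableT_comp mj measurable_fst)).
- move=> [c s] _ /=.
  have cc : continuous (fun s => (c : cpath) s ord0 i).
    move=> t.
    by apply: (@continuous_comp _ _ _ (c : cpath) (fun x : 'rV[R]_d => x ord0 i));
      [exact: cts_fun|exact: coord_continuous].
  suff rs : r ^~ s @ \oo --> Num.max 0 s.
    exact: (@cvg_comp _ _ _ (r ^~ s) (fun s => (c : cpath) s ord0 i) _ _ _ rs (cc _)).
  apply: (@squeeze_cvgr _ _ _ _ (fun k => Num.max 0 s - k.+1%:R^-1) (fun=> Num.max 0 s)).
  + apply: nearW => k; rewrite /r; have /andP[h1 h2] := truncn_itv (x0 s k).
    rewrite ler_pdivrMr// h1 andbT ler_pdivlMr// mulrBl mulVf ?gt_eqF//.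
    by rewrite lerBlDr natr1 ltW.
  + rewrite -[X in _ --> X]subr0; apply: cvgB; first exact: cvg_cst.
    exact: cvg_harmonic.
  + exact: cvg_cst.
Qed.

Lemma measurable_joint_eval :
  measurable_fun [set: mpath * measurableTypeR R]
    ((fun p => (p.1 : cpath) (Num.max 0 p.2)) : mpath * measurableTypeR R -> borel 'rV[R]_d).
Proof. by apply: measurable_fun_rV => i; exact: measurable_joint_eval_coord. Qed.

(** The discontinuous paths lie in a measurable null set, on which the path is replaced by 0;
    elsewhere it is extended evenly to negative times. *)
Lemma continuous_version dO (Om : measurableType dO) (P : probability Om R)
    (B : R -> Om -> 'rV[R]_d) : wiener_process P B ->
  exists2 X : Om -> cpath, measurable_fun setT (X : Om -> mpath) &
    {ae P, forall w, X w 0 = 0 /\ forall s, 0 <= s -> X w s = B s w}.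
Proof.
move=> [mB [N0 [mN0 PN0 BN0]] [N [mN PN BN]] _ _].
have cB w : ~ N w -> continuous (fun s : R => B `|s| w).
  move=> nN; have {}nN : {within `[0, +oo[, continuous (B ^~ w)}.
    by apply: contrapT => h; apply: nN; apply: BN.
  move=> s; have /subspace_continuousP := nN => /(_ `|s|).
  rewrite /= in_itv/= andbT => /(_ (normr_ge0 _)) cs.
  suff ns : Num.norm @ s --> within `[0, +oo[ (nbhs `|s|).
    exact: (@cvg_comp _ _ _ (Num.norm : R -> R) (B ^~ w) _ _ _ ns cs).
  move=> A hA.
  have : nbhs s [set t : R | `[0, +oo[%classic `|t| -> A `|t|] :=
    @norm_continuous _ R^o s _ hA.
  apply: (@filterS _ (nbhs s)) => t /=; apply.
  by rewrite /= in_itv/= andbT.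
pose X w : cpath := if pselect (N w) is right nN then
   mkcts (cB w nN) : continuousType R 'rV[R]_d else cst 0.
have XE w s : 0 <= s -> X w s = if w \in N then 0 else B s w.
  move=> s0; rewrite /X; case: pselect => Nw.
    by rewrite mem_set.
  by rewrite memNset//= /mkcts ger0_norm.
exists X.
  apply: measurable_fun_mpath => s s0.
  rewrite (_ : (fun w => _) = (fun w => if w \in N then 0 else B s w)); last first.
    by apply/funext => w; rewrite XE.
  apply: measurable_fun_ifT; [|exact: measurable_cst|exact: mB].
  apply: (measurable_fun_bool true); rewrite setTI.
  by rewrite (_ : _ @^-1` _ = N)//; apply/seteqP; split=> w /=; [exact: set_mem|exact: mem_set].
exists (N0 `|` N); split.
- exact: measurableU.
- by rewrite (measureU0 mN0 mN PN).
- move=> w /= h; have [|nN] := pselect (N w); [by right|left].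
  apply: BN0 => /= B0; apply: h; split=> [|s s0].
    by rewrite XE// memNset.
  by rewrite XE// memNset.
Qed.

End canonical_space.

(** * Dyadic increments and uniqueness of the Wiener law *)

Section dyadic_increments.
Context {R : realType} {d : nat}.
Local Notation cpath := (@cpath R d).
Local Notation mpath := (@mpath R d).
Local Notation rV := (borel 'rV[R]_d).
Implicit Types c : cpath.

Definition grid (k i : nat) : R := i%:R / 2 ^+ k.

Lemma grid_ge0 k i : 0 <= grid k i.
Proof. by rewrite divr_ge0// exprn_ge0. Qed.

Lemma grid0 k : grid k 0 = 0. Proof. by rewrite /grid mul0r. Qed.

Lemma gridS k i : grid k.+1 (i.*2) = grid k i.
Proof.
rewrite /grid -muln2 natrM exprS; field.
by rewrite expf_neq0.
Qed.

Lemma grid_lt k i : grid k i < grid k i.+1.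
Proof. by rewrite ltr_pM2r ?invr_gt0 ?exprn_gt0// ltr_nat. Qed.

(** Index 0 stands for the initial value, so that the increments up to an index recover the values
    at the grid points by summation. *)
Definition incr (k i : nat) c : 'rV[R]_d :=
  if i is j.+1 then c (grid k j.+1) - c (grid k j) else c 0.

Definition increment_events (k : nat) : set (set cpath) :=
  [set E | exists N (A : nat -> set rV), (forall i, measurable (A i)) /\
     E = [set c | forall i, (i <= N)%N -> A i (incr k i c)]].

Lemma increment_eventsI k : setI_closed (increment_events k).
Proof.
move=> _ _ [N [A [mA ->]]] [M [B [mB ->]]].
exists (maxn N M), (fun i => (if (i <= N)%N then A i else setT) `&`
  (if (i <= M)%N then B i else setT)); split.
  by move=> i; apply: measurableI; case: ifP.
apply/seteqP; split=> [c [hA hB] i _|c h]; first split.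
- by case: ifP => // /hA.
- by case: ifP => // /hB.
split=> i iN.
  by have [] := h i (leq_trans iN (leq_maxl _ _)); rewrite iN.
by have [_] := h i (leq_trans iN (leq_maxr _ _)); rewrite iN.
Qed.

Definition grid_mpath (k : nat) := g_sigma_algebraType (increment_events k).
HB.instance Definition _ k := Measurable.on (grid_mpath k).

Lemma measurable_rVD dT (T : measurableType dT) (f g : T -> 'rV[R]_d) :
  measurable_fun setT (f : T -> rV) -> measurable_fun setT (g : T -> rV) ->
  measurable_fun setT ((fun x => f x + g x) : T -> rV).
Proof.
move=> mf mg; apply: measurable_fun_rV => i.
rewrite (_ : (fun w => _) = (fun w => f w ord0 i + g w ord0 i)); last first.
  by apply/funext => w; rewrite !mxE.
by apply: measurable_funD; apply: (measurableT_comp (measurable_rV_coord i)).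
Qed.

Lemma measurable_rVZ dT (T : measurableType dT) (a : R) (f : T -> 'rV[R]_d) :
  measurable_fun setT (f : T -> rV) ->
  measurable_fun setT ((fun x => a *: f x) : T -> rV).
Proof.
move=> mf; apply: measurable_fun_rV => i.
rewrite (_ : (fun w => _) = (fun w => a * f w ord0 i)); last first.
  by apply/funext => w; rewrite !mxE.
by apply: measurable_funM => //; apply: (measurableT_comp (measurable_rV_coord i)).
Qed.

Lemma measurable_rVB dT (T : measurableType dT) (f g : T -> 'rV[R]_d) :
  measurable_fun setT (f : T -> rV) -> measurable_fun setT (g : T -> rV) ->
  measurable_fun setT ((fun x => f x - g x) : T -> rV).
Proof.
move=> mf mg; apply: measurable_rVD => //.
under eq_fun do rewrite -scaleN1r; exact: measurable_rVZ.
Qed.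

Lemma measurable_incr k i : measurable_fun [set: grid_mpath k] (incr k i : _ -> rV).
Proof.
move=> _ A mA; rewrite setTI; apply: sub_sigma_algebra.
exists i, (fun j => if j == i then A else setT); split.
  by move=> j; case: ifP.
apply/seteqP; split=> c /=; first by move=> h j _; case: eqP => [->|].
by move=> /(_ i (leqnn i)); rewrite eqxx.
Qed.

Lemma measurable_eval_grid k i :
  measurable_fun [set: grid_mpath k] ((fun c => (c : cpath) (grid k i)) : _ -> rV).
Proof.
elim: i => [|i IH].
  rewrite (_ : (fun c => _) = incr k 0); first exact: measurable_incr.
  by apply/funext => c; rewrite /= grid0.
rewrite (_ : (fun c => _) = (fun c => incr k i.+1 c + (c : cpath) (grid k i))).
  exact: measurable_rVD (@measurable_incr k i.+1) IH.
by apply/funext => c; rewrite /= subrK.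
Qed.

Lemma increment_event_measurable k dT (T : measurableType dT) (X : T -> cpath) E :
  (forall i, measurable_fun setT ((fun w => X w (grid k i)) : T -> rV)) ->
  increment_events k E -> measurable (X @^-1` E).
Proof.
move=> mX [N [A [mA ->]]].
rewrite (_ : _ @^-1` _ = \bigcap_(i in [set i | (i <= N)%N])
  ((fun w => incr k i (X w)) @^-1` A i)); last by apply/seteqP; split.
apply: bigcap_measurableType => i _; rewrite -[X in measurable X]setTI.
suff mi : measurable_fun setT ((fun w => incr k i (X w)) : T -> rV) by exact: mi.
case: i => [|i] /=; last exact: measurable_rVB.
by have := mX 0%N; rewrite grid0.
Qed.

(** The points of the coarse grid are those of even index in the finer one, whose increments
    determine the values there. *)
Lemma grid_measurableS k (E : set cpath) :
  <<s increment_events k >> E -> <<s increment_events k.+1 >> E.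
Proof.
move: E; apply: smallest_sub; first exact: smallest_sigma_algebra.
move=> E Ek; apply: (@increment_event_measurable k _ (grid_mpath k.+1) id) => // i.
rewrite (_ : (fun w => _) = (fun c => (c : cpath) (grid k.+1 i.*2))).
  exact: measurable_eval_grid.
by apply/funext => c; rewrite gridS.
Qed.

Lemma grid_measurable_le k l (E : set cpath) : (k <= l)%N ->
  <<s increment_events k >> E -> <<s increment_events l >> E.
Proof.
move=> kl Ek; rewrite -(subnK kl); elim: (l - k)%N => [//|n IH].
by rewrite addSn; exact: grid_measurableS.
Qed.

(* The increments over one dyadic grid are independent, and the grids are nested,
   hence these events form a pi-system on which the law of a Wiener process is
   explicit. *)
Definition dyadic_events : set (set cpath) :=
  \bigcup_k <<s increment_events k >>.

Lemma dyadic_eventsI : setI_closed dyadic_events.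
Proof.
move=> A B [k _ Ak] [l _ Bl]; exists (maxn k l) => //.
apply: (@measurableI _ (grid_mpath (maxn k l))).
- exact: grid_measurable_le (leq_maxl _ _) Ak.
- exact: grid_measurable_le (leq_maxr _ _) Bl.
Qed.

(** A continuous path at time s is the limit of its values at the dyadic points just below s, so the
    dyadic events already generate every evaluation. *)
Lemma mpath_measurableE :
  (@measurable _ mpath) = <<s dyadic_events >> :> set (set mpath).
Proof.
apply/seteqP; split; last first.
  apply: smallest_sub; first exact: sigma_algebra_measurable.
  move=> E [k _]; move: E; apply: smallest_sub; first exact: sigma_algebra_measurable.
  move=> E Ek; apply: (@increment_event_measurable k _ mpath id) => // i.
  exact: measurable_eval (grid_ge0 k i).
pose D := g_sigma_algebraType dyadic_events.
have mid : measurable_fun [set: D] (id : D -> mpath).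
  apply: (@measurable_fun_mpath _ _ _ D) => s s0.
  apply: (@measurable_fun_rV _ _ _ D) => i.
  apply: (@measurable_fun_cvg _ D R setT
    (fun k (c : D) => (c : cpath) (grid k (Num.truncn (s * 2 ^+ k))) ord0 i)).
    move=> k; apply: (measurableT_comp (measurable_rV_coord i)).
    move=> _ A mA; rewrite setTI; apply: sub_sigma_algebra; exists k => //.
    have := @measurable_eval_grid k (Num.truncn (s * 2 ^+ k)) measurableT _ mA.
    by rewrite setTI.
  move=> c _ /=.
  have cc : {for s, continuous (fun s => (c : cpath) s ord0 i)}.
    by apply: (@continuous_comp _ _ _ (c : cpath) (fun x : 'rV[R]_d => x ord0 i));
      [exact: cts_fun|exact: coord_continuous].
  suff rs : (fun k => grid k (Num.truncn (s * 2 ^+ k))) @ \oo --> s.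
    exact: (@cvg_comp _ _ _ _ (fun s => (c : cpath) s ord0 i) _ _ _ rs cc).
  apply: (@squeeze_cvgr _ _ _ _ (fun k => s - 2^-1 ^+ k) (fun=> s)).
  + apply: nearW => k; rewrite /grid.
    have p0 : (0 : R) < 2 ^+ k by rewrite exprn_gt0.
    have /andP[h1 h2] := truncn_itv (mulr_ge0 s0 (ltW p0)).
    rewrite ler_pdivrMr// h1 andbT ler_pdivlMr// mulrBl exprVn mulVf ?gt_eqF//.
    by rewrite lerBlDr natr1 ltW.
  + rewrite -[X in _ --> X]subr0; apply: cvgB; first exact: cvg_cst.
    by apply: cvg_expr; rewrite ger0_norm ?invr_ge0// invf_lt1// ltr1n.
  + exact: cvg_cst.
by move=> A mA; have := mid measurableT _ mA; rewrite setTI.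
Qed.

End dyadic_increments.

Section wiener_law.
Context {R : realType} {d : nat}.
Local Notation cpath := (@cpath R d).
Local Notation mpath := (@mpath R d).
Local Notation rV := (borel 'rV[R]_d).

Definition path_of dO (Om : measurableType dO) (P : probability Om R)
    (B : R -> Om -> 'rV[R]_d) (X : Om -> cpath) :=
  measurable_fun setT (X : Om -> mpath) /\
  {ae P, forall w, X w 0 = 0 /\ forall s, 0 <= s -> X w s = B s w}.

Lemma wiener_increment_box dO (Om : measurableType dO) (P : probability Om R)
    (B : R -> Om -> 'rV[R]_d) (s t : R) (A : 'I_d -> set R) :
  wiener_process P B -> 0 <= s -> s < t -> (forall i, measurable (A i)) ->
  P [set w | forall i, A i ((B t w - B s w) ord0 i)] =
  (\prod_(i < d) normal_prob 0 (Num.sqrt (t - s)) (A i))%E.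
Proof. by case=> _ _ _ _ h s0 st mA; exact: h. Qed.

Lemma measurable_wiener_increment dO (Om : measurableType dO) (P : probability Om R)
    (B : R -> Om -> 'rV[R]_d) (s t : R) :
  wiener_process P B -> 0 <= s -> 0 <= t ->
  measurable_fun setT ((fun w => B t w - B s w) : Om -> rV).
Proof. by move=> [mB _ _ _ _] s0 t0; apply: measurable_rVB; exact: mB. Qed.

Context d1 d2 (Om : measurableType d1) (Om' : measurableType d2).
Context (P : probability Om R) (P' : probability Om' R).
Context (B : R -> Om -> 'rV[R]_d) (B' : R -> Om' -> 'rV[R]_d).

Lemma wiener_increment_unique (s t : R) (A : set rV) :
  wiener_process P B -> wiener_process P' B' -> 0 <= s -> s < t -> measurable A ->
  P [set w | A (B t w - B s w)] = P' [set w | A (B' t w - B' s w)].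
Proof.
move=> hB hB' s0 st mA; have t0 : 0 <= t by rewrite ltW// (le_lt_trans s0).
have mI := measurable_wiener_increment hB s0 t0.
have mI' := measurable_wiener_increment hB' s0 t0.
apply: (@borel_rV_measure_unique R d
  (measure_function_pushforward__canonical__measure_function_Measure P mI)
  (measure_function_pushforward__canonical__measure_function_Measure P' mI')) => //.
  by rewrite /= /pushforward preimage_setT probability_setT ltry.
move=> C mC; rewrite /= /pushforward.
exact: etrans (wiener_increment_box hB s0 st mC) (esym (wiener_increment_box hB' s0 st mC)).
Qed.
End wiener_law.

Section wiener_law_unique.
Context {R : realType} {d : nat}.
Local Notation cpath := (@cpath R d).
Local Notation mpath := (@mpath R d).
Local Notation rV := (borel 'rV[R]_d).

(** The product comes from the independence of the increments over one grid; the factor of index 0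
    is an indicator because the path starts from 0 almost surely. *)
Lemma wiener_increment_event dO (Om : measurableType dO) (P : probability Om R)
    (B : R -> Om -> 'rV[R]_d) (X : Om -> cpath) k N (A : nat -> set rV) :
  wiener_process P B -> path_of P B X -> (forall i, measurable (A i)) ->
  P (X @^-1` [set c | forall i, (i <= N)%N -> A i (incr k i c)]) =
  ((\1_(A 0%N) 0)%:E * \prod_(i < N)
     P [set w | A i.+1 (B (grid k i.+1) w - B (grid k i) w)%R])%E.
Proof.
move=> hB [mX XB] mA.
have mE : measurable (X @^-1` [set c | forall i, (i <= N)%N -> A i (incr k i c)]).
  apply: (@increment_event_measurable _ _ k) => [i|]; last by exists N, A.
  apply: (measurableT_comp (measurable_eval (grid_ge0 k i))); exact: mX.
have [A0|A0] := pselect (A 0%N 0); last first.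
  rewrite indicE memNset// mul0e -[RHS](measure0 P).
  apply: ae_iff_measure => //; apply: filterS XB => w [X0 _]; split=> //.
  by move=> /(_ 0%N (leq0n _)); rewrite /= X0.
rewrite indicE mem_set// mul1e.
have gle i : grid k i <= grid k i.+1 :> R by exact/ltW/grid_lt.
have [_ _ _ ind _] := hB.
have := ind N (grid k) (grid_ge0 k 0) gle (fun i => A i.+1) (fun i => mA i.+1).
move=> <-.
apply: ae_iff_measure => //.
  rewrite (_ : [set _ | _] = \bigcap_(i in [set: 'I_N])
    ((fun w => B (grid k i.+1) w - B (grid k i) w) @^-1` A i.+1)); last first.
    by apply/seteqP; split=> [w h i _|w h i]; exact: h.
  apply: fin_bigcap_measurable => // i _; rewrite -[X in measurable X]setTI.
  exact: (measurable_wiener_increment hB (grid_ge0 k i) (grid_ge0 k i.+1)).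
apply: filterS XB => w [X0 XB]; split=> [h i|h [|i] iN] /=.
- by have := h i.+1 (ltn_ord i); rewrite /= !XB ?grid_ge0.
- by rewrite X0.
- by have := h (Ordinal iN); rewrite /= !XB ?grid_ge0.
Qed.

Context d1 d2 (Om : measurableType d1) (Om' : measurableType d2).
Context (P : probability Om R) (P' : probability Om' R).
Context (B : R -> Om -> 'rV[R]_d) (B' : R -> Om' -> 'rV[R]_d).

(** Uniqueness of measures on a pi-system is applied twice: over the union of the dyadic levels,
    then inside one level, whose generating events have an explicit probability. *)
Lemma wiener_law_unique (X : Om -> cpath) (X' : Om' -> cpath) (E : set mpath) :
  wiener_process P B -> wiener_process P' B' -> path_of P B X -> path_of P' B' X' ->
  measurable E -> P (X @^-1` E) = P' (X' @^-1` E).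
Proof.
move=> hB hB' hX hX' mE; have [mX _] := hX; have [mX' _] := hX'.
pose m1 := measure_function_pushforward__canonical__measure_function_Measure P mX.
pose m2 := measure_function_pushforward__canonical__measure_function_Measure P' mX'.
have m1oo : (m1 setT < +oo)%E.
  by rewrite /= /pushforward preimage_setT probability_setT ltry.
have iT k : increment_events k [set: cpath].
  by exists 0%N, (fun=> setT); split=> //; apply/seteqP; split.
have DT : dyadic_events [set: cpath] by exists 0%N => //; apply: sub_sigma_algebra.
have cT (T : Type) (A : set T) : \bigcup_(_ : nat) [set: T] = [set: T].
  by apply/seteqP; split=> // x _; exists 0%N.
apply: (@measure_unique _ R mpath dyadic_events (fun=> setT) mpath_measurableE
  dyadic_eventsI (fun=> DT) (cT _ _) m1 m2) => // A [k _ Ak].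
apply: (@g_sigma_algebra_measure_unique _ R mpath (increment_events k) _
  (fun=> setT) (fun=> iT k) (cT _ _) m1 m2) => //.
- move=> C Ck; rewrite mpath_measurableE; apply: sub_sigma_algebra; exists k => //.
  exact: sub_sigma_algebra.
- exact: increment_eventsI.
- move=> _ [N [C [mC ->]]]; rewrite /m1 /m2 /= /pushforward.
  rewrite (wiener_increment_event _ _ hB hX mC) (wiener_increment_event _ _ hB' hX' mC).
  congr (_ * _)%E; apply: eq_bigr => i _.
  exact: (wiener_increment_unique hB hB' (grid_ge0 k i) (grid_lt k i)).
Qed.

End wiener_law_unique.

(** * Brownian scaling *)

Section scaling.
Context {R : realType}.
Local Notation mu := (@lebesgue_measure R).
Local Open Scope ereal_scope.

Lemma measurable_scale (a : R) :
  measurable_fun [set: measurableTypeR R] (fun x : measurableTypeR R => (a * x)%R : measurableTypeR R).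
Proof. exact: (@measurable_funM _ R R setT (cst a) id). Qed.

Lemma lebesgue_measure_scale (a : R) (A : set (measurableTypeR R)) : (0 < a)%R ->
  measurable A -> mu A = a%:E * mu ((fun x => (a * x)%R) @^-1` A).
Proof.
move=> a0 mA.
pose m : {measure set (measurableTypeR R) -> \bar R} :=
  mscale (NngNum (ltW a0)) (measure_function_pushforward__canonical__measure_function_Measure
    mu (measurable_scale a)).
transitivity (m A); last by rewrite /m /= /mscale /= /pushforward.
apply: lebesgue_measure_unique => // _ [[x y] _ <-].
rewrite /m /= /mscale /= /pushforward.
rewrite (_ : _ @^-1` _ = `](x / a)%R, (y / a)%R]%classic); last first.
  apply/seteqP; split=> z /=; rewrite !in_itv/= ltr_pdivrMr// ler_pdivlMr// [(z * a)%R]mulrC//.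
rewrite !lebesgue_measure_itv/= !lte_fin ltr_pM2r ?invr_gt0//.
case: ifP => _; last by rewrite mule0.
by rewrite -!EFinB -EFinM; congr EFin; field; rewrite gt_eqF.
Qed.

Lemma ge0_integral_scale (a : R) (D : set R) (f : R -> \bar R) : (0 < a)%R ->
  measurable D -> measurable_fun D f -> (forall x, 0 <= f x) ->
  \int[mu]_(x in D) f x = a%:E * \int[mu]_(x in (fun x => (a * x)%R) @^-1` D) f (a * x)%R.
Proof.
move=> a0 mD mf f0.
pose m : {measure set (measurableTypeR R) -> \bar R} :=
  mscale (NngNum (ltW a0)) (measure_function_pushforward__canonical__measure_function_Measure
    mu (measurable_scale a)).
rewrite (eq_measure_integral m); last first.
  by move=> A mA _; exact: (lebesgue_measure_scale a0 mA).
rewrite ge0_integral_mscale//.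
congr (_ * _).
by rewrite (ge0_integral_pushforward (measurable_scale a)).
Qed.

Lemma normal_prob_scale (a s : R) (A : set R) : (0 < a)%R -> (0 < s)%R ->
  measurable A ->
  normal_prob 0 (a * s)%R ((fun y => (a^-1 * y)%R) @^-1` A) = normal_prob 0 s A.
Proof.
move=> a0 s0 mA; rewrite /normal_prob.
have mA' : measurable ((fun y : R => (a^-1 * y)%R) @^-1` A).
  have : measurable_fun [set: R] (fun y : R => a^-1 * y)%R.
    exact: (@measurable_funM _ R R setT (cst a^-1%R) id).
  by move=> /(_ measurableT _ mA); rewrite setTI.
rewrite (ge0_integral_scale a0 mA'); last 2 first.
- by apply/measurable_EFinP; apply: measurable_funTS; exact: measurable_normal_pdf.
- by move=> x; rewrite lee_fin normal_pdf_ge0.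
rewrite [X in integral _ X _](_ : _ = A); last first.
  by apply/seteqP; split=> x /=; rewrite mulKf// gt_eqF.
rewrite -ge0_integralZl//; last 3 first.
- apply/measurable_EFinP; apply: measurable_funTS.
  apply: (measurableT_comp (@measurable_normal_pdf R 0 (a * s)%R)).
  exact: measurable_scale.
- by move=> x _; rewrite lee_fin normal_pdf_ge0.
- by rewrite lee_fin ltW.
apply: eq_integral => x _; rewrite -EFinM !normal_pdfE ?mulf_neq0 ?gt_eqF//; congr EFin.
rewrite /normal_peak /normal_fun mulrA; congr (_ * expR _)%R.
  rewrite exprMn -mulrA -mulrnAr sqrtrM ?sqr_ge0// sqrtr_sqr gtr0_norm//.
  by rewrite invfM mulrA divff ?mul1r// gt_eqF.
rewrite !subr0 !exprMn -mulrnAr -mulrN -mulf_div divff ?mul1r//.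
by rewrite expf_neq0// gt_eqF.
Qed.

End scaling.

Section brownian_scaling.
Context {R : realType} {d : nat}.
Local Notation cpath := (@cpath R d).
Local Notation mpath := (@mpath R d).
Local Notation rV := (borel 'rV[R]_d).
Context (a : R) (a0 : 0 < a).

Lemma continuous_scale_path (c : cpath) :
  continuous (fun s : R => (Num.sqrt a)^-1 *: (c : cpath) (a * s)).
Proof.
move=> s; apply: cvgZr.
apply: (@continuous_comp _ _ _ (fun s : R => a * s) (c : cpath)).
  exact: mulrl_continuous.
exact: cts_fun.
Qed.

Definition scale_path (c : cpath) : cpath :=
  mkcts (@continuous_scale_path c) : continuousType R 'rV[R]_d.

Lemma measurable_scale_path : measurable_fun setT (scale_path : mpath -> mpath).
Proof.
apply: (@measurable_fun_mpath _ _ _ mpath) => s s0.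
apply: (@measurable_rVZ _ _ _ mpath (Num.sqrt a)^-1 (fun c : mpath => (c : cpath) (a * s))).
by apply: measurable_eval; rewrite mulr_ge0// ltW.
Qed.

Context dO (Om : measurableType dO) (P : probability Om R).
Context (B : R -> Om -> 'rV[R]_d) (hB : wiener_process P B).

Definition scale_process (s : R) (w : Om) := (Num.sqrt a)^-1 *: B (a * s) w.

Lemma wiener_scale : wiener_process P scale_process.
Proof.
have [mB B0 cB indB incB] := hB; have sa0 : 0 < Num.sqrt a by rewrite sqrtr_gt0.
have incE s t w : scale_process t w - scale_process s w =
    (Num.sqrt a)^-1 *: (B (a * t) w - B (a * s) w) by rewrite scalerBr.
split.
- by move=> t t0; apply: measurable_rVZ; apply: mB; rewrite mulr_ge0// ltW.
- by apply: filterS B0 => w /= B0; rewrite /scale_process mulr0 B0 scaler0.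
- apply: filterS cB => w /subspace_continuousP cB; apply/subspace_continuousP => s s0.
  apply: cvgZr.
  have as0 : `[0, +oo[%classic (a * s).
    by move: s0; rewrite /= !in_itv/= !andbT => s0; rewrite mulr_ge0// ltW.
  suff h : (fun s : R => a * s) @ within `[0, +oo[ (nbhs s) --> within `[0, +oo[ (nbhs (a * s)).
    exact: (@cvg_comp _ _ _ (fun s : R => a * s) (B ^~ w) _ _ _ h (cB _ as0)).
  move=> A hA.
  have : nbhs s [set t : R | `[0, +oo[%classic (a * t) -> A (a * t)] :=
    @mulrl_continuous _ a s _ hA.
  rewrite /= /within /=; apply: (@filterS _ (nbhs s)) => t /= h t0; apply: h.
  by move: t0; rewrite !in_itv/= !andbT => t0; rewrite mulr_ge0// ltW.
- move=> k t t0 tS A mA.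
  have mA' i : measurable ((fun x : rV => ((Num.sqrt a)^-1 *: x) : rV) @^-1` A i).
    have := @measurable_rVZ R d _ rV (Num.sqrt a)^-1 id (@measurable_id _ _ _).
    by move=> /(_ measurableT _ (mA i)); rewrite setTI.
  have := indB k (fun i => a * t i) _ _ (fun i =>
    ((fun x : rV => ((Num.sqrt a)^-1 *: x) : rV) @^-1` A i)) mA'.
  rewrite mulr_ge0// ?(ltW a0)// => /(_ isT).
  have -> : [set w | forall i, A i (scale_process (t i.+1) w - scale_process (t i) w)] =
    [set w | forall i, ((fun x : rV => (Num.sqrt a)^-1 *: x) @^-1` A i)
      (B (a * t i.+1) w - B (a * t i) w)].
    by apply/seteqP; split=> w h i; have := h i; rewrite /= incE.
  move=> -> //; last by move=> i; rewrite ler_pM2l.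
  by apply: eq_bigr => i _; congr (P _); apply/seteqP; split=> w /=; rewrite incE.
- move=> s t s0 st A mA.
  pose A' i := (fun y : R => (Num.sqrt a)^-1 * y) @^-1` A i.
  have mA' i : measurable (A' i).
    have : measurable_fun [set: R] (fun y : R => (Num.sqrt a)^-1 * y).
      exact: (@measurable_funM _ R R setT (cst (Num.sqrt a)^-1) id).
    by move=> /(_ measurableT _ (mA i)); rewrite setTI.
  have -> : [set w | forall i, A i ((scale_process t w - scale_process s w) ord0 i)] =
    [set w | forall i, A' i ((B (a * t) w - B (a * s) w) ord0 i)].
    by apply/seteqP; split=> w h i; have := h i; rewrite /A' /= incE [fun_of_matrix (_ *: _) _ _]mxE.
  have as0 : 0 <= a * s by rewrite mulr_ge0// ltW.
  have ast : a * s < a * t by rewrite ltr_pM2l.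
  apply: (etrans (incB _ _ as0 ast A' mA')).
  apply: eq_bigr => i _; rewrite -mulrBr sqrtrM; last exact: ltW.
  by apply: normal_prob_scale => //; rewrite sqrtr_gt0 subr_gt0.
Qed.

Lemma path_of_scale (X : Om -> cpath) : path_of P B X ->
  path_of P scale_process (scale_path \o X).
Proof.
move=> [mX XB]; split; first exact: (measurableT_comp measurable_scale_path mX).
apply: filterS XB => w [X0 XB]; split=> [|s s0] /=.
  by rewrite /mkcts mulr0 X0 scaler0.
by rewrite /mkcts /scale_process XB// mulr_ge0// ltW.
Qed.

End brownian_scaling.

(** * Occupation times *)

Section occupation.
Context {R : realType} {d : nat}.
Local Notation cpath := (@cpath R d).
Local Notation mpath := (@mpath R d).
Local Notation rV := (borel 'rV[R]_d).
Local Notation mu := (@lebesgue_measure R).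
Local Open Scope ereal_scope.

Lemma ge0_integral_indic dT (T : measurableType dT) (m : {measure set T -> \bar R})
    (D : set T) (f : T -> \bar R) :
  \int[m]_(x in D) f x = \int[m]_x (f x * (\1_D x)%:E).
Proof.
rewrite integral_mkcond; apply: eq_integral => x _.
by rewrite patchE indicE; case: ifP => _; rewrite ?mule1 ?mule0.
Qed.

Lemma measurable_joint_scale (n : R) :
  measurable_fun [set: mpath * measurableTypeR R]
    ((fun p => (p.1 : cpath) (Num.max 0 (n * p.2))%R) : mpath * measurableTypeR R -> rV).
Proof.
apply: (measurableT_comp (@measurable_joint_eval R d)
  (g := fun p : mpath * measurableTypeR R => (p.1, (n * p.2)%R))).
apply/measurable_fun_pair; first exact: measurable_fst.
exact: (measurable_funM (measurable_cst n) measurable_snd).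
Qed.

Lemma measurable_fun_invr dT (T : measurableType dT) (f : T -> R) :
  measurable_fun setT f -> (forall x, (0 <= f x)%R) ->
  measurable_fun setT (fun x => (f x)^-1%R).
Proof.
move=> mf f0; under eq_fun do rewrite -powR_inv1//.
exact: (measurableT_comp (@measurable_powR R (-1)) mf).
Qed.

Lemma measurable_normal_pdf_comp dT (T : measurableType dT) (f g : T -> R) :
  measurable_fun setT f -> measurable_fun setT g ->
  measurable_fun setT (fun x => normal_pdf 0 (f x) (g x)).
Proof.
move=> mf mg; have m2 : measurable_fun setT (fun x => f x ^+ 2)%R by exact: measurable_funX.
(* At standard deviation 0 the density is defined separately, as an indicator. *)
apply: measurable_fun_ifT.
- exact: measurable_fun_eqr.
- apply: (measurableT_comp _ mg); exact: measurable_indic.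
- apply: measurable_funM.
    apply: measurable_fun_invr; last by move=> x; exact: sqrtr_ge0.
    apply: (measurableT_comp (continuous_measurable_fun (@sqrt_continuous R))).
    under eq_fun do rewrite -mulr_natr -mulrA.
    exact: measurable_funM.
  apply: (measurableT_comp (@measurable_expR R)).
  apply: measurable_funM.
    under eq_fun do rewrite subr0 -mulN1r.
    by apply: measurable_funM => //; exact: measurable_funX.
  apply: measurable_fun_invr; last by move=> x; rewrite mulrn_wge0// sqr_ge0.
  under eq_fun do rewrite -mulr_natr.
  exact: measurable_funM.
Qed.

Lemma measurable_gauss_pdf_joint (n : R) :
  measurable_fun [set: measurableTypeR R * rV]
    (fun p : measurableTypeR R * rV => gauss_pdf (n * p.1)%R (p.2 : 'rV[R]_d)).
Proof.
apply: (@measurable_prod _ _ _ _ _ _ (fun (i : 'I_d) (p : measurableTypeR R * rV) =>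
  normal_pdf 0 (Num.sqrt (n * p.1)) ((p.2 : 'rV[R]_d) ord0 i))) => i _.
apply: measurable_normal_pdf_comp.
  apply: (measurableT_comp (continuous_measurable_fun (@sqrt_continuous R))).
  exact: (measurable_funM (measurable_cst n) measurable_fst).
exact: (measurableT_comp (measurable_rV_coord i) measurable_snd).
Qed.

Lemma measurable_cpath (c : cpath) : measurable_fun [set: measurableTypeR R]
  ((c : R -> 'rV[R]_d) : measurableTypeR R -> rV).
Proof.
apply: measurable_fun_rV => i; apply: continuous_measurable_fun => t.
by apply: (@continuous_comp _ _ _ (c : cpath) (fun x : 'rV[R]_d => x ord0 i));
  [exact: cts_fun|exact: coord_continuous].
Qed.

Context dO (Om : measurableType dO) (P : probability Om R).
Context (B : R -> Om -> 'rV[R]_d) (hB : wiener_process P B).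
Context (X : Om -> cpath) (hX : path_of P B X).

Lemma path_expectation (t : R) (h : 'rV[R]_d -> R) : (0 < t)%R ->
  measurable_fun [set: rV] (h : rV -> R) -> (forall x, (0 <= h x)%R) ->
  \int[P]_w (h (X w t))%:E =
  \int[lebesgue_rV]_x ((h x)%:E * (gauss_pdf t x)%:E).
Proof.
move=> t0 mh h0; have [mX XB] := hX.
have mhE : measurable_fun [set: rV] (fun x : rV => (h x)%:E) by exact/measurable_EFinP.
rewrite -(wiener_expectation hB t0 mhE); last by move=> x; rewrite lee_fin.
apply: ge0_ae_eq_integral => //.
- apply: (measurableT_comp mhE).
  exact: (measurableT_comp (measurable_eval (ltW t0)) mX).
- by apply: (measurableT_comp mhE); exact: (wiener_measurable hB (ltW t0)).
- by move=> w _; rewrite lee_fin.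
- by move=> w _; rewrite lee_fin.
- by apply: filterS XB => w [_ XB] _; rewrite XB// ltW.
Qed.

Lemma measurable_occupation (n : R) (h : 'rV[R]_d -> R) :
  measurable_fun [set: rV] (h : rV -> R) ->
  measurable_fun [set: Om * measurableTypeR R]
    (fun p : Om * measurableTypeR R => (h (X p.1 (Num.max 0 (n * p.2))%R))%:E).
Proof.
move=> mh; have [mX XB] := hX.
have mhE : measurable_fun [set: rV] (fun x : rV => (h x)%:E) by exact/measurable_EFinP.
apply: (measurableT_comp mhE).
apply: (measurableT_comp (measurable_joint_scale n)
  (g := fun p : Om * measurableTypeR R => ((X p.1 : mpath), p.2))).
apply/measurable_fun_pair; last exact: measurable_snd.
exact: (measurableT_comp mX measurable_fst).
Qed.

(** Along with the exchange of integrals, time 0 is discarded: it has measure zero, and the Gaussian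
    density is available at positive times only. *)
Lemma occupation_tonelli (n U : R) (h : 'rV[R]_d -> R) : (0 < n)%R ->
  measurable_fun [set: rV] (h : rV -> R) -> (forall x, (0 <= h x)%R) ->
  \int[P]_w \int[mu]_(s in `[0%R, U]) (h (X w (n * s)%R))%:E =
  \int[mu]_(s in `]0%R, U]) \int[P]_w (h (X w (n * s)%R))%:E.
Proof.
move=> n0 mh h0.
pose D : set (measurableTypeR R) := `]0%R, U]%classic.
have mD : measurable D by exact: measurable_itv.
have mhE : measurable_fun [set: rV] (fun x : rV => (h x)%:E) by exact/measurable_EFinP.
have mDE : measurable_fun [set: measurableTypeR R] (fun s : measurableTypeR R => (\1_D s : R)%:E).
  apply/(@measurable_EFinP _ (measurableTypeR R) R setT (\1_D)).
  exact: measurable_indic.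
(* The truncation [Num.max 0] changes nothing on [D]; it is the form in which evaluation is jointly
   measurable. *)
pose F (p : Om * measurableTypeR R) :=
  (h (X p.1 (Num.max 0 (n * p.2))%R))%:E * (\1_D p.2)%:E.
have F0 p : 0 <= F p by rewrite mule_ge0// lee_fin.
have mF : measurable_fun setT F.
  apply: emeasurable_funM; first exact: measurable_occupation.
  exact: (measurableT_comp mDE measurable_snd).
transitivity (\int[P]_w \int[mu]_s F (w, s)).
  apply: eq_integral => w _.
  have mw : measurable_fun [set: measurableTypeR R]
      (fun s : measurableTypeR R => (h (X w (n * s)%R))%:E).
    apply: (measurableT_comp mhE).
    apply: (measurableT_comp (measurable_cpath (X w))).
    exact: (measurable_funM (measurable_cst n) (@measurable_id _ _ _)).
  transitivity (\int[mu]_(s in D) (h (X w (n * s)%R))%:E).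
    by rewrite -integral_itv_obnd_cbnd//; exact: measurable_funTS.
  rewrite ge0_integral_indic; apply: eq_integral => s _; rewrite /F /= !indicE.
  have [sD|sD] := boolP (s \in D); last by rewrite !mule0.
  congr ((h (X w _))%:E * _); rewrite max_r// mulr_ge0// ?(ltW n0)//.
  by move: sD; rewrite inE /D /= in_itv/= => /andP[/ltW].
rewrite fubini_tonelli// -/D [RHS]ge0_integral_indic; apply: eq_integral => s _.
rewrite /F /=; have [sD|sD] := boolP (s \in D); last first.
  rewrite !indicE (negbTE sD) mule0.
  by rewrite integral0_eq// => x _; rewrite mule0.
have s0 : (0 < s)%R by move: sD; rewrite inE /D /= in_itv/= => /andP[].
rewrite !indicE sD mule1.
by under eq_integral do rewrite mule1 max_r ?mulr_ge0 ?(ltW n0) ?(ltW s0)//.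
Qed.

(** The time integral of the density is the Green function of the process run up to time [U]. The
    exchange of time and space goes through tuples, where the Lebesgue measure has a sigma-finite
    structure. *)
Lemma occupation_formula (n U : R) (h : 'rV[R]_d -> R) : (0 < n)%R ->
  measurable_fun [set: rV] (h : rV -> R) -> (forall x, (0 <= h x)%R) ->
  \int[P]_w \int[mu]_(s in `[0%R, U]) (h (X w (n * s)%R))%:E =
  \int[lebesgue_rV]_x ((h x)%:E * \int[mu]_(s in `]0%R, U]) (gauss_pdf (n * s) x)%:E).
Proof.
move=> n0 mh h0; rewrite occupation_tonelli//.
have [m mE] := lebesgue_tuple_sigma_finite_measure R d.
pose D : set (measurableTypeR R) := `]0%R, U]%classic.
have mD : measurable D by exact: measurable_itv.
have mhE : measurable_fun [set: rV] (fun x : rV => (h x)%:E) by exact/measurable_EFinP.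
have mDE : measurable_fun [set: measurableTypeR R] (fun s : measurableTypeR R => (\1_D s : R)%:E).
  apply/(@measurable_EFinP _ (measurableTypeR R) R setT (\1_D)).
  exact: measurable_indic.
pose G (p : measurableTypeR R * rV) :=
  (\1_D p.1 : R)%:E * ((h p.2)%:E * (gauss_pdf (n * p.1) (p.2 : 'rV[R]_d))%:E).
have G0 p : 0 <= G p by rewrite !mule_ge0// lee_fin ?gauss_pdf_ge0.
have mG : measurable_fun setT G.
  apply: emeasurable_funM; first exact: (measurableT_comp mDE measurable_fst).
  apply: emeasurable_funM; first exact: (measurableT_comp mhE measurable_snd).
  by apply/measurable_EFinP; exact: measurable_gauss_pdf_joint.
pose row (t : d.-tuple R) : rV := \row_i tnth t i.
pose Gr (p : measurableTypeR R * d.-tuple R) := G (p.1, row p.2).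
have mGr : measurable_fun setT Gr.
  apply: (measurableT_comp mG).
  apply/measurable_fun_pair; first exact: measurable_fst.
  exact: (measurableT_comp (@rV_of_tuple_measurable R d) measurable_snd).
transitivity (\int[mu]_s \int[m]_t Gr (s, t)).
  rewrite -/D ge0_integral_indic; apply: eq_integral => s _.
  rewrite /Gr /G /=; have [sD|sD] := boolP (s \in D); last first.
    rewrite !indicE (negbTE sD) mule0.
    by rewrite integral0_eq// => x _; rewrite mul0e.
  have s0 : (0 < s)%R by move: sD; rewrite inE /D /= in_itv/= => /andP[].
  rewrite !indicE sD mule1.
  under [RHS]eq_integral do rewrite mul1e.
  rewrite path_expectation ?mulr_gt0//.
  rewrite (integral_lebesgue_rV mE)//.
    apply: emeasurable_funM => //.
    by apply/measurable_EFinP; exact: measurable_gauss_pdf.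
  by move=> x; rewrite mule_ge0// lee_fin// gauss_pdf_ge0.
have Gr0 p : 0 <= Gr p by exact: G0.
rewrite fubini_tonelli//.
have GE x : \int[mu]_s G (s, x) =
    (h x)%:E * \int[mu]_(s in `]0%R, U]) (gauss_pdf (n * s) (x : 'rV[R]_d))%:E.
  rewrite -/D [X in _ * X]ge0_integral_indic -ge0_integralZl//; last 3 first.
  - apply: emeasurable_funM => //; apply/measurable_EFinP.
    exact: (measurable_fun_pair1 x (measurable_gauss_pdf_joint n)).
  - by move=> s _; rewrite mule_ge0// lee_fin// gauss_pdf_ge0.
  - by rewrite lee_fin.
  by apply: eq_integral => s _; rewrite /G /= muleC muleA.
under [RHS]eq_integral do rewrite -GE.
rewrite (integral_lebesgue_rV mE)//.
- exact: (measurable_fun_fubini_tonelli_G (m1 := mu) G).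
- by move=> x; apply: integral_ge0.
Qed.

End occupation.

(** * Bounds on the truncated Green function *)

Section green.
Context {R : realType} {d : nat}.
Local Notation mu := (@lebesgue_measure R).
Local Notation rV := (borel 'rV[R]_d).
Local Open Scope ereal_scope.

Lemma integral_powR_affine_oc (n q b U : R) : (0 < n)%R -> (0 < q)%R -> b != 1%R ->
  (0 < U)%R ->
  \int[mu]_(s in `]0%R, U]) ((n * s + q) `^ (- b))%:E =
  (((n * U + q) `^ (1 - b) - q `^ (1 - b)) / (n * (1 - b)))%:E.
Proof.
move=> n0 q0 b1 U0; rewrite -integral_powR_affine// integral_itv_obnd_cbnd//.
apply: measurable_funTS; apply/measurable_EFinP.
apply: (measurableT_comp (@measurable_powR R (- b))).
exact: (measurable_funD (measurable_funM (measurable_cst n) (@measurable_id _ _ _)) (measurable_cst q)).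
Qed.

Lemma green_le (n U b : R) (x : 'rV[R]_d) : (0 < d)%N -> (0 < n)%R -> (0 < U)%R ->
  (0 < sqnorm x)%R -> (b <= d%:R / 2)%R -> b != 1%R ->
  \int[mu]_(s in `]0%R, U]) (gauss_pdf (n * s) x)%:E <=
  (d%:R `^ (d%:R / 2) * sqnorm x `^ (b - d%:R / 2) *
   (((n * U + sqnorm x) `^ (1 - b) - sqnorm x `^ (1 - b)) / (n * (1 - b))))%:E.
Proof.
move=> d0 n0 U0 x0 bd b1.
have m1 : measurable_fun [set: measurableTypeR R] (fun s : measurableTypeR R => (gauss_pdf (n * s) x)%:E).
  apply/measurable_EFinP.
  exact: (measurable_fun_pair1 (x : rV) (measurable_gauss_pdf_joint n)).
have m2 : measurable_fun [set: measurableTypeR R]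
    (fun s : measurableTypeR R => ((n * s + sqnorm x) `^ (- b))%:E).
  apply/measurable_EFinP.
  apply: (measurableT_comp (@measurable_powR R (- b))).
  exact: (measurable_funD (measurable_funM (measurable_cst n) (@measurable_id _ _ _)) (measurable_cst _)).
rewrite EFinM -integral_powR_affine_oc//.
rewrite -ge0_integralZl//; last 3 first.
- exact: measurable_funTS.
- by move=> s _; rewrite lee_fin powR_ge0.
- by rewrite lee_fin mulr_ge0 ?powR_ge0.
apply: ge0_le_integral => //.
- by move=> s _; rewrite lee_fin gauss_pdf_ge0.
- exact: measurable_funTS.
- apply: measurable_funTS; exact: (emeasurable_funM (measurable_cst _) m2).
- move=> s; rewrite /= in_itv/= => /andP[s0 _]; rewrite -EFinM lee_fin.
  by apply: gauss_pdf_le_powR => //; rewrite mulr_gt0.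
Qed.

Lemma measurable_green (n U : R) : measurable_fun [set: rV] (fun x : rV =>
  \int[mu]_(s in `]0%R, U]) (gauss_pdf (n * s) (x : 'rV[R]_d))%:E).
Proof.
pose D : set (measurableTypeR R) := `]0%R, U]%classic.
have mD : measurable D by exact: measurable_itv.
have mDE : measurable_fun [set: measurableTypeR R] (fun s : measurableTypeR R => (\1_D s : R)%:E).
  apply/(@measurable_EFinP _ (measurableTypeR R) R setT (\1_D)).
  exact: measurable_indic.
pose G (p : measurableTypeR R * rV) := (gauss_pdf (n * p.1) (p.2 : 'rV[R]_d))%:E * (\1_D p.1 : R)%:E.
under eq_fun do rewrite ge0_integral_indic.
apply: (measurable_fun_fubini_tonelli_G (m1 := mu) G).
  apply: emeasurable_funM; last exact: (measurableT_comp mDE measurable_fst).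
  by apply/measurable_EFinP; exact: measurable_gauss_pdf_joint.
by move=> p; rewrite mule_ge0// lee_fin// gauss_pdf_ge0.
Qed.

Lemma sqnorm_enorm_powR (x : 'rV[R]_d) (p : R) : (sqnorm x `^ p = enorm x `^ (2 * p))%R.
Proof.
by rewrite -sqr_enorm -powR_mulrn ?sqrtr_ge0// -powRrM.
Qed.

Lemma enorm_ge0 (x : 'rV[R]_d) : (0 <= enorm x)%R.
Proof. exact: sqrtr_ge0. Qed.

Lemma sqnorm_gt0 (x : 'rV[R]_d) : x != 0%R -> (0 < sqnorm x)%R.
Proof.
move=> x0; rewrite lt_def sqnorm_ge0 andbT; apply: contra x0 => /eqP sx.
apply/eqP/rowP => i; rewrite mxE; apply/eqP; rewrite -sqrf_eq0; apply/eqP.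
by apply: (psumr_eq0P _ sx) => // j _; exact: sqr_ge0.
Qed.

Lemma green_le_gt2 (n U : R) (x : 'rV[R]_d) : (2 < d)%N -> (0 < n)%R -> (0 < U)%R ->
  x != 0%R ->
  \int[mu]_(s in `]0%R, U]) (gauss_pdf (n * s) x)%:E <=
  (d%:R `^ (d%:R / 2) * 2 / n * enorm x `^ (2 - d%:R))%:E.
Proof.
move=> d2 n0 U0 /sqnorm_gt0 x0.
apply: le_trans (@green_le n U (3 / 2)%R x _ n0 U0 x0 _ _) _.
- exact: ltn_trans d2.
- by rewrite ler_pM2r ?invr_gt0// ler_nat.
- by rewrite gt_eqF//; lra.
rewrite lee_fin -mulrA -[leRHS]mulrA -[leRHS]mulrA ler_wpM2l ?powR_ge0//.
have -> : (1 - 3 / 2 = - 2^-1 :> R)%R by field.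
rewrite (_ : _ / (n * _) = 2 / n * (sqnorm x `^ (- 2^-1) - (n * U + sqnorm x) `^ (- 2^-1)))%R; last first.
  by field; rewrite gt_eqF.
rewrite mulrCA [leRHS]mulrA ler_wpM2l ?divr_ge0 ?(ltW n0)//.
have -> : (enorm x `^ (2 - d%:R) = sqnorm x `^ (3 / 2 - d%:R / 2) * sqnorm x `^ (- 2^-1))%R.
  rewrite -powRD; last by rewrite (gt_eqF x0) implybT.
  by rewrite sqnorm_enorm_powR; congr (_ `^ _)%R; field.
by rewrite ler_wpM2l ?powR_ge0// gerBl powR_ge0.
Qed.

Lemma green_le_2 (n U A g : R) (x : 'rV[R]_d) : d = 2%N -> (0 < n)%R -> (0 < U)%R ->
  (0 < g < 1 / 2)%R -> x != 0%R -> (enorm x <= A)%R ->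
  \int[mu]_(s in `]0%R, U]) (gauss_pdf (n * s) x)%:E <=
  (d%:R `^ (d%:R / 2) * ((n * U + A ^+ 2) `^ g / (n * g)) * enorm x `^ (- (2 * g)))%:E.
Proof.
move=> d2 n0 U0 /andP[g0 g1] /sqnorm_gt0 x0 xA.
have dd : (d%:R / 2 = 1 :> R)%R by rewrite d2 divff.
(* With d / 2 = 1 this exponent produces exactly the weight |x|^(- 2 g); the bound on |x| serves to
   make the remaining power of n U + |x|^2 independent of x. *)
apply: le_trans (@green_le n U (1 - g)%R x _ n0 U0 x0 _ _) _.
- by rewrite d2.
- by rewrite dd lerBlDr lerDl ltW.
- by rewrite lt_eqF// gtrBl.
rewrite lee_fin -mulrA -[leRHS]mulrA ler_wpM2l ?powR_ge0// dd.
have -> : (1 - g - 1 = - g :> R)%R by ring.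
have -> : (1 - (1 - g) = g :> R)%R by ring.
rewrite sqnorm_enorm_powR mulrN mulrC ler_wpM2r ?powR_ge0//.
rewrite ler_wpM2r ?invr_ge0 ?mulr_ge0 ?(ltW g0) ?(ltW n0)//.
rewrite lerBlDr ler_wpDr ?powR_ge0//.
have A0 : (0 <= A)%R := le_trans (enorm_ge0 x) xA.
apply: ge0_ler_powR; rewrite ?nnegrE ?addr_ge0 ?mulr_ge0 ?sqnorm_ge0 ?sqr_ge0 ?(ltW g0) ?(ltW n0) ?(ltW U0)//.
by rewrite lerD2l -sqr_enorm lerXn2r// nnegrE ?enorm_ge0.
Qed.

End green.

Section occupation_near_origin.
Context {R : realType} {d : nat}.
Local Notation cpath := (@cpath R d).
Local Notation mu := (@lebesgue_measure R).
Local Notation rV := (borel 'rV[R]_d).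

Lemma measurable_enorm : measurable_fun [set: rV] ((@enorm R d) : rV -> R).
Proof.
apply: (measurableT_comp (continuous_measurable_fun (@sqrt_continuous R))).
apply: (@measurable_sum _ _ _ _ _ _ (fun (i : 'I_d) (x : rV) => (x : 'rV[R]_d) ord0 i ^+ 2)) => i.
by apply: measurable_funX; exact: measurable_rV_coord.
Qed.

Definition eball (A : R) : set 'rV[R]_d := [set x | enorm x <= A].

Lemma measurable_eball A : measurable (eball A : set rV).
Proof.
rewrite (_ : eball A = (@enorm R d : rV -> R) @^-1` `]-oo, A]%classic).
  by rewrite -[X in measurable X]setTI; apply: measurable_enorm => //; exact: measurable_itv.
by apply/seteqP; split=> x /=; rewrite in_itv.
Qed.

Lemma lebesgue_rV_origin : (0 < d)%N -> lebesgue_rV ([set 0] : set rV) = 0%E.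
Proof.
move=> d0; have := @lebesgue_rV_box R d (fun=> [set 0]) (fun=> measurable_set1 _).
rewrite (_ : [set x | _] = [set 0]); last first.
  apply/seteqP; split=> x /=; first by move=> h; apply/rowP => i; rewrite mxE h.
  by move=> -> i; rewrite mxE.
by move=> ->; rewrite (bigD1 (Ordinal d0))//= lebesgue_measure_set1 mul0e.
Qed.

Lemma measurable_origin : measurable ([set 0] : set rV).
Proof.
have := @measurable_rV_box R d (fun=> [set 0]) (fun=> measurable_set1 _).
congr measurable; apply/seteqP; split=> x /=; first by move=> h; apply/rowP => i; rewrite mxE h.
by move=> -> i; rewrite mxE.
Qed.

Context dO (Om : measurableType dO) (P : probability Om R).
Context (B : R -> Om -> 'rV[R]_d) (hB : wiener_process P B).
Context (X : Om -> cpath) (hX : path_of P B X).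

Section weighted.
Local Open Scope ereal_scope.
Context (lam : 'rV[R]_d -> R) (lam_gt0 : forall x, (0 < lam x)%R).
Context (mlam : measurable_fun [set: rV] (lam : rV -> R)).

Definition ball_weight (A : R) (x : 'rV[R]_d) : R := (\1_(eball A) x * (lam x)^-1)%R.

Lemma ball_weight_ge0 A x : (0 <= ball_weight A x)%R.
Proof. by rewrite mulr_ge0// invr_ge0 ltW. Qed.

Lemma measurable_lamV : measurable_fun [set: rV] (fun x : rV => (lam x)^-1)%R.
Proof. by apply: measurable_fun_invr => // x; rewrite ltW. Qed.

Lemma measurable_ball_weight A : measurable_fun [set: rV] (ball_weight A : rV -> R).
Proof.
apply: measurable_funM; last exact: measurable_lamV.
by apply: measurable_indic; exact: measurable_eball.
Qed.

(** The bound on the Green function is asked off the origin only, since the power takes a default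
    value there; the origin is a null set in positive dimension. *)
Lemma occupation_weight_le (n U A a K : R) : (0 < d)%N -> (0 < n)%R -> (0 <= K)%R ->
  (forall x : 'rV[R]_d, x != 0%R -> (enorm x <= A)%R ->
    \int[mu]_(s in `]0%R, U]) (gauss_pdf (n * s) x)%:E <= (K * enorm x `^ a)%:E) ->
  \int[P]_w \int[mu]_(s in `[0%R, U]) (ball_weight A (X w (n * s)%R))%:E <=
  K%:E * \int[lebesgue_rV]_(x in [set x : rV | (enorm x <= A)%R])
    ((lam x)^-1 * (enorm x `^ a))%:E.
Proof.
move=> d0 n0 K0 gK.
rewrite (occupation_formula hB hX _ n0 (measurable_ball_weight A) (ball_weight_ge0 A)).
have mG := @measurable_green R d n U.
have mW : measurable_fun [set: rV] (fun x : rV => (ball_weight A x)%:E).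
  by apply/measurable_EFinP; exact: measurable_ball_weight.
have mR : measurable_fun [set: rV] (fun x : rV => ((lam x)^-1 * (enorm x `^ a))%:E).
  apply/measurable_EFinP; apply: measurable_funM; first exact: measurable_lamV.
  exact: (measurableT_comp (@measurable_powR R a) measurable_enorm).
have mE := measurable_eball A.
rewrite -ge0_integralZl; last 4 first.
- exact: mE.
- exact: measurable_funTS.
- by move=> x _; rewrite lee_fin mulr_ge0 ?powR_ge0// invr_ge0 ltW.
- by rewrite lee_fin.
rewrite [leRHS]ge0_integral_indic.
have G0 x : 0 <= \int[mu]_(s in `]0%R, U]) (gauss_pdf (n * s) (x : 'rV[R]_d))%:E.
  by apply: integral_ge0 => s _; rewrite lee_fin gauss_pdf_ge0.
apply: ae_ge0_le_integral => //.
- by move=> x _; rewrite mule_ge0 ?lee_fin ?ball_weight_ge0.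
- exact: emeasurable_funM.
- by move=> x _; rewrite !mule_ge0// lee_fin// mulr_ge0 ?powR_ge0// invr_ge0 ltW.
- apply: emeasurable_funM.
    by apply: emeasurable_funM => //; exact: measurable_cst.
  apply/measurable_EFinP; exact: measurable_indic.
exists ([set (0 : 'rV[R]_d)%R] : set rV); split; [exact: measurable_origin|exact: lebesgue_rV_origin|].
move=> x /= h; apply: contrapT => x0; apply: h => _.
rewrite /ball_weight indicE; have [xA|xA] := boolP (x \in _); last first.
  by rewrite mul0r mul0e mule0.
rewrite mul1r mule1 -EFinM mulrCA EFinM lee_wpmul2l ?lee_fin ?invr_ge0 ?(ltW (lam_gt0 _))//.
apply: gK; first exact/eqP.
by move: xA; rewrite inE.
Qed.

Lemma occupation_vanishes (A U : R) : (2 <= d)%N -> (0 < A)%R -> (0 < U)%R ->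
  (d = 2%N -> exists g : R, (0 < g < 1 / 2)%R /\ forall r : R, (0 < r)%R ->
      (\int[lebesgue_rV]_(x in [set x : borel 'rV[R]_d | (enorm x <= r)%R])
        ((lam x)^-1 * (enorm x `^ (- (2 * g))))%:E < +oo)%E) ->
  ((2 < d)%N -> forall r : R, (0 < r)%R ->
      (\int[lebesgue_rV]_(x in [set x : borel 'rV[R]_d | (enorm x <= r)%R])
        ((lam x)^-1 * (enorm x `^ (2 - d%:R)))%:E < +oo)%E) ->
  exists c : R, forall n : R, (1 <= n)%R ->
    \int[P]_w \int[mu]_(s in `[0%R, U]) (ball_weight A (X w (n * s)%R))%:E <=
    (c / Num.sqrt n)%:E.
Proof.
move=> d2 A0 U0 h2 h3; have d0 : (0 < d)%N by exact: leq_trans d2.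
have fin a r : (\int[lebesgue_rV]_(x in [set x : borel 'rV[R]_d | (enorm x <= r)%R])
        ((lam x)^-1 * (enorm x `^ a))%:E < +oo)%E ->
   exists2 I : R, (0 <= I)%R & \int[lebesgue_rV]_(x in [set x : borel 'rV[R]_d | (enorm x <= r)%R])
        ((lam x)^-1 * (enorm x `^ a))%:E = I%:E.
  set J := integral _ _ _ => Joo; have J0 : 0 <= J.
    by apply: integral_ge0 => x _; rewrite lee_fin mulr_ge0 ?powR_ge0// invr_ge0 ltW.
  by exists (fine J); [exact: fine_ge0|rewrite fineK// ge0_fin_numE].
have sqrtn n : (1 <= n)%R -> (1 <= Num.sqrt n)%R.
  by move=> n1; rewrite -[leLHS]sqrtr1 ler_wsqrtr.
have [dE|d3] := eqVneq d 2%N.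
  have [g [/[dup] g01 /andP[g0 g1] /(_ A A0)/fin[I I0 IE]]] := h2 dE.
  (* For n >= 1, n U + A^2 <= n (U + A^2 + 1), and g < 1 / 2 gives n^g / n <= 1 / sqrt n. *)
  exists (d%:R `^ (d%:R / 2) * ((U + A ^+ 2 + 1) `^ g / g) * I)%R => n n1.
  have n0 : (0 < n)%R by exact: lt_le_trans n1.
  have := @occupation_weight_le n U A (- (2 * g))%R
    (d%:R `^ (d%:R / 2) * ((n * U + A ^+ 2) `^ g / (n * g)))%R d0 n0 _
    (fun x x0 xA => green_le_2 dE n0 U0 g01 x0 xA).
  have K0 : (0 <= d%:R `^ (d%:R / 2) * ((n * U + A ^+ 2) `^ g / (n * g)))%R.
    by rewrite mulr_ge0 ?divr_ge0 ?powR_ge0 ?mulr_ge0 ?(ltW n0) ?(ltW g0).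
  move=> /(_ K0) /le_trans; apply; rewrite IE -EFinM lee_fin.
  rewrite [leRHS]mulrAC ler_wpM2r// -[leRHS]mulrA ler_wpM2l ?powR_ge0//.
  have U2 : (0 <= U + A ^+ 2 + 1)%R by rewrite !addr_ge0 ?sqr_ge0 ?(ltW U0).
  have ng : (n `^ g <= Num.sqrt n)%R.
    by rewrite -powR12_sqrt ?(ltW n0)// ler_powR// ltW// -div1r.
  apply: (@le_trans _ _ ((n * (U + A ^+ 2 + 1)) `^ g / (n * g)))%R.
    rewrite ler_wpM2r ?invr_ge0 ?mulr_ge0 ?(ltW n0) ?(ltW g0)//.
    apply: ge0_ler_powR; rewrite ?nnegrE ?addr_ge0 ?mulr_ge0 ?sqr_ge0 ?(ltW n0) ?(ltW U0) ?(ltW g0) ?(ltW A0)//.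
    have A2 := sqr_ge0 A.
    have : (0 <= (n - 1) * A ^+ 2)%R by rewrite mulr_ge0// subr_ge0.
    by nra.
  rewrite powRM ?(ltW n0)// [leRHS]mulrAC ler_pdivrMr ?mulr_gt0//.
  have sn0 : (0 < Num.sqrt n)%R by rewrite sqrtr_gt0.
  rewrite -{3}[n]sqr_sqrtr ?(ltW n0)// expr2.
  rewrite (_ : _ / _ * _ = Num.sqrt n * (U + A ^+ 2 + 1) `^ g)%R; last first.
    by field; rewrite !gt_eqF.
  by rewrite ler_wpM2r ?powR_ge0.
have d3' : (2 < d)%N by rewrite ltn_neqAle eq_sym d3.
have [I I0 IE] := fin _ _ (h3 d3' A A0).
(* The decay is of order 1 / n here; it is weakened to 1 / sqrt n to have one rate for all
   dimensions. *)
exists (d%:R `^ (d%:R / 2) * 2 * I)%R => n n1.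
have n0 : (0 < n)%R by exact: lt_le_trans n1.
have := @occupation_weight_le n U A (2 - d%:R)%R
    (d%:R `^ (d%:R / 2) * 2 / n)%R d0 n0 _
    (fun x x0 xA => green_le_gt2 d3' n0 U0 x0).
have K0 : (0 <= d%:R `^ (d%:R / 2) * 2 / n)%R.
  by rewrite divr_ge0 ?mulr_ge0 ?powR_ge0 ?(ltW n0).
move=> /(_ K0) /le_trans; apply; rewrite IE -EFinM lee_fin.
rewrite [leRHS]mulrAC ler_wpM2r// ler_wpM2l ?mulr_ge0 ?powR_ge0//.
rewrite lef_pV2 ?posrE ?sqrtr_gt0// -{2}[n]sqr_sqrtr ?(ltW n0)// expr2.
by rewrite ler_peMl ?sqrtr_ge0// sqrtn.
Qed.

End weighted.
End occupation_near_origin.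

(** * Time spent in a ball *)

Section small_ball.
Context {R : realType} {d : nat}.
Local Notation cpath := (@cpath R d).
Local Notation mu := (@lebesgue_measure R).
Local Notation rV := (borel 'rV[R]_d).
Local Open Scope ereal_scope.

Lemma normal_prob_sym_itv_le (A s : R) : (0 <= A)%R -> s != 0%R ->
  normal_prob 0 s (`[(- A)%R, A]%classic : set R) <= (2 * A * normal_peak s)%:E.
Proof.
move=> A0 s0; rewrite /normal_prob.
apply: (@le_trans _ _ (\int[mu]_(x in `[(- A)%R, A]) (normal_peak s)%:E)).
  apply: ge0_le_integral => //.
  - by move=> x _; rewrite lee_fin normal_pdf_ge0.
  - by apply/measurable_EFinP; apply: measurable_funTS; exact: measurable_normal_pdf.
  - by move=> x _; rewrite lee_fin normal_pdf_ub.
rewrite integral_cst//= lebesgue_measure_itv/= lte_fin.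
case: ifPn => h; last by rewrite mule0 lee_fin !mulr_ge0// normal_peak_ge0.
by rewrite -EFinB -EFinM lee_fin le_eqVlt; apply/orP; left; apply/eqP; ring.
Qed.

Context dO (Om : measurableType dO) (P : probability Om R).
Context (B : R -> Om -> 'rV[R]_d) (hB : wiener_process P B).
Context (X : Om -> cpath) (hX : path_of P B X).

(** The ball lies in the slab where one coordinate is at most A in absolute value, whose probability
    is at most 2 A times the peak of the density. The summands 1 and 2 are there for times t <= 1,
    where the right-hand side is at least 1, and they leave a bound without singularity at time
    0. *)
Lemma small_ball_prob (A t : R) : (0 < d)%N -> (0 <= A)%R -> (0 < t)%R ->
  \int[P]_w (\1_(eball A) (X w t))%:E <= ((2 * A + 2) * (t + 1) `^ (- 2^-1))%:E.
Proof.
move=> d0 A0 t0; have [mX XB] := hX.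
have mXt : measurable_fun setT ((fun w => X w t) : Om -> rV).
  exact: (measurableT_comp (measurable_eval (ltW t0)) mX).
have mE : measurable ((fun w => X w t) @^-1` eball A).
  by rewrite -[X in measurable X]setTI; exact: (mXt measurableT _ (measurable_eball A)).
have -> : \int[P]_w (\1_(eball A) (X w t))%:E = P ((fun w => X w t) @^-1` eball A).
  rewrite -[in RHS](setIT (_ @^-1` _)) -integral_indic//.
have t10 : (0 < t + 1)%R by rewrite addr_gt0.
rewrite powRN powR12_sqrt ?(ltW t10)//.
have st0 : (0 < Num.sqrt (t + 1))%R by rewrite sqrtr_gt0.
have [t1|t1] := leP t 1%R.
  apply: (@le_trans _ _ 1); first exact: probability_le1.
  rewrite lee_fin ler_pdivlMr// mul1r.
  apply: (@le_trans _ _ 2%R); last by rewrite lerDr mulr_ge0.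
  rewrite -[leRHS]ger0_norm// -sqrtr_sqr ler_wsqrtr//.
  by rewrite expr2; lra.
pose i0 := Ordinal d0.
pose C (i : 'I_d) : set R := if i == i0 then `[(- A)%R, A]%classic else setT.
have mC i : measurable (C i) by rewrite /C; case: ifP => _; [exact: measurable_itv|exact: measurableT].
have mBt := wiener_measurable hB (ltW t0).
have mbox (Y : Om -> 'rV[R]_d) : measurable_fun setT (Y : Om -> rV) ->
    measurable [set w | forall i, C i (Y w ord0 i)].
  by move=> mY; rewrite -[X in measurable X]setTI; exact: (mY measurableT _ (measurable_rV_box mC)).
apply: (@le_trans _ _ (P [set w | forall i, C i (X w t ord0 i)])).
  apply: le_measure; rewrite ?inE//; first exact: mbox.
  move=> w /= xA i; rewrite /C; case: eqP => [_|//].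
  rewrite /= in_itv/= -ler_norml; apply: le_trans xA.
  rewrite -sqrtr_sqr ler_wsqrtr// (bigD1 i)//= lerDl.
  by apply: sumr_ge0 => j _; exact: sqr_ge0.
have -> : P [set w | forall i, C i (X w t ord0 i)] = P [set w | forall i, C i (B t w ord0 i)].
  apply: ae_iff_measure; [exact: mbox|exact: mbox|].
  by apply: filterS XB => w [_ XB]; rewrite /= XB// ltW.
rewrite (wiener_law_box hB t0 mC) (bigD1 i0)//= big1 ?mule1; last first.
  by move=> i ii0; rewrite /C (negbTE ii0) [LHS]probability_setT.
rewrite /C eqxx; apply: (le_trans (normal_prob_sym_itv_le A0 _)).
  by rewrite gt_eqF// sqrtr_gt0.
rewrite lee_fin ler_pM ?mulr_ge0 ?normal_peak_ge0// ?lerDl//.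
rewrite /normal_peak lef_pV2 ?posrE//; last first.
  by rewrite sqrtr_gt0 mulrn_wgt0// mulr_gt0 ?pi_gt0// exprn_gt0// sqrtr_gt0.
rewrite ler_wsqrtr// sqr_sqrtr ?(ltW t0)// -mulr_natr.
by have := @pi_ge2 R; nra.
Qed.

Lemma small_ball_occupation (A U : R) : (0 < d)%N -> (0 <= A)%R -> (0 < U)%R ->
  exists c : R, forall n : R, (1 <= n)%R ->
    \int[P]_w \int[mu]_(s in `[0%R, U]) (\1_(eball A) (X w (n * s)%R))%:E <=
    (c / Num.sqrt n)%:E.
Proof.
(* The integral of (n s + 1)^(-1/2) over [0, U] is at most 2 sqrt (n U + 1) / n, hence at most 2
   sqrt (U + 1) / sqrt n. *)
move=> d0 A0 U0; exists ((2 * A + 2) * (2 * Num.sqrt (U + 1)))%R => n n1.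
have n0 : (0 < n)%R by exact: lt_le_trans n1.
have mI : measurable_fun [set: rV] (\1_(eball A) : rV -> R).
  by apply: measurable_indic; exact: measurable_eball.
rewrite (occupation_tonelli hX _ n0 mI)//.
have mP : measurable_fun `]0%R, U] (fun s : measurableTypeR R =>
    \int[P]_w (\1_(eball A) (X w (n * s)%R))%:E).
  apply: (@eq_measurable_fun _ _ _ _ _ (fun s : measurableTypeR R =>
      \int[P]_w (\1_(eball A) (X w (Num.max 0 (n * s))%R))%:E)).
    move=> s; rewrite inE /= in_itv/= => /andP[s0 _].
    by apply: eq_integral => w _; rewrite max_r// mulr_ge0// ltW.
  apply: measurable_funTS.
  apply: (measurable_fun_fubini_tonelli_G (m1 := P)
    (fun p : Om * measurableTypeR R => (\1_(eball A) (X p.1 (Num.max 0 (n * p.2))%R))%:E)).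
    exact: (measurable_occupation hX n mI).
  by move=> p; rewrite lee_fin.
have m2 : measurable_fun [set: measurableTypeR R]
    (fun s : measurableTypeR R => ((n * s + 1) `^ (- 2^-1))%:E).
  apply/measurable_EFinP.
  apply: (measurableT_comp (@measurable_powR R (- 2^-1))).
  exact: (measurable_funD (measurable_funM (measurable_cst n) (@measurable_id _ _ _)) (measurable_cst _)).
apply: (@le_trans _ _ (\int[mu]_(s in `]0%R, U]) ((2 * A + 2)%:E * ((n * s + 1) `^ (- 2^-1))%:E))).
  apply: ge0_le_integral => //.
  - by move=> s _; apply: integral_ge0 => w _; rewrite lee_fin.
  - by apply: measurable_funTS; exact: (emeasurable_funM (measurable_cst _) m2).
  - move=> s; rewrite /= in_itv/= => /andP[s0 _]; rewrite -EFinM.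
    by apply: small_ball_prob => //; rewrite mulr_gt0.
rewrite ge0_integralZl//; last 3 first.
- exact: measurable_funTS.
- by move=> s _; rewrite lee_fin powR_ge0.
- by rewrite lee_fin addr_ge0// mulr_ge0.
rewrite integral_powR_affine_oc//; last by rewrite lt_eqF//; lra.
rewrite -EFinM lee_fin -[leRHS]mulrA ler_wpM2l ?addr_ge0 ?mulr_ge0//.
have -> : (1 - 2^-1 = 2^-1 :> R)%R by field.
rewrite powR1 !powR12_sqrt ?addr_ge0 ?mulr_ge0 ?(ltW n0) ?(ltW U0)//.
have sn0 : (0 < Num.sqrt n)%R by rewrite sqrtr_gt0.
have -> : (2 * Num.sqrt (U + 1) / Num.sqrt n = (Num.sqrt n * Num.sqrt (U + 1)) / (n * 2^-1))%R.
  by rewrite -{3}[n]sqr_sqrtr ?(ltW n0)//; field; rewrite gt_eqF.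
rewrite ler_wpM2r ?invr_ge0 ?mulr_ge0 ?(ltW n0)//.
rewrite -sqrtrM ?(ltW n0)// lerBlDr ler_wpDr// ler_wsqrtr//.
by nra.
Qed.

End small_ball.

(** * Clocks and their inverses *)

Section path_topology.
Context {R : realType} {d : nat}.
Local Notation rV := (borel 'rV[R]_d).

(** Only one of the two points is confined to the segment, so a perturbed time does not have to be
    located; compactness is used in its near-covering form. *)
Lemma uniform_continuity_segment (g : R -> 'rV[R]_d) (a b e : R) :
  continuous g -> 0 < e ->
  exists2 r : R, 0 < r & forall x y, x \in `[a, b] -> `|x - y| < r -> `|g x - g y| < e.
Proof.
move=> cg e0; have e2 : 0 < e / 2 by rewrite divr_gt0.
have := @segment_compact R a b; rewrite compact_near_coveringP => cov.
have /cov : forall x, `[a, b]%classic x -> \forall x' \near x & r \near 0^'+,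
    forall y, `|x' - y| < r -> `|g x' - g y| < e.
  move=> x _; have /cvgrPdist_lt/(_ _ e2) := cg x.
  move=> /nbhs_ballP[r /= r0 gr]; have r2 : 0 < r / 2 by rewrite divr_gt0.
  exists (ball x (r / 2), `]0, (r / 2)[%classic); first split.
  - by apply/nbhs_ballP; exists (r / 2).
  - by exists (r / 2) => // z /=; rewrite sub0r normrN in_itv/= => + z0; rewrite gtr0_norm// z0.
  move=> [x' r'] /= []; rewrite /ball/= in_itv/= => xx' /andP[_ rr'] y x'y.
  rewrite -(subrKA (g x)) (le_lt_trans (ler_normD _ _))// (splitr e) ltrD//.
    rewrite distrC; apply: gr; rewrite /ball/= (lt_trans xx')//.
    by rewrite ltr_pdivrMr// mulr_natr mulr2n ltrDl.
  apply: gr; rewrite /ball /= -(subrKA x') (le_lt_trans (ler_normD _ _))//.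
  by rewrite (splitr r) ltrD// (lt_trans x'y).
move=> [r /= r0 hr]; exists (r / 2); first by rewrite divr_gt0.
move=> x y xab; apply: hr => //=; last by rewrite divr_gt0.
by rewrite sub0r normrN gtr0_norm ?divr_gt0// ltr_pdivrMr// mulr_natr mulr2n ltrDl.
Qed.

Context {T : R}.
Local Notation PS := (path_space d T).

Lemma nbhs_path_space (f : PS) (U : set PS) : nbhs f U ->
  exists2 r : R, 0 < r & forall g : PS, (forall t, `|f t - g t| < r) -> U g.
Proof.
rewrite -nbhs_entourageE => -[E [V [W entW WV] VE] EU].
move: entW; rewrite -entourage_ballE => -[r /= r0 rW].
exists r => // g fg; apply: EU; apply/xsectionP; apply: VE; apply: WV => t.
apply: rW => /=; rewrite -ball_normE; exact: fg.
Qed.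

Lemma rV_norm_lt (x : 'rV[R]_d) (e : R) : 0 < e -> (forall i, `|x ord0 i| < e) -> `|x| < e.
Proof.
move=> e0 xe; rewrite -[x]subr0.
suff : ball x e (0 : 'rV[R]_d) by rewrite -ball_normE.
by split=> // i j; rewrite ord1 /ball/= mxE subr0; exact: xe.
Qed.

Lemma continuous_norm_rV : continuous (fun x : 'rV[R]_d => `|x| : R).
Proof. exact: norm_continuous. Qed.

Context (T0 : 0 <= T).

Definition clamp (t : R) : R := Num.min (Num.max 0 t) T.

Lemma clamp_in t : clamp t \in (`[0, T]%classic : set R).
Proof. by rewrite inE /= in_itv/= /clamp le_min le_max lexx T0/= ge_min lexx orbT. Qed.

Lemma clampK t : 0 <= t -> t <= T -> clamp t = t.
Proof. by move=> t0 tT; rewrite /clamp max_r// min_l. Qed.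

(** A retraction of the line onto the segment, through which a path on the segment becomes a
    continuous function of a real time. *)
Definition pt (t : R) : set_type (`[0, T]%classic : set R) := exist _ (clamp t) (clamp_in t).

Lemma pt_val (t : set_type (`[0, T]%classic : set R)) : pt (\val t) = t.
Proof.
apply: val_inj => /=; rewrite clampK//;
  by have := set_valP t; rewrite /= in_itv/= => /andP[].
Qed.

Lemma pt_continuous : continuous pt.
Proof.
apply: continuous_comp_initial => t /=.
apply: continuous_min; last exact: cvg_cst.
by apply: continuous_max; [exact: cvg_cst|exact: cvg_id].
Qed.

Lemma path_pt_continuous (f : PS) : continuous (fun t => f (pt t)).
Proof.
by move=> t; apply: continuous_comp; [exact: pt_continuous|exact: cts_fun].
Qed.

(** A code [D] = (m, a, k) describes the step function of mesh 1 / (m + 1) with the rational values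
    listed in a, and a precision 1 / (k + 1). There are countably many codes, which expresses
    separability; testing at rational times only makes the condition a countable intersection. *)
Definition path_near (f : PS) (D : nat * seq 'rV[rat]_d * nat) : Prop :=
  forall q : rat, `|f (pt (ratr q)) -
    map_mx ratr (nth 0 D.1.2 (Num.truncn (clamp (ratr q) * D.1.1.+1%:R)))| <= D.2.+1%:R^-1 :> R.

(** Uniform continuity gives a mesh over which the path moves by less than half the precision; the
    rational approximation of the grid values takes the other half. *)
Lemma path_near_ex (f : PS) (k : nat) : exists2 D, path_near f D & D.2 = k.
Proof.
have e0 : (0 : R) < k.+1%:R^-1 / 2 by rewrite divr_gt0// invr_gt0.
have [r r0 fr] := uniform_continuity_segment 0 T (@path_pt_continuous f) e0.
have [m _ /(_ m (leqnn m)) /= mr] := near_infty_natSinv_lt (PosNum r0).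
have /choice[a aP] (j : nat) : exists a : 'rV[rat]_d,
    `|f (pt (j%:R / m.+1%:R)) - map_mx ratr a| < k.+1%:R^-1 / 2.
  have /choice[q qP] (i : 'I_d) : exists q : rat,
      ratr q \in `](f (pt (j%:R / m.+1%:R)) ord0 i - k.+1%:R^-1 / 2), (f (pt (j%:R / m.+1%:R)) ord0 i)[.
    by apply: rat_in_itvoo; rewrite gtrBl.
  exists (\row_i q i); apply: rV_norm_lt => // i; rewrite !mxE.
  have := qP i; rewrite in_itv/= => /andP[q1 q2].
  by rewrite gtr0_norm ?subr_gt0// ltrBlDr addrC -ltrBlDr.
exists (m, mkseq a (Num.truncn (T * m.+1%:R)).+1, k) => //= q.
have := clamp_in (ratr q); rewrite inE /= in_itv/=.
set x := clamp (ratr q) => /andP[x0 xT].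
have xm0 : 0 <= x * m.+1%:R by rewrite mulr_ge0.
have /andP[j1 j2] := truncn_itv xm0; set j := Num.truncn (x * m.+1%:R) in j1 j2 *.
rewrite nth_mkseq; last first.
  by rewrite ltnS; apply: le_truncn; rewrite ler_wpM2r.
rewrite -(subrKA (f (pt (j%:R / m.+1%:R)))) (le_trans (ler_normD _ _))//.
rewrite (splitr k.+1%:R^-1) lerD//; last exact: ltW.
have -> : pt (ratr q) = pt x by apply: val_inj; rewrite /= (clampK x0 xT).
apply/ltW/fr; first by rewrite in_itv/= x0.
apply: le_lt_trans mr.
rewrite ger0_norm; last by rewrite subr_ge0 ler_pdivrMr.
rewrite [leRHS](_ : _ = j.+1%:R / m.+1%:R - j%:R / m.+1%:R); last first.
  by rewrite -mulrBl -[j.+1%:R]natr1 addrAC subrr add0r mul1r.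
by rewrite lerB// ler_pdivlMr// ltW.
Qed.

(** The triangle inequality through the step function gives the bound at rational times; a violation
    would hold on a nonempty open set of times, which contains a rational. *)
Lemma path_near_dist (f g : PS) D : path_near f D -> path_near g D ->
  forall t, `|f t - g t| <= 2 * D.2.+1%:R^-1.
Proof.
move=> fD gD t; rewrite leNgt; apply/negP => h.
pose F (x : R) : R := `|f (pt x) - g (pt x)|.
have cF : continuous F.
  move=> x; apply: (@continuous_comp _ _ _ (fun x => f (pt x) - g (pt x)) (fun x : 'rV[R]_d => `|x| : R)).
    by apply: cvgB; exact: path_pt_continuous.
  exact: continuous_norm_rV.
have oF : open (F @^-1` [set y | 2 * D.2.+1%:R^-1 < y]).
  by apply: open_comp; [move=> x _; exact: cF|exact: open_gt].
have [] := @dense_rat R (F @^-1` [set y | 2 * D.2.+1%:R^-1 < y]).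
- by exists (\val t); rewrite /F/= pt_val.
- exact: oF.
move=> x [/= Fq [q _ qE]]; move: Fq; rewrite -qE /F ltNge => /negP; apply.
rewrite -(subrKA (map_mx ratr (nth 0 D.1.2 (Num.truncn (clamp (ratr q) * D.1.1.+1%:R))))).
rewrite (le_trans (ler_normD _ _))// mulr_natl mulr2n lerD//.
by rewrite distrC; exact: gD.
Qed.

(** Every open set is a countable union of sets of paths near one code, so the Borel sets of the
    uniform topology are generated by the evaluations. *)
Lemma measurable_fun_path_space dO (Om : measurableType dO) (Y : Om -> PS) :
  (forall t, measurable_fun setT ((fun w => Y w t) : Om -> rV)) ->
  measurable_fun setT (Y : Om -> borel PS).
Proof.
move=> mY; apply: (@measurability _ _ Om (borel PS) setT Y (@open PS)) => //.
move=> _ [U oU <-]; rewrite setTI.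
pose V D := if `[< (fun f => path_near f D) `<=` U >] then
  [set w | path_near (Y w) D] else set0.
rewrite (_ : _ @^-1` _ = \bigcup_D V D).
  apply: countable_bigcupT_measurable => // D; rewrite /V; case: ifP => // _.
  rewrite -[X in measurable X]setCK; apply: measurableC.
  rewrite (_ : ~` _ = \bigcup_q ~` [set w |
    `|Y w (pt (ratr q)) - map_mx ratr (nth 0 D.1.2 (Num.truncn (clamp (ratr q) * D.1.1.+1%:R)))| <=
      D.2.+1%:R^-1 :> R]); last first.
    apply/seteqP; split=> [w /existsNP[q h]|w [q _ h] w']; first by exists q.
    by apply: h; exact: w'.
  apply: countable_bigcupT_measurable => // q; apply: measurableC.
  set a := map_mx _ _.
  have mq : measurable_fun setT ((fun w => Y w (pt (ratr q)) - a) : Om -> rV).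
    by apply: measurable_rVB; [exact: mY|exact: measurable_cst].
  have mn : measurable_fun [set: rV] ((fun x : rV => `|(x : 'rV[R]_d)|) : rV -> R).
    by apply: continuous_borel_measurable; exact: continuous_norm_rV.
  rewrite (_ : [set w | _] = (fun w => `|Y w (pt (ratr q)) - a|) @^-1` `]-oo, D.2.+1%:R^-1]%classic).
    rewrite -[X in measurable X]setTI.
    by apply: (measurableT_comp mn mq) => //; exact: measurable_itv.
  by apply/seteqP; split=> w /=; rewrite in_itv.
apply/seteqP; split=> [w Uw|w [D _]]; last first.
  by rewrite /V; case: asboolP => // DU; exact: DU.
have [r r0 rU] := nbhs_path_space (open_nbhs_nbhs (conj oU Uw)).
have r2 : 0 < r / 2 by rewrite divr_gt0.
have [k _ /(_ k (leqnn k)) /= kr] := near_infty_natSinv_lt (PosNum r2).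
have [D DY Dk] := path_near_ex (Y w) k.
exists D => //; rewrite /V; case: asboolP => // -[] f fD; apply: rU => t.
apply: (le_lt_trans (path_near_dist DY fD t)).
by rewrite Dk mulrC -ltr_pdivlMr.
Qed.

End path_topology.

(** * First passage times of increasing clocks *)

Section first_passage.
Context {R : realType}.
Implicit Types (F : R -> \bar R) (t u p : R).

Definition first_passage F t : R :=
  fine (ereal_inf [set u%:E | u in [set u : R | 0 < u /\ (t%:E < F u)%E]]).

Lemma first_passageE F t p : 0 <= p -> (forall u, p < u -> (t%:E < F u)%E) ->
  (forall u, 0 < u < p -> (F u <= t%:E)%E) -> first_passage F t = p.
Proof.
move=> p0 Fp Fle; rewrite /first_passage.
set S := [set _ | _ in _]; suff -> : ereal_inf S = p%:E by [].
apply/eqP; rewrite eq_le; apply/andP; split.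
  apply/lee_addgt0Pr => e e0; apply: ereal_inf_lbound; exists (p + e) => //=.
  by split; [rewrite ltr_wpDl|apply: Fp; rewrite ltrDl].
apply: le_ereal_inf_tmp => _ [u [u0 Fu] <-]; rewrite lee_fin leNgt; apply/negP => up.
by move: Fu; rewrite ltNge Fle// u0.
Qed.

(** Strict growth makes the passage times continuous in the level, unboundedness makes them
    finite. *)
Definition passable F : Prop :=
  (forall u v, 0 <= u -> u < v -> (F u < F v)%E) /\ (forall t, exists2 u, 0 < u & (t%:E < F u)%E).

Section passable.
Context F (hF : passable F).
Let p t := first_passage F t.

Lemma first_passage_prop t :
  [/\ 0 <= p t, forall u, p t < u -> (t%:E < F u)%E & forall u, 0 < u < p t -> (F u <= t%:E)%E].
Proof.
have [Flt Fub] := hF; rewrite /p /first_passage.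
set S := [set u : R | 0 < u /\ (t%:E < F u)%E].
have [v v0 Fv] := Fub t.
have i0 : (0 <= ereal_inf [set u%:E | u in S])%E.
  by apply: le_ereal_inf_tmp => _ [u [u0 _] <-]; rewrite lee_fin ltW.
have ifin : (ereal_inf [set u%:E | u in S] < +oo)%E.
  by apply: (@le_lt_trans _ _ v%:E); [apply: ereal_inf_lbound; exists v|exact: ltry].
have iE : ereal_inf [set u%:E | u in S] = (fine (ereal_inf [set u%:E | u in S]))%:E.
  by rewrite fineK// ge0_fin_numE.
split; first exact: fine_ge0.
  move=> u; rewrite -lte_fin -iE => /ereal_inf_lt[_ [w [w0 Fw] <-]].
  by rewrite lte_fin => wu; apply: (lt_trans Fw); apply: Flt => //; exact: ltW.
move=> u /andP[u0]; rewrite -lte_fin -iE => up; rewrite leNgt; apply/negP => Fu.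
by move: up; apply/negP; rewrite -leNgt; apply: ereal_inf_lbound; exists u.
Qed.

Lemma first_passage_ge0 t : 0 <= p t. Proof. by have [] := first_passage_prop t. Qed.

Lemma first_passage_lt t u : p t < u -> (t%:E < F u)%E.
Proof. by have [_ h _] := first_passage_prop t; exact: h. Qed.

Lemma first_passage_le t u : 0 < u -> (t%:E < F u)%E -> p t <= u.
Proof.
move=> u0 Fu; rewrite leNgt; apply/negP => up; have [_ _ h] := first_passage_prop t.
by move: Fu; rewrite ltNge h// u0.
Qed.

(* Only the strict monotonicity of F matters: a jump of F makes p constant. *)
Lemma continuous_first_passage : continuous p.
Proof.
move=> t; apply/cvgrPdist_le => e e0.
have [Flt _] := hF; have p0 := first_passage_ge0 t.
have e2 : 0 < e / 2 by rewrite divr_gt0.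
have e2e : e / 2 < e by rewrite ltr_pdivrMr// mulr_natr mulr2n ltrDl.
have up : \forall s \near t, p s <= p t + e.
  have Fp : (t%:E < F (p t + e / 2)%R)%E by apply: first_passage_lt; rewrite ltrDl.
  have Fpe : (F (p t + e / 2)%R < F (p t + e)%R)%E.
    by apply: Flt; rewrite ?addr_ge0 ?(ltW e2)// ltrD2l.
  have : \forall s \near t, (s%:E < F (p t + e)%R)%E.
    case: (F (p t + e)%R) Fpe => [r| |] Fpe.
    - have tr : t < r by rewrite -lte_fin (lt_trans Fp).
      near=> s; rewrite lte_fin; near: s.
      exact: (open_nbhs_nbhs (conj (@open_lt R r) tr)).
    - by near=> s; exact: ltry.
    - by move: Fpe; rewrite ltNge leNye.
  by apply: filterS => s; apply: first_passage_le; rewrite ltr_wpDl.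
have low : \forall s \near t, p t - e <= p s.
  have [pe|pe] := ltP (p t) e.
    near=> s; rewrite (le_trans _ (first_passage_ge0 s))// subr_le0 ltW//.
  have pe0 : 0 <= p t - e by rewrite subr_ge0.
  have [_ _ Fle] := first_passage_prop t.
  have h1 : (F (p t - e)%R < F (p t - e / 2)%R)%E by apply: Flt; rewrite // ltrD2l ltrN2.
  have h2 : (F (p t - e / 2)%R <= t%:E)%E.
    by apply: Fle; rewrite gtrBl e2 andbT subr_gt0 (lt_le_trans e2e).
  have : \forall s \near t, (F (p t - e)%R < s%:E)%E.
    case: (F (p t - e)%R) (lt_le_trans h1 h2) => [r| |] Fr.
    - have tr : r < t by rewrite -lte_fin.
      near=> s; rewrite lte_fin; near: s.
      exact: (open_nbhs_nbhs (conj (@open_gt R r) tr)).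
    - by move: Fr; rewrite ltNge leey.
    - by near=> s; exact: ltNyr.
  apply: filterS => s Fs; rewrite leNgt; apply/negP => /first_passage_lt.
  by move=> /(lt_trans Fs); rewrite ltxx.
near=> s; rewrite ler_distlC; apply/andP; split; near: s => //.
Unshelve. all: by end_near. Qed.

End passable.

Section comparison.
Context F (hF : passable F) (G : R -> \bar R) (m del T U : R).
Context (m0 : 0 < m) (del0 : 0 < del) (G0 : G 0 = 0%E).
Context (Gslope : forall u v, 0 <= u -> u <= v -> (G u + (m * (v - u))%:E <= G v)%E).
Context (Gfin : forall u, 0 <= u -> G u \is a fin_num).
Context (FG : forall u, 0 <= u -> u <= U -> (F u <= G u + del%:E)%E /\ (G u <= F u + del%:E)%E).
Context (TU : T + del < m * U).

Lemma passable_slope : passable G.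
Proof.
split=> [u v u0 uv|t].
  apply: lt_le_trans (Gslope u0 (ltW uv)).
  by rewrite lteDl ?Gfin// lte_fin mulr_gt0// subr_gt0.
pose u := (`|t| + 1) / m.
have u0 : 0 < u by rewrite divr_gt0// ltr_wpDl.
exists u => //; apply: lt_le_trans (Gslope (lexx 0) (ltW u0)).
rewrite G0 add0e subr0 lte_fin /u mulrC divfK ?gt_eqF//.
by rewrite (le_lt_trans (ler_norm t))// ltrDl.
Qed.

(** [G] gains at least [del] during a time [del / m], so if one clock has passed t, the other has
    passed it at most [del / m] later. The condition [T + del < m * U] keeps all the times involved
    inside [0, U], where the clocks are compared. *)
Lemma first_passage_dist t : 0 <= t -> t <= T ->
  `|first_passage F t - first_passage G t| <= del / m /\
  first_passage F t <= U /\ first_passage G t <= U.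
Proof.
move=> t0 tT; have hG := passable_slope.
have dm0 : 0 < del / m by rewrite divr_gt0.
have pF0 := first_passage_ge0 hF t; have pG0 := first_passage_ge0 hG t.
have pGT : first_passage G t <= T / m.
  apply/ler_addgt0Pr => e e0.
  have Tm0 : 0 <= T / m by rewrite divr_ge0 ?(ltW m0)// (le_trans t0).
  apply: (first_passage_le hG); first by rewrite ltr_wpDl.
  apply: lt_le_trans (Gslope (lexx 0) (addr_ge0 Tm0 (ltW e0))).
  rewrite G0 add0e subr0 lte_fin mulrDr mulrCA divff ?gt_eqF// mulr1.
  by rewrite (le_lt_trans tT)// ltrDl mulr_gt0.
have U1 : T / m + del / m < U.
  by rewrite -mulrDl ltr_pdivrMr// [U * m]mulrC.
have upper : first_passage F t <= first_passage G t + del / m.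
  apply/ler_addgt0Pr => e e0.
  (* The second bound leaves room for [w + del / m] before [U]. *)
  pose e' := Num.min (e / 2) ((U - (T / m + del / m)) / 2).
  have e'0 : 0 < e' by rewrite lt_min !divr_gt0// subr_gt0.
  pose w := first_passage G t + e'.
  have w0 : 0 <= w by rewrite addr_ge0// ltW.
  have wd : w <= w + del / m by rewrite lerDl ltW.
  have wU : w + del / m <= U.
    have : e' <= (U - (T / m + del / m)) / 2 by rewrite ge_min lexx orbT.
    have : first_passage G t + del / m <= T / m + del / m by rewrite lerD2r.
    by rewrite /w; lra.
  apply: (@le_trans _ _ (w + del / m)); last first.
    have : e' <= e / 2 by rewrite ge_min lexx.
    by rewrite /w; lra.
  have wd0 : 0 < w + del / m by rewrite ltr_wpDl.
  apply: (first_passage_le hF) => //.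
  have [_ GF] := FG (ltW wd0) wU.
  have tw : (t%:E < G w)%E by apply: (first_passage_lt hG); rewrite ltrDl.
  have := Gslope w0 wd; rewrite [w + _]addrC addrK mulrCA divff ?gt_eqF// mulr1 addrC.
  move=> /le_trans/(_ GF); rewrite leeD2rE//; exact: lt_le_trans.
have pFU : first_passage F t < U.
  by apply: (le_lt_trans upper); apply: le_lt_trans U1; rewrite lerD2r.
have lower : first_passage G t <= first_passage F t + del / m.
  apply/ler_addgt0Pr => e e0.
  pose e' := Num.min e (U - first_passage F t).
  have e'0 : 0 < e' by rewrite lt_min e0 subr_gt0.
  pose w := first_passage F t + e'.
  have w0 : 0 <= w by rewrite addr_ge0// ltW.
  have wU : w <= U by rewrite /w -lerBrDl ge_min lexx orbT.
  have wd : w <= w + del / m by rewrite lerDl ltW.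
  apply: (@le_trans _ _ (w + del / m)); last first.
    have : e' <= e by rewrite ge_min lexx.
    by rewrite /w; lra.
  have wd0 : 0 < w + del / m by rewrite ltr_wpDl.
  apply: (first_passage_le hG) => //.
  have [GF _] := FG w0 wU.
  have tw : (t%:E < F w)%E by apply: (first_passage_lt hF); rewrite ltrDl.
  apply: lt_le_trans (Gslope w0 wd).
  rewrite [w + del / m]addrC addrK mulrCA divff ?gt_eqF// mulr1.
  exact: lt_le_trans GF.
split; last by split; [exact: ltW|rewrite (le_trans pGT)// ltW// (le_lt_trans _ U1)// lerDl ltW].
by rewrite ler_distl lerBlDr lower upper.
Qed.

End comparison.
End first_passage.

(** * Clocks along a path and the time-changed path *)

Section path_integral.
Context {R : realType} {d : nat}.
Local Notation cpath := (@cpath R d).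
Local Notation mpath := (@mpath R d).
Local Notation rV := (borel 'rV[R]_d).
Local Notation mu := (@lebesgue_measure R).
Local Open Scope ereal_scope.
Implicit Types (h : 'rV[R]_d -> R) (c : cpath).

Definition path_integral h c (u : R) : \bar R := \int[mu]_(s in `[0%R, u]) (h (c s))%:E.

Section properties.
Context h (mh : measurable_fun [set: rV] (h : rV -> R)) (h0 : forall x, (0 <= h x)%R).

Lemma measurable_along c :
  measurable_fun [set: measurableTypeR R] (fun s : measurableTypeR R => (h (c s))%:E).
Proof.
have mhE : measurable_fun [set: rV] (fun x : rV => (h x)%:E) by exact/measurable_EFinP.
exact: (measurableT_comp mhE (measurable_cpath c)).
Qed.

Lemma measurable_path_integral (u : R) :
  measurable_fun [set: mpath] (fun c : mpath => path_integral h c u).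
Proof.
pose D : set (measurableTypeR R) := `[0%R, u]%classic.
have mD : measurable D by exact: measurable_itv.
have mhE : measurable_fun [set: rV] (fun x : rV => (h x)%:E) by exact/measurable_EFinP.
have mDE : measurable_fun [set: measurableTypeR R] (fun s : measurableTypeR R => (\1_D s : R)%:E).
  apply/(@measurable_EFinP _ (measurableTypeR R) R setT (\1_D)).
  exact: measurable_indic.
pose F (p : mpath * measurableTypeR R) :=
  (h ((p.1 : cpath) (Num.max 0 p.2)%R))%:E * (\1_D p.2 : R)%:E.
rewrite (_ : (fun c => _) = (fun c => \int[mu]_s F (c, s))); last first.
  apply/funext => c; rewrite /path_integral -/D ge0_integral_indic.
  apply: eq_integral => s _; rewrite /F /= !indicE.
  have [sD|sD] := boolP (s \in D); last by rewrite !mule0.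
  by rewrite max_r//; move: sD; rewrite inE /D /= in_itv/= => /andP[].
apply: (measurable_fun_fubini_tonelli_F (m2 := mu) F).
  apply: emeasurable_funM; last exact: (measurableT_comp mDE measurable_snd).
  exact: (measurableT_comp mhE (@measurable_joint_eval R d)).
by move=> p; rewrite mule_ge0// lee_fin.
Qed.

Lemma path_integral_ge0 c u : 0 <= path_integral h c u.
Proof. by apply: integral_ge0 => s _; rewrite lee_fin. Qed.

Lemma path_integral0 c : path_integral h c 0 = 0.
Proof. by rewrite /path_integral set_itv1 integral_set1. Qed.

Lemma path_integral_cat c (u v : R) : (0 <= u)%R -> (u <= v)%R ->
  path_integral h c v = path_integral h c u + \int[mu]_(s in `]u, v]) (h (c s))%:E.
Proof.
move=> u0 uv; rewrite /path_integral.
rewrite (@itv_bndbnd_setU _ _ (BLeft 0%R) (BRight u) (BRight v)) ?bnd_simp//.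
rewrite ge0_integral_setU//.
- by apply: measurable_funTS; exact: measurable_along.
- by move=> s _; rewrite lee_fin.
- rewrite disj_set2E; apply/eqP/seteqP; split=> s //= [].
  by rewrite !in_itv/= => /andP[_ su] /andP[us _]; move: us; rewrite ltNge su.
Qed.

Lemma path_integral_le c u v : (u <= v)%R -> path_integral h c u <= path_integral h c v.
Proof.
move=> uv; apply: ge0_subset_integral => //=.
- by apply: measurable_funTS; exact: measurable_along.
- by move=> s _; rewrite lee_fin.
- by apply: subset_itvl; rewrite bnd_simp.
Qed.

End properties.

(** A clock stops while [h] vanishes along the path. With this indicator, the absence of such a stop
    becomes the vanishing of an integral, which is a measurable condition. *)
Definition zero_ind h (x : 'rV[R]_d) : R := \1_[set y | h y = 0%R] x.

Lemma zero_ind_ge0 h x : (0 <= zero_ind h x)%R. Proof. by rewrite /zero_ind. Qed.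

Lemma measurable_zero_ind h : measurable_fun [set: rV] (h : rV -> R) ->
  measurable_fun [set: rV] (zero_ind h : rV -> R).
Proof.
move=> mh; apply: measurable_indic; rewrite -[X in measurable X]setTI.
rewrite (_ : [set y | _] = h @^-1` [set 0%R])//.
by apply: mh => //; exact: measurable_set1.
Qed.

(** The paths along which the clock [path_integral h] is finite, unbounded and
    does not stop. *)
Definition good_clock h : set cpath := [set c |
  [/\ forall N : nat, path_integral h c N%:R < +oo,
      forall N : nat, exists M : nat, N%:R%:E < path_integral h c M%:R &
      forall N : nat, path_integral (zero_ind h) c N%:R = 0]].

(** Measurability is what allows almost sure goodness to pass between processes with the same law;
    integer horizons keep the conditions countable. *)
Lemma measurable_good_clock h : measurable_fun [set: rV] (h : rV -> R) ->
  (forall x, (0 <= h x)%R) -> measurable (good_clock h : set mpath).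
Proof.
move=> mh h0.
have mK (N : nat) := measurable_path_integral mh h0 N%:R.
have mZ (N : nat) := measurable_path_integral (measurable_zero_ind mh) (zero_ind_ge0 h) N%:R.
rewrite (_ : good_clock h =
  (\bigcap_N (fun c : mpath => path_integral h c N%:R) @^-1` `]-oo, (+oo : \bar R)[%classic) `&`
  (\bigcap_N \bigcup_M (fun c : mpath => path_integral h c M%:R) @^-1` `](N%:R%:E : \bar R), +oo[%classic) `&`
  (\bigcap_N (fun c : mpath => path_integral (zero_ind h) c N%:R) @^-1` [set 0])).
- apply: measurableI; [apply: measurableI|]; apply: bigcapT_measurable => N.
  + by rewrite -[X in measurable X]setTI; apply: mK => //; exact: emeasurable_itv.
  + apply: bigcupT_measurable => M.
    by rewrite -[X in measurable X]setTI; apply: mK => //; exact: emeasurable_itv.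
  + by rewrite -[X in measurable X]setTI; apply: mZ => //; exact: emeasurable_set1.
- apply/seteqP; split=> c.
    move=> [c1 c2 c3]; split; [split|] => N _ /=; [by rewrite in_itv/= c1| |exact: c3].
    by have [M cM] := c2 N; exists M => //=; rewrite in_itv/= andbT.
  move=> [[c1 c2] c3]; split=> N; [|  |exact: c3].
    by have := c1 N I; rewrite /= in_itv.
  by have [M _ /=] := c2 N I; rewrite in_itv/= andbT; exists M.
Qed.

Lemma good_clock_null h c (u v : R) : measurable_fun [set: rV] (h : rV -> R) ->
  good_clock h c -> (0 <= u)%R ->
  \int[mu]_(s in `]u, v]) (zero_ind h (c s))%:E = 0.
Proof.
move=> mh [_ _ gz] u0; apply/eqP; rewrite eq_le; apply/andP; split; last first.
  by apply: integral_ge0 => s _; rewrite lee_fin zero_ind_ge0.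
rewrite -[leRHS](gz (Num.bound `|v|)); apply: ge0_subset_integral => //=.
- by apply: measurable_funTS; exact: (measurable_along (measurable_zero_ind mh)).
- by move=> s _; rewrite lee_fin zero_ind_ge0.
- move=> s; rewrite /= !in_itv/= => /andP[us sv]; rewrite (le_trans u0 (ltW us))/=.
  apply: (le_trans sv); apply: (le_trans (ler_norm v)); rewrite ltW//.
  by rewrite archi_boundP.
Qed.

(** If the integral were 0, [h] would vanish almost everywhere along the path on ]u, v], and the
    integral of [zero_ind h] would be v - u instead of 0. *)
Lemma good_clock_lt h c (u v : R) : measurable_fun [set: rV] (h : rV -> R) ->
  (forall x, (0 <= h x)%R) -> good_clock h c -> (0 <= u)%R -> (u < v)%R ->
  0 < \int[mu]_(s in `]u, v]) (h (c s))%:E.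
Proof.
move=> mh h0 gc u0 uv.
rewrite lt_def integral_ge0 ?andbT; last by move=> s _; rewrite lee_fin.
apply/eqP => i0.
have mc := measurable_along mh c.
have : \int[mu]_(s in `]u, v]) `|(h (c s))%:E| = 0.
  by rewrite -[RHS]i0; apply: eq_integral => s _; rewrite gee0_abs// lee_fin.
move=> /(ae_eq_integral_abs mu (measurable_itv _) (measurable_funTS mc)) [N [mN N0 hN]].
have : \int[mu]_(s in `]u, v]) (zero_ind h (c s))%:E = \int[mu]_(s in `]u, v]) 1.
  apply: ae_eq_integral => //.
  - by apply: measurable_funTS; exact: (measurable_along (measurable_zero_ind mh)).
  - exists N; split=> // s /= hs; apply: hN => /= h1; apply: hs => suv.
    by rewrite /zero_ind indicE mem_set//; have := h1 suv => -[].
rewrite (good_clock_null _ mh gc u0) integral_cst//= mul1e lebesgue_measure_itv/= lte_fin uv.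
by rewrite -EFinB => -[] /esym/eqP; rewrite subr_eq0 gt_eqF.
Qed.

Lemma good_clock_finite h c u : measurable_fun [set: rV] (h : rV -> R) ->
  (forall x, (0 <= h x)%R) -> good_clock h c -> path_integral h c u \is a fin_num.
Proof.
move=> mh h0 [gf _ _]; rewrite ge0_fin_numE ?path_integral_ge0//.
apply: le_lt_trans (gf (Num.bound `|u|)); apply: path_integral_le => //.
by rewrite (le_trans (ler_norm u))// ltW//; by rewrite archi_boundP.
Qed.

Lemma good_clock_passable h c : measurable_fun [set: rV] (h : rV -> R) ->
  (forall x, (0 <= h x)%R) -> good_clock h c -> passable (path_integral h c).
Proof.
move=> mh h0 gc; split=> [u v u0 uv|t].
  rewrite (path_integral_cat mh h0 c u0 (ltW uv)) lteDl ?good_clock_finite//.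
  exact: good_clock_lt.
have [_ gu _] := gc; have [M tM] := gu (Num.bound `|t|).
exists M.+1%:R => //.
apply: (@lt_le_trans _ _ (path_integral h c M%:R)); last first.
  by apply: path_integral_le => //; rewrite ler_nat.
apply: lt_trans tM; rewrite lte_fin; apply: (le_lt_trans (ler_norm t)).
by rewrite archi_boundP.
Qed.

End path_integral.

Section time_changed_path.
Context {R : realType} {d : nat} (T : R) (T0 : 0 <= T).
Local Notation cpath := (@cpath R d).
Local Notation mpath := (@mpath R d).
Local Notation rV := (borel 'rV[R]_d).
Context (h : 'rV[R]_d -> R) (mh : measurable_fun [set: rV] (h : rV -> R)).
Context (h0 : forall x, 0 <= h x).
Local Notation PS := (path_space d T).

Lemma continuous_time_changed (c : cpath) : good_clock h c ->
  continuous (fun t : set_type (`[0%R, T]%classic : set R) =>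
    c (first_passage (path_integral h c) (\val t))).
Proof.
move=> gc t.
have cv : {for t, continuous (fun t : set_type (`[0%R, T]%classic : set R) => \val t : R)}.
  exact: (@initial_continuous _ _ (@set_val R (`[0%R, T]%classic : set R))).
apply: (@continuous_comp _ _ _ (fun t : set_type (`[0%R, T]%classic : set R) => \val t : R)
  (fun t : R => c (first_passage (path_integral h c) t)) t cv).
apply: (@continuous_comp _ _ _ (first_passage (path_integral h c)) (c : cpath)).
  by apply: continuous_first_passage; exact: good_clock_passable.
exact: cts_fun.
Qed.

(** The null path is the default value on bad clocks, so that the map is defined on all paths. *)
Definition time_changed (c : cpath) : PS :=
  if pselect (good_clock h c) is left gc then
    mkcts (@continuous_time_changed c gc) :
      continuousType (set_type (`[0%R, T]%classic : set R)) 'rV[R]_d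
  else cst 0.

Lemma time_changedE c t : good_clock h c ->
  time_changed c t = c (first_passage (path_integral h c) (\val t)).
Proof. by move=> gc; rewrite /time_changed; case: pselect. Qed.

(** For a good clock, the passage time is below a exactly when the clock exceeds the level at some
    positive rational time below a. The path is then read at this random time by joint
    measurability. *)
Lemma measurable_time_changed : measurable_fun [set: mpath] (time_changed : mpath -> borel PS).
Proof.
apply: (@measurable_fun_path_space R d T T0 _ mpath) => t.
pose p (c : mpath) : R := if c \in (good_clock h : set mpath) then
  first_passage (path_integral h (c : cpath)) (\val t) else 0.
have p0 c : 0 <= p c.
  rewrite /p; case: ifP => // /set_mem gc.
  by apply: first_passage_ge0; exact: good_clock_passable.
have mG := measurable_good_clock mh h0.
have mgood : measurable_fun [set: mpath] (fun c : mpath => c \in (good_clock h : set mpath)).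
  apply: (measurable_fun_bool true); rewrite setTI.
  rewrite (_ : _ @^-1` _ = (good_clock h : set mpath))//.
  by apply/seteqP; split=> c /=; [exact: set_mem|exact: mem_set].
have mp : measurable_fun [set: mpath] p.
  apply: (measurability _ (RGenInftyO.measurableE R)) => // _ [_ [a ->] <-].
  rewrite setTI.
  pose E (q : rat) : set mpath := [set c : mpath | 0 < (ratr q : R) < a /\
    ((\val t)%:E < path_integral h (c : cpath) (ratr q))%E].
  (* On bad clocks [p] is 0, which lies below [a] exactly when [a] is positive. *)
  pose E0 : set mpath := if 0 < a then ~` (good_clock h : set mpath) else set0.
  have -> : p @^-1` `]-oo, a[%classic =
      ((good_clock h : set mpath) `&` \bigcup_q E q) `|` E0.
    apply/seteqP; split=> c /=; rewrite in_itv/=.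
      have [gc|gc] := pselect (good_clock h c).
        rewrite /p mem_set// => pa; left; split=> //.
        have hp := good_clock_passable mh h0 gc.
        have [q] := rat_in_itvoo pa; rewrite in_itv/= => /andP[pq qa].
        exists q => //; split; last exact: (first_passage_lt hp pq).
        by rewrite qa andbT (le_lt_trans _ pq)// first_passage_ge0.
      by rewrite /p memNset// => a0; right; rewrite /E0 a0.
    move=> [[gc [q _ /= [/andP[q0 qa] tq]]]|].
      rewrite /p mem_set//; apply: le_lt_trans qa.
      by apply: first_passage_le => //; exact: good_clock_passable.
    by rewrite /E0; case: ifPn => // a0 gc; rewrite /p memNset.
  apply: measurableU; last by rewrite /E0; case: ifP => _; [exact: measurableC|exact: measurable0].
  apply: measurableI => //; apply: countable_bigcupT_measurable => // q.
  have [qa|qa] := boolP (0 < (ratr q : R) < a); last first.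
    rewrite (_ : E q = set0); first exact: measurable0.
    by apply/seteqP; split=> // c [h1 _]; move: qa; rewrite h1.
  rewrite (_ : E q = (fun c : mpath => path_integral h c (ratr q)) @^-1`
    `](\val t)%:E, +oo[%classic); last first.
    by apply/seteqP; split=> c /=; rewrite in_itv/= andbT; [case|split].
  rewrite -[X in measurable X]setTI; apply: measurable_path_integral => //.
  exact: emeasurable_itv.
rewrite (_ : (fun c => _) = (fun c : mpath => if c \in (good_clock h : set mpath) then
    (c : cpath) (Num.max 0 (p c)) else 0)); last first.
  apply/funext => c; rewrite /p /=; case: ifP => [/set_mem gc|gc].
    have fp0 := first_passage_ge0 (good_clock_passable mh h0 gc) (\val t).
    by rewrite time_changedE// mem_set// max_r.
  rewrite /time_changed; case: pselect => //= gc'.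
  by move: gc; rewrite mem_set.
apply: measurable_fun_ifT; [exact: mgood| |exact: measurable_cst].
apply: (measurableT_comp (@measurable_joint_eval R d) (g := fun c : mpath => (c, p c))).
by apply/measurable_fun_pair.
Qed.

End time_changed_path.

(** * The limiting clock *)

Section octants.
Context {R : realType} {d : nat}.
Local Notation rV := (borel 'rV[R]_d).
Implicit Types (x : 'rV[R]_d) (al : {ffun 'I_d -> bool}).

Lemma octantP al x : octant al x <-> forall i, 0 < (-1) ^+ al i * x ord0 i.
Proof.
have sgnK i : (-1) ^+ al i * (-1) ^+ al i = 1 :> R.
  by rewrite -expr2 -exprM mulnC exprM sqrrN !expr1n.
split=> [[t [t0 ->]] i|h].
  rewrite summxE (bigD1 i)//= big1 ?addr0; last first.
    by move=> j ji; rewrite !mxE eqxx/= eq_sym (negbTE ji) mulr0.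
  rewrite !mxE !eqxx mulr1 mulrA sgnK mul1r; exact: t0.
exists (fun i => (-1) ^+ al i * x ord0 i); split=> //.
apply/rowP => i; rewrite summxE (bigD1 i)//= big1 ?addr0; last first.
  by move=> j ji; rewrite !mxE eqxx/= eq_sym (negbTE ji) mulr0.
by rewrite !mxE !eqxx mulr1 mulrA sgnK mul1r.
Qed.

Lemma octant_scale (a : R) al x : 0 < a -> octant al (a *: x) <-> octant al x.
Proof.
move=> a0; rewrite !octantP; split=> h i; have := h i.
  by rewrite mxE mulrCA (pmulr_rgt0 _ a0).
by rewrite mxE mulrCA (pmulr_rgt0 _ a0).
Qed.

Lemma octant_inj al al' x : octant al x -> octant al' x -> al = al'.
Proof.
move=> /octantP h /octantP h'; apply/ffunP => i.
have := h i; have := h' i.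
case: (al i); case: (al' i) => //; rewrite ?expr0 ?expr1 ?mul1r ?mulN1r ?oppr_gt0 => x1 x2;
  by have := lt_trans x1 x2; rewrite ltxx.
Qed.

Definition hyperplanes : set 'rV[R]_d := [set x | exists i, x ord0 i = 0].

Lemma octant_cover x : ~ hyperplanes x -> exists al, octant al x.
Proof.
move=> hx; exists [ffun i => x ord0 i < 0]; apply/octantP => i; rewrite ffunE.
have xi : x ord0 i != 0 by apply/eqP => xi; apply: hx; exists i.
case: (ltP (x ord0 i) 0) => xi0; first by rewrite /= expr1 mulN1r oppr_gt0.
by rewrite /= expr0 mul1r lt_def xi.
Qed.

Lemma hyperplanesE : hyperplanes =
  \bigcup_(i in [set: 'I_d]) [set x | forall j, (if j == i then [set 0] else setT) (x ord0 j)].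
Proof.
apply/seteqP; split=> [x [i xi]|x [i _ h]].
  by exists i => // j; case: eqP => [->|].
by exists i; have := h i; rewrite eqxx.
Qed.

Lemma measurable_hyperplane (i : 'I_d) :
  measurable ([set x | forall j, (if j == i then [set 0] else setT) (x ord0 j)] : set rV).
Proof.
by apply: (@measurable_rV_box R d (fun j => if j == i then [set 0] else setT)) => j; case: ifP.
Qed.

Lemma measurable_hyperplanes : measurable (hyperplanes : set rV).
Proof.
rewrite hyperplanesE; apply: fin_bigcup_measurable => // i _.
exact: measurable_hyperplane.
Qed.

Lemma lebesgue_rV_hyperplanes : lebesgue_rV (hyperplanes : set rV) = 0%E.
Proof.
apply: measure_negligible; first exact: measurable_hyperplanes.
(* The finite union is indexed by all natural numbers to apply countable subadditivity; the terms
   from d on are empty. *)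
pose A (k : nat) : set rV := [set x | exists2 i : 'I_d, val i = k & (x : 'rV[R]_d) ord0 i = 0].
rewrite (_ : hyperplanes = \bigcup_k A k); last first.
  apply/seteqP; split=> [x [i xi]|x [k _ [i _ xi]]]; last by exists i.
  by exists (val i) => //; exists i.
apply: negligible_bigcup => k; have [kd|kd] := ltnP k d; last first.
  rewrite (_ : A k = set0); first exact: negligible_set0.
  by apply/seteqP; split=> // x [i ik]; have := ltn_ord i; rewrite -[nat_of_ord i]/(val i) ik ltnNge kd.
pose i0 := Ordinal kd.
have mi := measurable_hyperplane i0.
rewrite (_ : A k = [set x | forall j, (if j == i0 then [set 0] else setT) (x ord0 j)]); last first.
  apply/seteqP; split=> [x [i ik xi] j|x h].
    by case: eqP => // ->; rewrite /= -xi; congr (_ _ _); apply: val_inj.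
  by exists i0 => //; have := h i0; rewrite eqxx.
apply/negligibleP => //.
apply: (etrans (@lebesgue_rV_box R d (fun j => if j == i0 then [set 0] else setT) _)).
  by move=> j; case: ifP.
by rewrite (bigD1 i0)//= eqxx lebesgue_measure_set1 mul0e.
Qed.

Lemma measurable_octant al : measurable (octant al : set rV).
Proof.
rewrite (_ : octant al = [set x | forall i, [set y : R | 0 < (-1) ^+ al i * y] (x ord0 i)]).
  apply: (@measurable_rV_box R d (fun i => [set y : R | 0 < (-1) ^+ al i * y])) => i.
  rewrite (_ : [set y | _] = (fun y : R => (-1) ^+ al i * y) @^-1` `]0, +oo[%classic).
    by rewrite -[X in measurable X]setTI; apply: measurable_funM => //; exact: measurable_itv.
  by apply/seteqP; split=> y /=; rewrite in_itv/= andbT.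
by apply/seteqP; split=> x /octantP.
Qed.

Section upsilon.
Context (la : {ffun 'I_d -> bool} -> R) (la_gt0 : forall al, 0 < la al).

Lemma measurable_upsilon : measurable_fun [set: rV] (upsilon la : rV -> R).
Proof.
apply: (@measurable_sum _ _ _ _ _ _ (fun (al : {ffun 'I_d -> bool}) (x : rV) =>
  (la al)^-1 * \1_(octant al) (x : 'rV[R]_d))) => al.
apply: measurable_funM => //; apply: measurable_indic; exact: measurable_octant.
Qed.

Lemma upsilon_ge0 x : 0 <= upsilon la x.
Proof. by apply: sumr_ge0 => al _; rewrite mulr_ge0// invr_ge0 ltW. Qed.

Lemma upsilon_octant al x : octant al x -> upsilon la x = (la al)^-1.
Proof.
move=> ox; rewrite /upsilon (bigD1 al)//= indicE mem_set// mulr1 big1 ?addr0// => al' al'al.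
rewrite indicE memNset ?mulr0// => ox'; move: al'al.
by rewrite (octant_inj ox' ox) eqxx.
Qed.

Lemma upsilon_scale (a : R) x : 0 < a -> upsilon la (a *: x) = upsilon la x.
Proof.
move=> a0; apply: eq_bigr => al _; congr (_ * _); rewrite !indicE; congr (nat_of_bool _)%:R.
by apply/idP/idP => /set_mem h; apply/mem_set/(octant_scale _ _ a0).
Qed.

(** A sum takes the place of a maximum: it dominates each [la al], so its inverse is a positive
    lower bound of [upsilon] off the hyperplanes, in general smaller than the minimum. The upper
    bound is formed in the same way. *)
Definition upsilon_min : R := (\sum_al la al)^-1.
Definition upsilon_max : R := \sum_al (la al)^-1.

Lemma upsilon_min_gt0 : 0 < upsilon_min.
Proof.
rewrite invr_gt0 (bigD1 [ffun=> false])//= ltr_wpDr//.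
by apply: sumr_ge0 => al _; exact: ltW.
Qed.

Lemma upsilon_ge x : ~ hyperplanes x -> upsilon_min <= upsilon la x.
Proof.
move=> /octant_cover[al ox]; rewrite (upsilon_octant ox) lef_pV2 ?posrE//.
  by rewrite (bigD1 al)//= lerDl; apply: sumr_ge0 => al' _; exact: ltW.
by rewrite -invr_gt0; exact: upsilon_min_gt0.
Qed.

Lemma upsilon_le x : upsilon la x <= upsilon_max.
Proof.
apply: ler_sum => al _; rewrite -[leRHS]mulr1 ler_wpM2l// ?invr_ge0 ?ltW//.
Qed.

Lemma zero_ind_upsilon x : zero_ind (upsilon la) x <= \1_hyperplanes x.
Proof.
rewrite /zero_ind !indicE; have [h|h] := pselect (hyperplanes x).
  by rewrite (mem_set h); case: (_ \in _).
rewrite (memNset h) memNset// => /= ux; have := upsilon_ge h.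
by rewrite ux leNgt upsilon_min_gt0.
Qed.

Context (lam : 'rV[R]_d -> R) (lam_gt0 : forall x, 0 < lam x).
Context (h2 : forall al (eps : R), 0 < eps -> exists A : R, 0 < A /\
      forall x : 'rV[R]_d, octant al x -> A < enorm x -> `|lam x - la al| < eps).

Definition clock_gap x : R := `|(lam x)^-1 - upsilon la x|.

Lemma clock_gap_small (e : R) : 0 < e -> exists2 A : R, 0 < A &
  forall x, ~ hyperplanes x -> A < enorm x -> clock_gap x <= e.
Proof.
move=> e0.
have /choice[A hA] al : exists A : R, 0 < A /\ forall x, octant al x -> A < enorm x ->
    `|(lam x)^-1 - (la al)^-1| <= e.
  have l0 := la_gt0 al.
  (* The first bound gives [lam x >= la al / 2], so the denominator of the difference of inverses is
     at least [la al ^+ 2 / 2]; the second then makes the quotient at most [e]. *)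
  have eta0 : 0 < Num.min (la al / 2) (e * (la al ^+ 2 / 2)).
    by rewrite lt_min !(divr_gt0, mulr_gt0)// exprn_gt0.
  have [A [A0 hA]] := h2 al eta0.
  exists A; split=> // x ox Ax; have := hA x ox Ax.
  rewrite lt_min => /andP[]; rewrite ltr_distl => /andP[lx _] lame.
  have lx2 : la al / 2 <= lam x by lra.
  have xp := lam_gt0 x.
  rewrite -[(lam x)^-1]mul1r -[(la al)^-1]mul1r -mulNr addf_div ?gt_eqF//.
  rewrite mul1r mulN1r normf_div [`|lam x * _|]gtr0_norm ?mulr_gt0//.
  rewrite ler_pdivrMr ?mulr_gt0// distrC (le_trans (ltW lame))// ler_pM2l//.
  by rewrite expr2; nra.
exists (\sum_al A al).
  rewrite (bigD1 [ffun=> false])//= ltr_wpDr//; last by case: (hA [ffun=> false]).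
  by apply: sumr_ge0 => al _; apply: ltW; case: (hA al).
move=> x /octant_cover[al ox] Ax; rewrite /clock_gap (upsilon_octant ox).
have [_ h] := hA al; apply: h => //; apply: le_lt_trans Ax.
rewrite (bigD1 al)//= lerDl; apply: sumr_ge0 => al' _; apply: ltW; by case: (hA al').
Qed.

(** Outside the ball the gap is at most [e]; inside, the two inverse speeds are bounded separately.
    On the hyperplanes nothing is known and the gap is bounded by itself, in a last term that has
    zero occupation. *)
Lemma clock_gap_le (e : R) : 0 < e -> exists2 A : R, 0 < A & forall x,
  clock_gap x <= e + ball_weight lam A x + upsilon_max * \1_(eball A) x +
    \1_hyperplanes x * clock_gap x.
Proof.
move=> e0; have [A A0 hA] := clock_gap_small e0; exists A => // x.
have g0 : 0 <= clock_gap x by exact: normr_ge0.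
have w0 := ball_weight_ge0 lam_gt0 A x.
have u0 := upsilon_ge0 x.
have um : upsilon la x <= upsilon_max := upsilon_le x.
have [h|h] := pselect (hyperplanes x).
  rewrite [\1_hyperplanes x]indicE (mem_set h) mul1r lerDr !addr_ge0 ?(ltW e0)//.
  by rewrite mulr_ge0// (le_trans u0).
rewrite [\1_hyperplanes x]indicE (memNset h) mul0r addr0.
have [xA|xA] := leP (enorm x) A.
  rewrite /ball_weight indicE mem_set// mulr1 mul1r.
  have l0 : 0 < (lam x)^-1 by rewrite invr_gt0.
  rewrite /clock_gap (le_trans (ler_normB _ _))// !ger0_norm ?(ltW l0)//.
  by lra.
rewrite (le_trans (hA x h xA))// -addrA lerDl addr_ge0//.
by rewrite mulr_ge0// (le_trans u0).
Qed.

Lemma measurable_clock_gap : measurable_fun [set: rV] (lam : rV -> R) ->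
  measurable_fun [set: rV] (clock_gap : rV -> R).
Proof.
move=> mlam; apply: (measurableT_comp (@normr_measurable R setT)).
by apply: measurable_funB; [exact: measurable_lamV|exact: measurable_upsilon].
Qed.

End upsilon.
End octants.

(** * Expected gap between the clocks *)

Section occupation_gap.
Context {R : realType} {d : nat}.
Local Notation cpath := (@cpath R d).
Local Notation mpath := (@mpath R d).
Local Notation mu := (@lebesgue_measure R).
Local Notation rV := (borel 'rV[R]_d).
Local Open Scope ereal_scope.

Lemma ge0_integral_lty_ae dT (T : measurableType dT) (m : {measure set T -> \bar R})
    (f : T -> \bar R) : measurable_fun setT f -> (forall x, 0 <= f x) ->
  \int[m]_x f x < +oo -> {ae m, forall x, f x < +oo}.
Proof.
move=> mf f0 foo.
have fi : m.-integrable setT f.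
  by apply/integrableP; split=> //; under eq_integral do rewrite gee0_abs//.
by have := integrable_ae measurableT fi; apply: filterS => x /(_ I); rewrite ge0_fin_numE.
Qed.

Lemma ge0_integral_eq0_ae dT (T : measurableType dT) (m : {measure set T -> \bar R})
    (f : T -> \bar R) : measurable_fun setT f -> (forall x, 0 <= f x) ->
  \int[m]_x f x = 0 -> {ae m, forall x, f x = 0}.
Proof.
move=> mf f0 fi.
have : \int[m]_x `|f x| = 0 by under eq_integral do rewrite gee0_abs//.
by move=> /(ae_eq_integral_abs m measurableT mf); apply: filterS => x /(_ I).
Qed.

Context dO (Om : measurableType dO) (P : probability Om R).
Context (B : R -> Om -> 'rV[R]_d) (hB : wiener_process P B).
Context (X : Om -> cpath) (hX : path_of P B X).

Definition occupation (n U : R) (h : 'rV[R]_d -> R) : \bar R :=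
  \int[P]_w \int[mu]_(s in `[0%R, U]) (h (X w (n * s)%R))%:E.

Section fixed_n.
Context (n U : R) (n0 : (0 < n)%R).
Implicit Types h : 'rV[R]_d -> R.

Let green (x : 'rV[R]_d) := \int[mu]_(s in `]0%R, U]) (gauss_pdf (n * s) x)%:E.

Let green0 x : 0 <= green x.
Proof. by apply: integral_ge0 => s _; rewrite lee_fin gauss_pdf_ge0. Qed.

(** The occupation formula reduces the identity to one integral over space against the Green
    function. *)
Lemma occupationD h1 h2 :
  measurable_fun [set: rV] (h1 : rV -> R) -> (forall x, (0 <= h1 x)%R) ->
  measurable_fun [set: rV] (h2 : rV -> R) -> (forall x, (0 <= h2 x)%R) ->
  occupation n U (fun x => h1 x + h2 x)%R = occupation n U h1 + occupation n U h2.
Proof.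
move=> m1 p1 m2 p2.
have mG : measurable_fun [set: rV] (green : rV -> \bar R) by exact: measurable_green.
have mD : measurable_fun [set: rV] ((fun x => h1 x + h2 x)%R : rV -> R) by exact: measurable_funD.
have pD x : (0 <= h1 x + h2 x)%R by rewrite addr_ge0.
rewrite /occupation (occupation_formula hB hX U n0 mD pD).
rewrite (occupation_formula hB hX U n0 m1 p1) (occupation_formula hB hX U n0 m2 p2).
rewrite -ge0_integralD//.
- by apply: eq_integral => x _; rewrite EFinD ge0_muleDl ?lee_fin.
- by move=> x _; apply: mule_ge0; [rewrite lee_fin|exact: green0].
- by apply: emeasurable_funM => //; exact/measurable_EFinP.
- by move=> x _; apply: mule_ge0; [rewrite lee_fin|exact: green0].
- by apply: emeasurable_funM => //; exact/measurable_EFinP.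
Qed.

Lemma occupation_le h1 h2 :
  measurable_fun [set: rV] (h1 : rV -> R) -> (forall x, (0 <= h1 x)%R) ->
  measurable_fun [set: rV] (h2 : rV -> R) -> (forall x, (h1 x <= h2 x)%R) ->
  occupation n U h1 <= occupation n U h2.
Proof.
move=> m1 p1 m2 h12.
have p2 x : (0 <= h2 x)%R by exact: le_trans (h12 x).
have mG : measurable_fun [set: rV] (green : rV -> \bar R) by exact: measurable_green.
rewrite /occupation (occupation_formula hB hX U n0 m1 p1) (occupation_formula hB hX U n0 m2 p2).
apply: ge0_le_integral => //.
- by move=> x _; apply: mule_ge0; [rewrite lee_fin|exact: green0].
- by apply: emeasurable_funM => //; exact/measurable_EFinP.
- by apply: emeasurable_funM => //; exact/measurable_EFinP.
- by move=> x _; apply: lee_wpmul2r; [exact: green0|rewrite lee_fin].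
Qed.

Lemma occupation_hyperplanes h :
  measurable_fun [set: rV] (h : rV -> R) -> (forall x, (0 <= h x)%R) ->
  occupation n U (fun x => \1_hyperplanes x * h x)%R = 0.
Proof.
move=> m1 p1.
have mG : measurable_fun [set: rV] (green : rV -> \bar R) by exact: measurable_green.
have mH : measurable_fun [set: rV] ((fun x : rV => \1_hyperplanes x * h x)%R : rV -> R).
  by apply: measurable_funM => //; apply: measurable_indic; exact: measurable_hyperplanes.
have pH x : (0 <= \1_hyperplanes x * h x)%R by rewrite mulr_ge0.
rewrite /occupation (occupation_formula hB hX U n0 mH pH).
rewrite -[RHS](integral0 lebesgue_rV [set: rV]).
apply: ae_eq_integral => //.
  by apply: emeasurable_funM => //; exact/measurable_EFinP.
exists (hyperplanes : set rV); split.
- exact: measurable_hyperplanes.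
- exact: lebesgue_rV_hyperplanes.
- move=> x /= hx; apply: contrapT => nx; apply: hx => _.
  by rewrite indicE memNset// mul0r mul0e.
Qed.

Lemma occupation_cst (e : R) : (0 <= U)%R -> (0 <= e)%R -> occupation n U (fun=> e) = (e * U)%:E.
Proof.
move=> U0 e0; transitivity (\int[P]_w (e * U)%:E).
  apply: eq_integral => w _; rewrite integral_cst//= lebesgue_measure_itv/= lte_fin.
  case: ifPn => [U1|]; first by rewrite -EFinB -EFinM subr0.
  rewrite -leNgt => U1; have -> : U = 0%R by apply/eqP; rewrite eq_le U0 U1.
  by rewrite mule0 mulr0.
by rewrite integral_cst//= [X in _ * X]probability_setT mule1.
Qed.

Lemma occupationZ (k : R) h : (0 <= k)%R ->
  measurable_fun [set: rV] (h : rV -> R) -> (forall x, (0 <= h x)%R) ->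
  occupation n U (fun x => k * h x)%R = k%:E * occupation n U h.
Proof.
move=> k0 m1 p1.
have mG : measurable_fun [set: rV] (green : rV -> \bar R) by exact: measurable_green.
have mM : measurable_fun [set: rV] ((fun x => k * h x)%R : rV -> R) by exact: measurable_funM.
have pM x : (0 <= k * h x)%R by rewrite mulr_ge0.
rewrite /occupation (occupation_formula hB hX U n0 mM pM) (occupation_formula hB hX U n0 m1 p1).
rewrite -ge0_integralZl//.
- by apply: eq_integral => x _; rewrite EFinM muleA.
- by apply: emeasurable_funM => //; exact/measurable_EFinP.
- by move=> x _; apply: mule_ge0; [rewrite lee_fin|exact: green0].
Qed.

End fixed_n.

Section gap.
Context (d2 : (2 <= d)%N).
Context (lam : 'rV[R]_d -> R) (lam_gt0 : forall x, (0 < lam x)%R).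
Context (mlam : measurable_fun [set: rV] (lam : rV -> R)).
Context (la : {ffun 'I_d -> bool} -> R) (la_gt0 : forall al, (0 < la al)%R).
Context (h2 : forall al (eps : R), (0 < eps)%R -> exists A : R, (0 < A)%R /\
      forall x : 'rV[R]_d, octant al x -> (A < enorm x)%R -> (`|lam x - la al| < eps)%R).
Context (h3_2 : d = 2%N -> exists g : R, (0 < g < 1 / 2)%R /\ forall r : R, (0 < r)%R ->
      (\int[lebesgue_rV]_(x in [set x : borel 'rV[R]_d | (enorm x <= r)%R])
        ((lam x)^-1 * (enorm x `^ (- (2 * g))))%:E < +oo)%E).
Context (h3_gt2 : (2 < d)%N -> forall r : R, (0 < r)%R ->
      (\int[lebesgue_rV]_(x in [set x : borel 'rV[R]_d | (enorm x <= r)%R])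
        ((lam x)^-1 * (enorm x `^ (2 - d%:R)))%:E < +oo)%E).

(** The four terms of [clock_gap_le] contribute [e * U], twice a multiple of 1 / sqrt n, and 0. The
    constant depends on [e] through the radius of the ball, so [e] has to be fixed before [n]
    grows. *)
Lemma occupation_clock_gap (e U : R) : (0 < e)%R -> (0 < U)%R ->
  exists C : R, forall n : R, (1 <= n)%R ->
    occupation n U (clock_gap la lam) <= (e * U + C / Num.sqrt n)%:E.
Proof.
move=> e0 U0; have [A A0 gapA] := clock_gap_le la_gt0 lam_gt0 h2 e0.
have d0 : (0 < d)%N by exact: leq_trans d2.
have [c1 hc1] := occupation_vanishes hB hX lam_gt0 mlam d2 A0 U0 h3_2 h3_gt2.
have [c2 hc2] := small_ball_occupation hB hX d0 (ltW A0) U0.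
have um0 : (0 <= upsilon_max la)%R := le_trans (upsilon_ge0 la_gt0 0%R) (upsilon_le la_gt0 0%R).
exists (c1 + upsilon_max la * c2)%R => n n1; have n0 : (0 < n)%R by exact: lt_le_trans n1.
have mg := measurable_clock_gap la lam_gt0 mlam.
have g0 x : (0 <= clock_gap la lam x)%R by exact: normr_ge0.
have mw := measurable_ball_weight lam_gt0 mlam A.
have w0 := ball_weight_ge0 lam_gt0 A.
have mI : measurable_fun [set: rV] (\1_(eball A) : rV -> R).
  by apply: measurable_indic; exact: measurable_eball.
have mH : measurable_fun [set: rV] ((fun x : rV => \1_hyperplanes x * clock_gap la lam x)%R : rV -> R).
  by apply: measurable_funM => //; apply: measurable_indic; exact: measurable_hyperplanes.
have mUI : measurable_fun [set: rV] ((fun x : rV => upsilon_max la * \1_(eball A) x)%R : rV -> R).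
  exact: measurable_funM.
have mew : measurable_fun [set: rV] ((fun x : rV => e + ball_weight lam A x)%R : rV -> R).
  exact: measurable_funD.
have mewI : measurable_fun [set: rV]
    ((fun x : rV => e + ball_weight lam A x + upsilon_max la * \1_(eball A) x)%R : rV -> R).
  exact: measurable_funD.
apply: (le_trans (occupation_le U n0 mg g0 (measurable_funD mewI mH) gapA)).
have ew0 x : (0 <= e + ball_weight lam A x)%R by rewrite addr_ge0// ltW.
have ui0 (x : 'rV[R]_d) : (0 <= upsilon_max la * \1_(eball A) x)%R by rewrite mulr_ge0.
rewrite (occupationD U n0 mewI _ mH); last 2 first.
- by move=> x; rewrite addr_ge0.
- by move=> x; rewrite mulr_ge0.
rewrite (occupation_hyperplanes U n0 mg g0) adde0.
rewrite (occupationD U n0 mew ew0 mUI ui0).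
rewrite (occupationD U n0 (measurable_cst e) (fun=> ltW e0) mw w0).
rewrite (occupation_cst n (ltW U0) (ltW e0)).
rewrite (occupationZ U n0 um0 mI)//.
have -> : (e * U + (c1 + upsilon_max la * c2) / Num.sqrt n =
  e * U + c1 / Num.sqrt n + upsilon_max la * (c2 / Num.sqrt n))%R by ring.
rewrite (EFinD (_ + _)%R) (EFinD (e * U)%R) (EFinM (upsilon_max la)); apply: leeD.
  by apply: leeD => //; exact: hc1.
by apply: lee_wpmul2l; [rewrite lee_fin|exact: hc2].
Qed.

End gap.
End occupation_gap.

(** * Scaled clocks and the inverse of the limiting clock *)

Section clocks.
Context {R : realType} {d : nat}.
Local Notation cpath := (@cpath R d).
Local Notation mpath := (@mpath R d).
Local Notation mu := (@lebesgue_measure R).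
Local Notation rV := (borel 'rV[R]_d).
Local Open Scope ereal_scope.

Lemma time_changeE (lam : 'rV[R]_d -> R) (b : R -> 'rV[R]_d) (t : R) :
  fine (time_change lam b t) = first_passage (additive_functional lam b) t.
Proof. by []. Qed.

Lemma path_integral_scale_path (h : 'rV[R]_d -> R) (n : R) (n0 : (0 < n)%R) (c : cpath) (u : R) :
  path_integral (fun x => h (Num.sqrt n *: x)) (scale_path n c) u =
  \int[mu]_(s in `[0%R, u]) (h (c (n * s)%R))%:E.
Proof.
apply: eq_integral => s _; congr (h _)%:E.
by rewrite /scale_path /mkcts scalerA divff ?scale1r// gt_eqF// sqrtr_gt0.
Qed.

Lemma path_integral_time_scale (h : 'rV[R]_d -> R) (n : R) (n0 : (0 < n)%R) (c : cpath) (u : R) :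
  measurable_fun [set: rV] (h : rV -> R) -> (forall x, (0 <= h x)%R) ->
  path_integral h c (n * u) =
  n%:E * path_integral (fun x => h (Num.sqrt n *: x)) (scale_path n c) u.
Proof.
move=> mh h0; rewrite (path_integral_scale_path h n0) /path_integral.
rewrite (ge0_integral_scale n0); last 3 first.
- exact: measurable_itv.
- by apply: measurable_funTS; exact: measurable_along.
- by move=> s; rewrite lee_fin.
congr (_ * _); congr (integral _ _ _).
apply/seteqP; split=> s /=; rewrite !in_itv/= ler_pM2l// pmulr_rge0//.
Qed.

Lemma additive_functional_scale (lam : 'rV[R]_d -> R) (lam_gt0 : forall x, (0 < lam x)%R)
    (mlam : measurable_fun [set: rV] (lam : rV -> R))
    (n : R) (n0 : (0 < n)%R) (b : R -> 'rV[R]_d) (c : cpath) (u : R) :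
  (forall s, (0 <= s)%R -> c s = b s) ->
  additive_functional lam b (n * u) =
  n%:E * path_integral (fun x => (lam (Num.sqrt n *: x))^-1)%R (scale_path n c) u.
Proof.
move=> cb; rewrite -(path_integral_time_scale n0 c u (measurable_lamV lam_gt0 mlam)); last first.
  by move=> x; rewrite invr_ge0 ltW.
apply: eq_integral => s; rewrite inE /= in_itv/= => /andP[s0 _].
by rewrite cb.
Qed.

(** Meant for [G] the additive functional of the original path and [F] the clock of the scaled one:
    the passage time at level n t is n times that of the scaled clock at t. *)
Lemma first_passage_time_scale (F G : R -> \bar R) (n t : R) : (0 < n)%R -> passable F ->
  (forall u, (0 <= u)%R -> G (n * u)%R = n%:E * F u) ->
  first_passage G (n * t) = (n * first_passage F t)%R.
Proof.
move=> n0 hF GF; have GF' u : (0 <= u)%R -> G u = n%:E * F (u / n)%R.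
  by move=> u0; rewrite -GF ?divr_ge0 ?(ltW n0)// mulrCA divff ?mulr1// gt_eqF.
have p0 := first_passage_ge0 hF t.
apply: first_passageE; first by rewrite mulr_ge0// ltW.
  move=> u pu; have u0 : (0 <= u)%R by rewrite (le_trans _ (ltW pu))// mulr_ge0// ltW.
  rewrite GF'// EFinM lte_pmul2l//; apply: (first_passage_lt hF).
  by rewrite ltr_pdivlMr// mulrC.
move=> u /andP[u0 up]; have [_ _ h] := first_passage_prop hF t.
rewrite GF' ?(ltW u0)// EFinM lee_pmul2l//; apply: h.
by rewrite divr_gt0//= ltr_pdivrMr// mulrC.
Qed.

Section upsilon_clock.
Context (la : {ffun 'I_d -> bool} -> R) (la_gt0 : forall al, (0 < la al)%R).
Local Notation ups := (upsilon la).

Definition off_hyperplanes (c : cpath) : Prop :=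
  forall N : nat, path_integral \1_hyperplanes c N%:R = 0.

Lemma measurable_hyper_ind : measurable_fun [set: rV] (\1_hyperplanes : rV -> R).
Proof. by apply: measurable_indic; exact: measurable_hyperplanes. Qed.

Lemma off_hyperplanes_itv c (u v : R) : off_hyperplanes c -> (0 <= u)%R ->
  \int[mu]_(s in `]u, v]) (\1_hyperplanes (c s))%:E = 0.
Proof.
move=> gz u0; apply/eqP; rewrite eq_le; apply/andP; split; last first.
  by apply: integral_ge0 => s _; rewrite lee_fin.
rewrite -[leRHS](gz (Num.bound (`|v|)%R)); apply: ge0_subset_integral => //=.
- by apply: measurable_funTS; exact: (measurable_along measurable_hyper_ind).
- move=> s; rewrite /= !in_itv/= => /andP[us sv]; rewrite (le_trans u0 (ltW us))/=.
  apply: (le_trans sv); apply: (le_trans (ler_norm v)); rewrite ltW//.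
  by rewrite archi_boundP.
Qed.

Let mups := @measurable_upsilon R d la.
Let ups0 := upsilon_ge0 la_gt0.

Lemma upsilon_slope c (u v : R) : off_hyperplanes c -> (0 <= u)%R -> (u <= v)%R ->
  path_integral ups c u + (upsilon_min la * (v - u))%:E <= path_integral ups c v.
Proof.
move=> hc u0 uv; rewrite (path_integral_cat mups ups0 c u0 uv) leeD2l//.
have m0 := upsilon_min_gt0 la_gt0.
have -> : (upsilon_min la * (v - u))%:E = \int[mu]_(s in `]u, v]) (upsilon_min la)%:E.
  rewrite integral_cst//= lebesgue_measure_itv/= lte_fin; case: ifPn => [_|].
    by rewrite EFinM EFinB.
  rewrite -leNgt => vu; have -> : v = u by apply/eqP; rewrite eq_le vu uv.
  by rewrite subrr mulr0 mule0.
have mI := measurable_along measurable_hyper_ind c.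
have mU := measurable_along mups c.
(* The pointwise lower bound fails on the hyperplanes, where [upsilon] is 0. Adding a multiple of
   their indicator, whose integral along the path is 0, repairs it. *)
rewrite -[leRHS]adde0 -[X in _ <= _ + X](mule0 (upsilon_min la)%:E).
rewrite -(off_hyperplanes_itv v hc u0) -ge0_integralZl; last 4 first.
- exact: measurable_itv.
- exact: measurable_funTS.
- by move=> s _; rewrite lee_fin.
- by rewrite lee_fin ltW.
rewrite -ge0_integralD//; last 4 first.
- by move=> s _; rewrite lee_fin ups0.
- exact: measurable_funTS.
- by move=> s _; rewrite mule_ge0// lee_fin// ltW.
- by apply: measurable_funTS; apply: emeasurable_funM => //; exact: measurable_cst.
apply: ge0_le_integral => //.
- by move=> s _; rewrite lee_fin ltW.
- apply: measurable_funTS; apply: emeasurable_funD => //.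
  by apply: emeasurable_funM => //; exact: measurable_cst.
move=> s _; rewrite -EFinM -EFinD lee_fin.
have [h|h] := pselect (hyperplanes (c s)).
  by rewrite [\1_hyperplanes _]indicE mem_set// mulr1 lerDr ups0.
by rewrite [\1_hyperplanes _]indicE memNset// mulr0 addr0 upsilon_ge.
Qed.

Lemma path_integral_upsilon_le c (u v : R) : (0 <= u)%R -> (u <= v)%R ->
  path_integral ups c v <= path_integral ups c u + (upsilon_max la * (v - u))%:E.
Proof.
move=> u0 uv; rewrite (path_integral_cat mups ups0 c u0 uv) leeD2l//.
apply: (@le_trans _ _ (\int[mu]_(s in `]u, v]) (upsilon_max la)%:E)).
  apply: ge0_le_integral => //.
  - by move=> s _; rewrite lee_fin ups0.
  - by apply: measurable_funTS; exact: measurable_along.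
  - by move=> s _; rewrite lee_fin upsilon_le.
rewrite integral_cst//= lebesgue_measure_itv/= lte_fin; case: ifPn => [_|].
  by rewrite EFinM EFinB.
by rewrite mule0 lee_fin mulr_ge0 ?subr_ge0// (le_trans (ups0 0%R))// upsilon_le.
Qed.

Lemma path_integral_upsilon_fin c (u : R) : (0 <= u)%R -> path_integral ups c u \is a fin_num.
Proof.
move=> u0; rewrite ge0_fin_numE ?path_integral_ge0//.
apply: (le_lt_trans (path_integral_upsilon_le c (lexx 0%R) u0)).
by rewrite path_integral0 add0e ltry.
Qed.

Lemma good_clock_upsilon c : off_hyperplanes c -> good_clock ups c.
Proof.
move=> hc; split=> N.
- by have := path_integral_upsilon_fin c (ler0n R N); rewrite ge0_fin_numE ?path_integral_ge0.
- have m0 := upsilon_min_gt0 la_gt0.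
  exists (Num.bound (`|N%:R / upsilon_min la|)%R).
  have := upsilon_slope hc (lexx 0%R) (ler0n _ (Num.bound (`|N%:R / upsilon_min la|)%R)).
  rewrite path_integral0 add0e subr0; apply: lt_le_trans.
  rewrite lte_fin mulrC -ltr_pdivrMr//; apply: (le_lt_trans (ler_norm _)).
  exact: archi_boundP.
- apply/eqP; rewrite eq_le path_integral_ge0 ?andbT//.
  rewrite -(hc N); apply: ge0_le_integral => //.
  + by move=> s _; rewrite lee_fin zero_ind_ge0.
  + by apply: measurable_funTS; exact: (measurable_along (measurable_zero_ind mups)).
  + by apply: measurable_funTS; exact: (measurable_along measurable_hyper_ind).
  + by move=> s _; rewrite lee_fin zero_ind_upsilon.
Qed.

(** The clock is Lipschitz with constant [upsilon_max la], so it takes exactly the value t at its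
    passage time p. As [nu] is injective on [0, +oo[, its partial inverse sends t back to p. *)
Lemma nu_inv_first_passage (b : R -> 'rV[R]_d) c (t : R) : off_hyperplanes c ->
  (forall s, (0 <= s)%R -> c s = b s) -> (0 <= t)%R ->
  nu_inv la b t = first_passage (path_integral ups c) t.
Proof.
move=> hc cb t0; pose G := path_integral ups c.
have hG : passable G.
  by apply: good_clock_passable => //; exact: good_clock_upsilon.
have M0 : (0 <= upsilon_max la)%R by rewrite (le_trans (ups0 0%R))// upsilon_le.
have nuG u : (0 <= u)%R -> (nu la b u)%:E = G u.
  move=> u0; rewrite -[RHS]fineK ?path_integral_upsilon_fin//; congr EFin.
  rewrite /nu /Rintegral; congr fine; apply: eq_integral => s.
  by rewrite inE /= in_itv/= => /andP[s0 _]; rewrite cb.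
pose p := first_passage G t; have p0 : (0 <= p)%R by exact: first_passage_ge0.
have Gp : G p = t%:E.
  have Gpf : G p = (fine (G p))%:E by rewrite fineK// path_integral_upsilon_fin.
  apply/eqP; rewrite eq_le; apply/andP; split; last first.
    apply/lee_addgt0Pr => e e0.
    pose r := (e / (upsilon_max la + 1))%R.
    have M1 : (0 < upsilon_max la + 1)%R by rewrite ltr_wpDl.
    have r0 : (0 < r)%R by rewrite divr_gt0.
    have pr : (p <= p + r)%R by rewrite lerDl ltW.
    have h1 : t%:E < G (p + r)%R by apply: (first_passage_lt hG); rewrite ltrDl.
    apply: (le_trans (ltW h1)); apply: (le_trans (path_integral_upsilon_le c p0 pr)).
    rewrite leeD2l// lee_fin addrC addKr /r mulrCA ler_piMr ?(ltW e0)//.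
    by rewrite ler_pdivrMr// mul1r lerDl.
  (* For p = 0 there is no earlier time to approach from; the clock then vanishes at p. *)
  have [<-|pp] := eqVneq 0%R p; first by rewrite /G path_integral0 lee_fin.
  have {}pp : (0 < p)%R by rewrite lt_def eq_sym pp p0.
  apply/lee_addgt0Pr => e e0.
  have M1 : (0 < upsilon_max la + 1)%R by rewrite ltr_wpDl.
  pose r := Num.min (p / 2)%R (e / (upsilon_max la + 1))%R.
  have r0 : (0 < r)%R by rewrite lt_min !divr_gt0.
  have rp : (r <= p / 2)%R by rewrite ge_min lexx.
  have re : (r <= e / (upsilon_max la + 1))%R by rewrite ge_min lexx orbT.
  have pr0 : (0 < p - r)%R by lra.
  have pr : (p - r <= p)%R by rewrite gerBl ltW.
  have [_ _ h] := first_passage_prop hG t.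
  have h1 : G (p - r)%R <= t%:E by apply: h; rewrite -/p pr0 ltrBlDr ltrDl r0.
  apply: (le_trans (path_integral_upsilon_le c (ltW pr0) pr)).
  apply: leeD => //; rewrite lee_fin opprB addrC subrK.
  rewrite (le_trans (ler_wpM2l M0 re))// mulrCA ler_piMr ?(ltW e0)//.
  by rewrite ler_pdivrMr// mul1r lerDl.
have nup : nu la b p = t by apply: EFin_inj; rewrite nuG.
rewrite -/G -/p /nu_inv -nup; apply: pinvKV.
- move=> u v; rewrite !inE /= !in_itv/= !andbT => u0 v0 uv.
  have [uv'|vu|//] := ltgtP u v.
  + by have := hG.1 _ _ u0 uv'; rewrite -!nuG// uv ltxx.
  + by have := hG.1 _ _ v0 vu; rewrite -!nuG// uv ltxx.
- by rewrite inE /= in_itv/= p0.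
Qed.

End upsilon_clock.

Section comparison.
Context (lam : 'rV[R]_d -> R) (lam_gt0 : forall x, (0 < lam x)%R).
Context (mlam : measurable_fun [set: rV] (lam : rV -> R)).
Context (la : {ffun 'I_d -> bool} -> R) (la_gt0 : forall al, (0 < la al)%R).
Context (n : R) (n0 : (0 < n)%R).

Definition lamV (x : 'rV[R]_d) : R := (lam (Num.sqrt n *: x))^-1.
Definition gapn (x : 'rV[R]_d) : R := clock_gap la lam (Num.sqrt n *: x).

Lemma measurable_scale_arg (h : 'rV[R]_d -> R) : measurable_fun [set: rV] (h : rV -> R) ->
  measurable_fun [set: rV] ((fun x => h (Num.sqrt n *: x)) : rV -> R).
Proof.
move=> mh; apply: (measurableT_comp mh).
exact: (@measurable_rVZ R d _ rV (Num.sqrt n) id (@measurable_id _ _ _)).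
Qed.

Lemma measurable_lamVn : measurable_fun [set: rV] (lamV : rV -> R).
Proof. exact: (measurable_scale_arg (measurable_lamV lam_gt0 mlam)). Qed.

Lemma lamV_gt0 x : (0 < lamV x)%R. Proof. by rewrite invr_gt0. Qed.

Lemma lamV_ge0 x : (0 <= lamV x)%R. Proof. exact/ltW/lamV_gt0. Qed.

Lemma measurable_gapn : measurable_fun [set: rV] (gapn : rV -> R).
Proof. exact: (measurable_scale_arg (measurable_clock_gap la lam_gt0 mlam)). Qed.

Lemma gapn_ge0 x : (0 <= gapn x)%R. Proof. exact: normr_ge0. Qed.

Lemma gapnE x : gapn x = (`|lamV x - upsilon la x|)%R.
Proof. by rewrite /gapn /clock_gap upsilon_scale// sqrtr_gt0. Qed.

(** Two additive bounds replace a bound on the difference, since the clock of [lam] may be infinite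
    at this stage. *)
Lemma path_integral_lamV_le c (u : R) :
  path_integral lamV c u <= path_integral (upsilon la) c u + path_integral gapn c u /\
  path_integral (upsilon la) c u <= path_integral lamV c u + path_integral gapn c u.
Proof.
have mU := measurable_along (@measurable_upsilon R d la) c.
have mL := measurable_along measurable_lamVn c.
have mG := measurable_along measurable_gapn c.
split; rewrite /path_integral -ge0_integralD//.
- apply: ge0_le_integral => //.
  + by move=> s _; rewrite lee_fin lamV_ge0.
  + exact: measurable_funTS.
  + by apply: measurable_funTS; exact: emeasurable_funD.
  + move=> s _; rewrite -EFinD lee_fin gapnE -lerBlDl; exact: ler_norm.
- by move=> s _; rewrite lee_fin upsilon_ge0.
- exact: measurable_funTS.
- by move=> s _; rewrite lee_fin gapn_ge0.
- exact: measurable_funTS.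
- apply: ge0_le_integral => //.
  + by move=> s _; rewrite lee_fin upsilon_ge0.
  + exact: measurable_funTS.
  + by apply: measurable_funTS; exact: emeasurable_funD.
  + by move=> s _; rewrite -EFinD lee_fin gapnE -lerBlDl distrC; exact: ler_norm.
- by move=> s _; rewrite lee_fin lamV_ge0.
- exact: measurable_funTS.
- by move=> s _; rewrite lee_fin gapn_ge0.
- exact: measurable_funTS.
Qed.

(** The clock is finite because it exceeds the limiting one by at most the gap, and it never stops
    because its speed is positive everywhere. *)
Lemma good_clock_lamV c : (forall N : nat, path_integral gapn c N%:R < +oo) ->
  (forall N : nat, exists M : nat, N%:R%:E < path_integral lamV c M%:R) -> good_clock lamV c.
Proof.
move=> gf lu; split=> // N.
  have [h _] := path_integral_lamV_le c N%:R; apply: (le_lt_trans h).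
  rewrite lte_add_pinfty// -ge0_fin_numE ?path_integral_ge0//.
    exact: path_integral_upsilon_fin.
  exact: upsilon_ge0.
rewrite /path_integral integral0_eq// => s _; rewrite /zero_ind indicE memNset//= => h.
by have := lamV_gt0 (c s); rewrite h ltxx.
Qed.

End comparison.
End clocks.

(** * Convergence *)

Section modulus_convergence.
Context {R : realType} dO (Om : measurableType dO) (P : probability Om R).

(* The exceptional sets [~` A k] below decrease to a null set; on [A k], Markov's
   inequality controls the event [e_ n > k.+1^-1]. *)
Lemma cvg_Rintegral_modulus (g_ : nat -> Om -> R) (g : Om -> R)
    (e_ : nat -> Om -> \bar R) (M : R) :
  (forall n, measurable_fun setT (g_ n)) -> measurable_fun setT g ->
  (forall n w, `|g_ n w| <= M) -> (forall w, `|g w| <= M) ->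
  (forall n, measurable_fun setT (e_ n)) -> (forall n w, (0 <= e_ n w)%E) ->
  (forall eta : R, 0 < eta -> exists N : nat, forall n, (N <= n)%N ->
     (\int[P]_w e_ n w <= eta%:E)%E) ->
  {ae P, forall w, forall eps : R, 0 < eps -> exists k : nat, forall n, (k <= n)%N ->
     (e_ n w <= (k.+1%:R^-1)%:E)%E -> `|g_ n w - g w| <= eps} ->
  (\int[P]_w g_ n w)%R @[n --> \oo] --> (\int[P]_w g w)%R.
Proof.
move=> mg_ mg g_M gM me e0 ecvg [N0 [mN0 PN0 hN0]].
have M0 : 0 <= M by exact: le_trans (normr_ge0 _) (gM point).
have ig_ n : P.-integrable setT (EFin \o g_ n).
  apply: measurable_bounded_integrable => //.
    exact: le_lt_trans (probability_le1 _ measurableT) (ltry _).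
  exists M; split=> [|x Mx w _]; first exact: num_real.
  exact: (le_trans (g_M n w) (ltW Mx)).
have ig : P.-integrable setT (EFin \o g).
  apply: measurable_bounded_integrable => //.
    exact: le_lt_trans (probability_le1 _ measurableT) (ltry _).
  exists M; split=> [|x Mx w _]; first exact: num_real.
  exact: (le_trans (gM w) (ltW Mx)).
apply/cvgrPdist_le => eps eps0.
pose eps' := eps / 3; have eps'0 : 0 < eps' by rewrite divr_gt0.
pose A (k : nat) : set Om := [set w | forall n, (k <= n)%N ->
  (e_ n w <= (k.+1%:R^-1)%:E)%E -> `|g_ n w - g w| <= eps'].
have mgg n : measurable_fun setT (fun w => `|g_ n w - g w|).
  by apply: measurableT_comp => //; exact: measurable_funB.
have mA k : measurable (A k).
  rewrite (_ : A k = \bigcap_(n in [set n | (k <= n)%N])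
    ((e_ n @^-1` `](k.+1%:R^-1)%:E, +oo[%classic) `|`
     ((fun w => `|g_ n w - g w|) @^-1` `]-oo, eps']%classic))); last first.
    apply/seteqP; split=> w.
      move=> h n /= kn; have [ew|ew] := leP (e_ n w) (k.+1%:R^-1)%:E.
        by right; rewrite in_itv/=; exact: h.
      by left; rewrite /= in_itv/= ew.
    by move=> h n kn ew; have [/=|/=] := h n kn; rewrite in_itv/= ?andbT// ltNge ew.
  apply: bigcap_measurableType => n _; apply: measurableU.
    by rewrite -[X in measurable X]setTI; apply: me => //; exact: emeasurable_itv.
  by rewrite -[X in measurable X]setTI; apply: mgg => //; exact: measurable_itv.
have mAc k : measurable (~` A k) by exact: measurableC.
have ndA : nonincreasing_seq (fun k => ~` A k).
  move=> k l kl; apply/subsetPset; apply: subsetC => w Aw n ln ew; apply: Aw.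
    exact: leq_trans ln.
  by apply: (le_trans ew); rewrite lee_fin lef_pV2 ?posrE// ler_nat.
have mI : measurable (\bigcap_k ~` A k) by exact: bigcapT_measurable.
have PA0 : P (\bigcap_k ~` A k) = 0%E.
  apply: (subset_measure0 mI mN0 _ PN0) => w h; apply: hN0 => /= /(_ eps' eps'0)[k hk].
  exact: (h k I).
have Pcvg : (P (~` A k) @[k --> \oo] --> (0 : \bar R))%E.
  rewrite -PA0; apply: nonincreasing_cvg_mu => //.
  exact: le_lt_trans (probability_le1 P (mAc 0%N)) (ltry _).
have M1 : 0 < 2 * M + 1 by rewrite ltr_wpDl// mulr_ge0.
have [k Pk] : exists k, (P (~` A k) <= (eps' / (2 * M + 1))%:E)%E.
  have r0 : 0 < eps' / (2 * M + 1) by rewrite divr_gt0.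
  have := Pcvg [set x | (x < (eps' / (2 * M + 1))%:E)%E].
  have op : nbhs (0 : \bar R) [set x | (x < (eps' / (2 * M + 1))%:E)%E].
    by apply: open_nbhs_nbhs; split; [exact: open_ereal_lt_ereal|rewrite /= lte_fin].
  by move=> /(_ op)[k _ /(_ k (leqnn k)) /= /ltW Pk]; exists k.
have K0 : 0 < (2 * M + 1) * k.+1%:R by rewrite mulr_gt0.
have [N hN] := ecvg (eps' / ((2 * M + 1) * k.+1%:R)) (divr_gt0 eps'0 K0).
near=> n.
have Nn : (N <= n)%N by near: n; exists N.
have kn : (k <= n)%N by near: n; exists k.
have igg : P.-integrable setT (EFin \o (fun w => g_ n w - g w)).
  by have := integrableB measurableT (ig_ n) ig; apply: eq_integrable => // w _.
rewrite distrC -RintegralB//.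
apply: (le_trans (le_normr_Rintegral measurableT igg)).
rewrite /Rintegral -lee_fin fineK; last first.
  exact: (integrable_fin_num measurableT (integrable_norm igg)).
have mJ : measurable_fun setT (fun w => ((2 * M + 1) * \1_(~` A k) w)%:E).
  by apply/measurable_EFinP; apply: measurable_funM => //; exact: measurable_indic.
have mK : measurable_fun setT (fun w => ((2 * M + 1) * k.+1%:R)%:E * e_ n w)%E.
  by apply: emeasurable_funM.
have mE : measurable_fun setT (fun w => eps'%:E + ((2 * M + 1) * \1_(~` A k) w)%:E)%E.
  by apply: emeasurable_funD.
(* Three cases: on [A k] with [e_ n] below the threshold the first term suffices; off [A k] the
   second exceeds the trivial bound 2 M; above the threshold [k.+1%:R * e_ n] is at least 1 and the
   third does. *)
apply: (@le_trans _ _ (\int[P]_w (eps'%:E + ((2 * M + 1) * \1_(~` A k) w)%:E +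
    ((2 * M + 1) * k.+1%:R)%:E * e_ n w))%E).
  apply: ge0_le_integral => //.
  - exact/measurable_EFinP.
  - exact: emeasurable_funD.
  move=> w _; have gg : `|g_ n w - g w| <= 2 * M + 1.
    apply: (le_trans (ler_normB _ _)); have := g_M n w; have := gM w; lra.
  have c0 : (0 <= ((2 * M + 1) * k.+1%:R)%:E * e_ n w)%E by rewrite mule_ge0// lee_fin ltW.
  have [Aw|Aw] := pselect (A k w); last first.
    rewrite indicE mem_set// mulr1 -EFinD.
    apply: (@le_trans _ _ (eps' + (2 * M + 1))%:E).
      by rewrite lee_fin (le_trans gg)// lerDr ltW.
    by rewrite leeDl.
  rewrite indicE memNset//= mulr0 adde0.
  have [ew|ew] := leP (e_ n w) (k.+1%:R^-1)%:E.
    by apply: (@le_trans _ _ eps'%:E); [rewrite lee_fin; exact: Aw|rewrite leeDl].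
  apply: (@le_trans _ _ (((2 * M + 1) * k.+1%:R)%:E * e_ n w)%E); last first.
    by rewrite leeDr// lee_fin ltW.
  apply: (@le_trans _ _ (((2 * M + 1) * k.+1%:R)%:E * (k.+1%:R^-1)%:E)%E).
    by rewrite -EFinM lee_fin mulfK.
  by apply: lee_wpmul2l; [rewrite lee_fin ltW|exact: ltW].
rewrite ge0_integralD//; last 2 first.
- by move=> w _; rewrite adde_ge0// lee_fin ?mulr_ge0// ltW.
- by move=> w _; rewrite mule_ge0// lee_fin ltW.
rewrite ge0_integralD//; last 2 first.
- by move=> w _; rewrite lee_fin ltW.
- by move=> w _; rewrite lee_fin mulr_ge0// ltW.
rewrite integral_cst//= [X in (_ * X)%E]probability_setT mule1.
rewrite ge0_integralZl//; last by rewrite lee_fin ltW.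
have -> : (\int[P]_w ((2 * M + 1) * \1_(~` A k) w)%:E = (2 * M + 1)%:E * P (~` A k))%E.
  rewrite -[X in (_ = _ * P X)%E]setIT -integral_indic// -ge0_integralZl//.
  - by apply/measurable_EFinP; exact: measurable_indic.
  - by rewrite lee_fin ltW.
have -> : eps%:E = (eps'%:E + (2 * M + 1)%:E * (eps' / (2 * M + 1))%:E +
  ((2 * M + 1) * k.+1%:R)%:E * (eps' / ((2 * M + 1) * k.+1%:R))%:E)%E.
  rewrite -!EFinM -!EFinD; congr EFin.
  by rewrite ![_ * (eps' / _)]mulrCA !divff ?gt_eqF// /eps'; field.
apply: leeD; last by apply: lee_wpmul2l; [rewrite lee_fin ltW|exact: hN].
by apply: leeD => //; apply: lee_wpmul2l; [rewrite lee_fin ltW|exact: Pk].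
Unshelve. all: by end_near. Qed.

End modulus_convergence.

(** * Continuity of the time change along a fixed path *)

Section modulus.
Context {R : realType} {d : nat} (T : R) (T0 : 0 <= T).
Local Notation cpath := (@cpath R d).
Local Notation mpath := (@mpath R d).
Local Notation rV := (borel 'rV[R]_d).
Local Notation PS := (path_space d T).
Context (lam : 'rV[R]_d -> R) (lam_gt0 : forall x, 0 < lam x).
Context (mlam : measurable_fun [set: rV] (lam : rV -> R)).
Context (la : {ffun 'I_d -> bool} -> R) (la_gt0 : forall al, 0 < la al).

(* The limiting clock runs at speed at least [upsilon_min la], so every clock
   within 1 of it on [[0, horizon]] has passed [T] by then. *)
Definition horizon : R := (T + 2) / upsilon_min la.

Definition clock (n : R) : cpath -> PS :=
  time_changed T (measurable_lamVn lam_gt0 mlam n) (lamV_ge0 lam_gt0 n).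
Definition limit_clock : cpath -> PS :=
  time_changed T (@measurable_upsilon R d la) (upsilon_ge0 la_gt0).

(** Continuity of [f] asks for uniformly close time-changed paths, uniform continuity of [c] for
    close passage times, and the slope of the limiting clock for a small gap. The resulting [k]
    depends on the path but not on [n]. *)
Lemma clock_modulus (f : PS -> R) (c : cpath) (eps : R) : continuous f ->
  off_hyperplanes c -> 0 < eps ->
  exists k : nat, forall n : R, 0 < n -> good_clock (lamV lam n) c ->
    (path_integral (gapn lam la n) c horizon <= (k.+1%:R^-1)%:E)%E ->
    `|f (clock n c) - f (limit_clock c)| <= eps.
Proof.
move=> cf hc eps0; have m0 := upsilon_min_gt0 la_gt0.
have gu := good_clock_upsilon la_gt0 hc.
have fnear : nbhs (limit_clock c) [set y | `|f y - f (limit_clock c)| <= eps].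
  have /cvgrPdist_le/(_ _ eps0) := cf (limit_clock c).
  by apply: filterS => y /=; rewrite distrC.
have [r r0 hr] := nbhs_path_space fnear.
have cc : continuous (c : R -> 'rV[R]_d) by exact: cts_fun.
have [r' r'0 hr'] := uniform_continuity_segment 0 horizon cc r0.
have rm0 : 0 < r' * upsilon_min la by rewrite mulr_gt0.
have [k _ /(_ k (leqnn k)) /= kr] := near_infty_natSinv_lt (PosNum rm0).
exists k => n n0 gn gap; apply: hr => t.
have hU := good_clock_passable (@measurable_upsilon R d la) (upsilon_ge0 la_gt0) gu.
have hL := good_clock_passable (measurable_lamVn lam_gt0 mlam n) (lamV_ge0 lam_gt0 n) gn.
have k0 : 0 < k.+1%:R^-1 :> R by rewrite invr_gt0.
have k1 : k.+1%:R^-1 <= 1 :> R by rewrite invf_le1// ler1n.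
have := set_valP t; rewrite /= in_itv/= => /andP[t0 tT].
have FG u : 0 <= u -> u <= horizon ->
   (path_integral (lamV lam n) c u <= path_integral (upsilon la) c u + (k.+1%:R^-1)%:E)%E /\
   (path_integral (upsilon la) c u <= path_integral (lamV lam n) c u + (k.+1%:R^-1)%:E)%E.
  move=> u0 uU.
  have gu' : (path_integral (gapn lam la n) c u <= (k.+1%:R^-1)%:E)%E.
    apply: (le_trans _ gap); apply: path_integral_le => //.
      exact: measurable_gapn.
    exact: gapn_ge0.
  have [h1 h2] := path_integral_lamV_le lam_gt0 mlam la_gt0 n0 c u.
  by split; [apply: (le_trans h1)|apply: (le_trans h2)]; rewrite leeD2l.
have TU : T + k.+1%:R^-1 < upsilon_min la * horizon.
  by rewrite /horizon mulrCA divff ?mulr1 ?gt_eqF// ltrD2l (le_lt_trans k1)// ltr1n.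
have [dist [_ pGU]] := first_passage_dist hL m0 k0 (path_integral0 _ c)
  (fun u v => @upsilon_slope R d la la_gt0 c u v hc)
  (fun u => @path_integral_upsilon_fin R d la la_gt0 c u) FG TU t0 tT.
rewrite /limit_clock /clock !time_changedE//.
apply: hr'; first by rewrite in_itv/= first_passage_ge0.
rewrite distrC; apply: (le_lt_trans dist).
by rewrite ltr_pdivrMr.
Qed.

End modulus.

(** * Almost sure properties of the clocks *)

Section almost_sure_clocks.
Context {R : realType} {d : nat}.
Local Notation cpath := (@cpath R d).
Local Notation mpath := (@mpath R d).
Local Notation mu := (@lebesgue_measure R).
Local Notation rV := (borel 'rV[R]_d).
Local Open Scope ereal_scope.
Context dO (Om : measurableType dO) (P : probability Om R).
Context (B : R -> Om -> 'rV[R]_d) (hB : wiener_process P B).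
Context (X : Om -> cpath) (hX : path_of P B X).

Lemma ae_off_hyperplanes : {ae P, forall w, off_hyperplanes (X w)}.
Proof.
have [mX _] := hX.
have i0 (x : 'rV[R]_d) : (0 <= \1_hyperplanes x :> R)%R by [].
apply: ae_foralln => N; apply: ge0_integral_eq0_ae.
- exact: (measurableT_comp (measurable_path_integral measurable_hyper_ind i0 N%:R) mX).
- by move=> w; apply: path_integral_ge0.
have m1 : measurable_fun [set: rV] ((fun=> 1%R) : rV -> R) by exact: measurable_cst.
rewrite -[RHS](occupation_hyperplanes hB hX N%:R ltr01 m1 (fun=> ler01)).
apply: eq_integral => w _; apply: eq_integral => s _.
by rewrite mulr1 mul1r.
Qed.

Context (lam : 'rV[R]_d -> R) (lam_gt0 : forall x, (0 < lam x)%R).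
Context (mlam : measurable_fun [set: rV] (lam : rV -> R)).
Context (la : {ffun 'I_d -> bool} -> R) (la_gt0 : forall al, (0 < la al)%R).

Lemma ae_clock_unbounded (n : R) : (1 <= n)%R ->
  {ae P, forall w, \int[mu]_(s in `[0%R, +oo[) ((lam (B s w))^-1)%:E = +oo} ->
  {ae P, forall w, forall N : nat, exists M : nat,
    N%:R%:E < path_integral (lamV lam n) (scale_path n (X w)) M%:R}.
Proof.
move=> n1; have [_ XB] := hX; have n0 : (0 < n)%R by exact: lt_le_trans n1.
apply: filterS2 XB => w [_ Xw] inf N.
have mh := measurable_lamV lam_gt0 mlam.
have h0 x : (0 <= (lam x)^-1)%R by rewrite invr_ge0 ltW.
pose F (k : nat) : set (measurableTypeR R) := `[0%R, k%:R]%classic.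
have FU : \bigcup_k F k = `[0%R, +oo[%classic.
  apply/seteqP; split=> s; first by move=> [k _]; rewrite /F /= !in_itv/= => /andP[->].
  rewrite /= in_itv/= andbT => s0; exists (Num.bound s) => //.
  by rewrite /F /= in_itv/= s0 ltW// archi_boundP.
have : path_integral (fun x => (lam x)^-1)%R (X w) k%:R @[k --> \oo] --> +oo.
  rewrite -inf (_ : \int[mu]_(s in _) _ = \int[mu]_(s in \bigcup_k F k) ((lam (X w s))^-1)%:E).
    apply: ge0_nondecreasing_set_cvg_integral => //.
    - move=> k l kl; apply/subsetPset; rewrite /F.
      by apply: subset_itvl; rewrite bnd_simp ler_nat.
    - by move=> k; apply: measurable_funTS; exact: (measurable_along mh).
    - by move=> k s _; rewrite lee_fin.
  rewrite FU; apply: eq_integral => s; rewrite inE /= in_itv/= andbT => s0.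
  by rewrite Xw.
(* The original clock at time n M is n times the scaled clock at M, so the level to exceed is n N;
   as n >= 1, passing it by time M is enough. *)
move=> /cvgeyPgt/(_ (n * N%:R)%R)[M _ /(_ M (leqnn M)) /= hM].
exists M; rewrite -(@lte_pmul2l _ n%:E) ?lte_fin//.
rewrite -(path_integral_time_scale n0 (X w) M%:R mh h0) -EFinM.
apply: (lt_le_trans hM); apply: path_integral_le => //.
by rewrite ler_peMl.
Qed.

Context (d2 : (2 <= d)%N).
Context (h2 : forall al (eps : R), (0 < eps)%R -> exists A : R, (0 < A)%R /\
      forall x : 'rV[R]_d, octant al x -> (A < enorm x)%R -> (`|lam x - la al| < eps)%R).
Context (h3_2 : d = 2%N -> exists g : R, (0 < g < 1 / 2)%R /\ forall r : R, (0 < r)%R ->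
      (\int[lebesgue_rV]_(x in [set x : borel 'rV[R]_d | (enorm x <= r)%R])
        ((lam x)^-1 * (enorm x `^ (- (2 * g))))%:E < +oo)%E).
Context (h3_gt2 : (2 < d)%N -> forall r : R, (0 < r)%R ->
      (\int[lebesgue_rV]_(x in [set x : borel 'rV[R]_d | (enorm x <= r)%R])
        ((lam x)^-1 * (enorm x `^ (2 - d%:R)))%:E < +oo)%E).

Lemma integral_path_gapn (n U : R) : (0 < n)%R ->
  \int[P]_w path_integral (gapn lam la n) (scale_path n (X w)) U =
  occupation P X n U (clock_gap la lam).
Proof. by move=> n0; apply: eq_integral => w _; exact: path_integral_scale_path. Qed.

Lemma ae_clock_gap_fin (n : R) : (1 <= n)%R ->
  {ae P, forall w, forall N : nat,
    path_integral (gapn lam la n) (scale_path n (X w)) N%:R < +oo}.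
Proof.
move=> n1; have [mX _] := hX; have n0 : (0 < n)%R by exact: lt_le_trans n1.
(* The bound on the expected gap is for positive horizons, hence the separate case 0; its finiteness
   is all that matters, so it is used with tolerance 1. *)
apply: ae_foralln => -[|N]; first by apply: aeW => w; rewrite path_integral0 ltry.
have g0 := gapn_ge0 lam la n.
apply: (@ge0_integral_lty_ae R _ Om P
  (fun w => path_integral (gapn lam la n) (scale_path n (X w)) N.+1%:R)) => [|w|].
- have mY : measurable_fun setT ((fun w => scale_path n (X w)) : Om -> mpath).
    exact: (measurableT_comp (@measurable_scale_path R d n n0) mX).
  have mG := @measurable_gapn R d lam lam_gt0 mlam la n.
  exact: (measurableT_comp (measurable_path_integral mG g0 N.+1%:R) mY).
- exact: path_integral_ge0.
have [C hC] := occupation_clock_gap hB hX d2 lam_gt0 mlam la_gt0 h2 h3_2 h3_gt2 ltr01 (ltr0Sn R N).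
by rewrite integral_path_gapn//; apply: (le_lt_trans (hC n n1)); rewrite ltry.
Qed.

Lemma ae_good_clock (n : R) : (1 <= n)%R ->
  {ae P, forall w, \int[mu]_(s in `[0%R, +oo[) ((lam (B s w))^-1)%:E = +oo} ->
  {ae P, forall w, good_clock (lamV lam n) (scale_path n (X w))}.
Proof.
move=> n1 h4; apply: filterS2 (ae_clock_gap_fin n1) (ae_clock_unbounded n1 h4) => w.
by apply: good_clock_lamV => //; exact: lt_le_trans n1.
Qed.

End almost_sure_clocks.

(** * Transfer to the limiting process and convergence of expectations *)

Section limit_theorem.
Context {R : realType} {d : nat} (T : R) (T0 : 0 <= T) (d2 : (2 <= d)%N).
Local Notation cpath := (@cpath R d).
Local Notation mpath := (@mpath R d).
Local Notation mu := (@lebesgue_measure R).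
Local Notation rV := (borel 'rV[R]_d).
Local Notation PS := (path_space d T).
Context d1 d3 (Om : measurableType d1) (Om' : measurableType d3).
Context (P : probability Om R) (P' : probability Om' R).
Context (B : R -> Om -> 'rV[R]_d) (W : R -> Om' -> 'rV[R]_d).
Context (hB : wiener_process P B) (hW : wiener_process P' W).
Context (X : Om -> cpath) (X' : Om' -> cpath) (hX : path_of P B X) (hX' : path_of P' W X').
Context (lam : 'rV[R]_d -> R) (lam_gt0 : forall x, 0 < lam x).
Context (mlam : measurable_fun [set: rV] (lam : rV -> R)).
Context (la : {ffun 'I_d -> bool} -> R) (la_gt0 : forall al, 0 < la al).
Context (h2 : forall al (eps : R), 0 < eps -> exists A : R, 0 < A /\
      forall x : 'rV[R]_d, octant al x -> A < enorm x -> `|lam x - la al| < eps).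
Context (h3_2 : d = 2%N -> exists g : R, 0 < g < 1 / 2 /\ forall r : R, 0 < r ->
      (\int[lebesgue_rV]_(x in [set x : borel 'rV[R]_d | (enorm x <= r)%R])
        ((lam x)^-1 * (enorm x `^ (- (2 * g))))%:E < +oo)%E).
Context (h3_gt2 : (2 < d)%N -> forall r : R, 0 < r ->
      (\int[lebesgue_rV]_(x in [set x : borel 'rV[R]_d | (enorm x <= r)%R])
        ((lam x)^-1 * (enorm x `^ (2 - d%:R)))%:E < +oo)%E).
Context (h4 : {ae P, forall w,
      (\int[mu]_(s in `[0%R, +oo[) ((lam (B s w))^-1)%:E = +oo)%E}).

Local Notation clk := (clock T lam_gt0 mlam).
Local Notation lclk := (limit_clock T la_gt0).

Lemma measurable_clock (n : R) : measurable_fun [set: mpath] (clk n : mpath -> borel PS).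
Proof. exact: measurable_time_changed. Qed.

Lemma measurable_limit_clock : measurable_fun [set: mpath] (lclk : mpath -> borel PS).
Proof. exact: measurable_time_changed. Qed.

Lemma scaled_law (n : R) (E : set mpath) : 0 < n -> measurable E ->
  P ((fun w => scale_path n (X w)) @^-1` E) = P' (X' @^-1` E).
Proof.
move=> n0 mE.
exact: (wiener_law_unique (wiener_scale n0 hB) hW (path_of_scale n0 hX) hX' mE).
Qed.

Lemma measurable_scaled (n : R) : 0 < n ->
  measurable_fun setT ((fun w => scale_path n (X w)) : Om -> mpath).
Proof.
move=> n0; have [mX _] := hX.
exact: (measurableT_comp (@measurable_scale_path R d n n0) mX).
Qed.

Lemma scaled_expectation (n : R) (F : mpath -> \bar R) : 0 < n ->
  measurable_fun setT F -> (forall c, (0 <= F c)%E) ->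
  (\int[P']_w F (X' w) = \int[P]_w F (scale_path n (X w)))%E.
Proof.
move=> n0 mF F0; have [mX' _] := hX'; have mY := measurable_scaled n0.
have e1 := @ge0_integral_pushforward _ _ _ mpath _ _ mX' P' setT F measurableT mF (fun c _ => F0 c).
have e2 := @ge0_integral_pushforward _ _ _ mpath _ _ mY P setT F measurableT mF (fun c _ => F0 c).
rewrite -[LHS]e1 -[RHS]e2.
pose m1 := measure_function_pushforward__canonical__measure_function_Measure P' mX'.
pose m2 := measure_function_pushforward__canonical__measure_function_Measure P mY.
rewrite -[LHS]/(\int[m1]_c F c)%E -[RHS]/(\int[m2]_c F c)%E.
by apply: eq_measure_integral => A mA _; rewrite /= /pushforward scaled_law.
Qed.

(** The divergence of the additive functional is assumed along [B]. Bad clocks form a measurable set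
    of paths, which has the same probability under the scaled path and under [X'], namely 0. *)
Lemma ae_good_clock_limit (n : R) : 1 <= n ->
  {ae P', forall w, good_clock (lamV lam n) (X' w)}.
Proof.
move=> n1; have n0 : 0 < n by exact: lt_le_trans n1.
have [mX' _] := hX'; have mY := measurable_scaled n0.
have mG := measurableC (measurable_good_clock (measurable_lamVn lam_gt0 mlam n) (lamV_ge0 lam_gt0 n)).
exists (X' @^-1` (~` good_clock (lamV lam n))); split=> //.
- by rewrite -[X in measurable X]setTI; exact: (mX' measurableT _ mG).
have [N [mN N0 hN]] := ae_good_clock hB hX lam_gt0 mlam la_gt0 d2 h2 h3_2 h3_gt2 n1 h4.
rewrite -(scaled_law n0 mG); apply: (subset_measure0 _ mN hN N0).
by rewrite -[X in measurable X]setTI; exact: (mY measurableT _ mG).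
Qed.

Lemma ae_time_change (n : R) : 1 <= n ->
  {ae P, forall w, forall t : set_type `[0%R, T]%classic,
    (clk n (scale_path n (X w)) : PS) t =
    (Num.sqrt n)^-1 *: B (fine (time_change lam (B ^~ w) (n * \val t))) w}.
Proof.
move=> n1; have n0 : 0 < n by exact: lt_le_trans n1.
have [_ XB] := hX.
apply: filterS2 (ae_good_clock hB hX lam_gt0 mlam la_gt0 d2 h2 h3_2 h3_gt2 n1 h4) XB.
move=> w gc [_ Xw] t; rewrite /clock time_changedE// time_changeE.
have hp := good_clock_passable (measurable_lamVn lam_gt0 mlam n) (lamV_ge0 lam_gt0 n) gc.
rewrite (first_passage_time_scale (\val t) n0 hp) => [|u u0]; last first.
  exact: (additive_functional_scale lam_gt0 mlam n0 u Xw).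
set p := first_passage _ _; have p0 : 0 <= p by exact: first_passage_ge0.
have -> : scale_path n (X w) p = (Num.sqrt n)^-1 *: X w (n * p) by [].
by rewrite Xw// mulr_ge0// ltW.
Qed.

Lemma ae_limit_clock :
  {ae P', forall w, forall t : set_type `[0%R, T]%classic,
    (lclk (X' w) : PS) t = W (nu_inv la (W ^~ w) (\val t)) w}.
Proof.
have [_ XW] := hX'; apply: filterS2 (ae_off_hyperplanes hW hX') XW => w hc [_ Xw] t.
have := set_valP t; rewrite /= in_itv/= => /andP[t0 _].
have gc := good_clock_upsilon la_gt0 hc.
have hp := good_clock_passable (@measurable_upsilon R d la) (upsilon_ge0 la_gt0) gc.
rewrite /limit_clock time_changedE// (nu_inv_first_passage la_gt0 hc Xw t0) Xw//.
exact: first_passage_ge0.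
Qed.

Lemma integral_clock_gap_vanishes (U eta : R) : 0 < U -> 0 < eta ->
  exists N : nat, forall n, (N <= n)%N ->
    (\int[P']_w path_integral (gapn lam la n%:R) (X' w) U <= eta%:E)%E.
Proof.
move=> U0 eta0; pose e := eta / 2 / U.
have e0 : 0 < e by rewrite !divr_gt0.
have [C hC] := occupation_clock_gap hB hX d2 lam_gt0 mlam la_gt0 h2 h3_2 h3_gt2 e0 U0.
(* From this rank on, sqrt n >= 2 |C| / eta, which makes the second term at most eta / 2; the
   successor ensures n >= 1. *)
exists (Num.bound ((2 * C / eta) ^+ 2)).+1 => n Nn.
have n1 : 1 <= n%:R :> R by rewrite ler1n; exact: leq_trans Nn.
have n0 : 0 < n%:R :> R by exact: lt_le_trans n1.
rewrite (scaled_expectation n0 (F := fun c => path_integral (gapn lam la n%:R) (c : cpath) U)).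
- rewrite (integral_path_gapn P X lam la U n0); apply: (le_trans (hC _ n1)); rewrite lee_fin.
  have -> : e * U = eta / 2 by rewrite /e divfK// gt_eqF.
  have s0 : 0 < Num.sqrt n%:R :> R by rewrite sqrtr_gt0.
  rewrite [leRHS](splitr eta) lerD2l ler_pdivrMr//.
  have h : `|2 * C / eta| <= Num.sqrt n%:R.
    rewrite -sqrtr_sqr; apply: ler_wsqrtr.
    apply: (le_trans (ltW (archi_boundP (sqr_ge0 _)))); rewrite ler_nat; exact: ltnW.
  apply: (@le_trans _ _ (eta / 2 * `|2 * C / eta|)); last by rewrite ler_pM2l// divr_gt0.
  apply: (@le_trans _ _ (eta / 2 * (2 * C / eta))); last first.
    by rewrite ler_pM2l ?divr_gt0// ler_norm.
  have en : eta != 0 by rewrite gt_eqF.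
  by rewrite le_eqVlt; apply/orP; left; apply/eqP; field.
- exact: (measurable_path_integral (@measurable_gapn R d lam lam_gt0 mlam la n%:R) (gapn_ge0 lam la n%:R)).
- by move=> c; apply: path_integral_ge0; exact: gapn_ge0.
Qed.

Lemma cvg_Rintegral_clock (f : PS -> R) (M : R) : continuous f -> (forall x, `|f x| <= M) ->
  (\int[P']_w f (clk n%:R (X' w)))%R @[n --> \oo] --> (\int[P']_w f (lclk (X' w)))%R.
Proof.
move=> cf fM; have [mX' _] := hX'.
have mf : measurable_fun [set: borel PS] (f : borel PS -> R) by exact: continuous_borel_measurable.
have g0 n := gapn_ge0 lam la n.
have U0 : 0 < horizon T la.
  by rewrite /horizon divr_gt0// ?upsilon_min_gt0// ltr_wpDl.
apply: (cvg_Rintegral_modulus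
  (e_ := fun n w => path_integral (gapn lam la n%:R) (X' w) (horizon T la)) (M := M)) => //.
- by move=> n; exact: (measurableT_comp mf (measurableT_comp (measurable_clock n%:R) mX')).
- exact: (measurableT_comp mf (measurableT_comp measurable_limit_clock mX')).
- move=> n; have mG := @measurable_gapn R d lam lam_gt0 mlam la n%:R.
  exact: (measurableT_comp (measurable_path_integral mG (g0 n%:R) (horizon T la)) mX').
- by move=> n w; exact: (path_integral_ge0 (g0 n%:R)).
- by move=> eta eta0; exact: integral_clock_gap_vanishes.
have gc : {ae P', forall w, forall n : nat, good_clock (lamV lam n.+1%:R) (X' w)}.
  by apply: ae_foralln => n; apply: ae_good_clock_limit; rewrite ler1n.
apply: filterS2 (ae_off_hyperplanes hW hX') gc => w hc gw eps eps0.
have [k hk] := clock_modulus lam_gt0 mlam la_gt0 cf hc eps0.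
(* Starting at [k.+1] leaves out the index 0, at which the scaling degenerates; the threshold
   assumed in [en] is smaller than the one of [hk]. *)
exists k.+1 => -[//|n] kn en; apply: hk => //.
  by apply: (le_trans en); rewrite lee_fin lef_pV2 ?posrE// ler_nat.
Qed.

End limit_theorem.

Theorem theorem3p4 (R : realType) (d : nat) (hd : (2 <= d)%N)
    (d1 d2 : measure_display) (Om : measurableType d1) (Om' : measurableType d2)
    (P : probability Om R) (P' : probability Om' R)
    (B : R -> Om -> 'rV[R]_d) (W : R -> Om' -> 'rV[R]_d)
    (hB : wiener_process P B) (hW : wiener_process P' W)
    (lam : 'rV[R]_d -> R) (lam_gt0 : forall x, 0 < lam x)
    (mlam : measurable_fun [set: borel 'rV[R]_d] (lam : borel 'rV[R]_d -> R))
    (h1 : forall K : set 'rV[R]_d, compact K ->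
      (\int[lebesgue_rV]_(x in (K : set (borel 'rV[R]_d))) ((lam x)^-1)%:E
        < +oo)%E)
    (la : {ffun 'I_d -> bool} -> R) (la_gt0 : forall al, 0 < la al)
    (h2 : forall al (eps : R), 0 < eps -> exists A : R, 0 < A /\
      forall x : 'rV[R]_d, octant al x -> A < enorm x ->
        `|lam x - la al| < eps)
    (h3_2 : d = 2%N -> exists g : R, 0 < g < 1 / 2 /\ forall r : R, 0 < r ->
      (\int[lebesgue_rV]_(x in [set x : borel 'rV[R]_d | (enorm x <= r)%R])
        ((lam x)^-1 * (enorm x `^ (- (2 * g))))%:E < +oo)%E)
    (h3_gt2 : (2 < d)%N -> forall r : R, 0 < r ->
      (\int[lebesgue_rV]_(x in [set x : borel 'rV[R]_d | (enorm x <= r)%R])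
        ((lam x)^-1 * (enorm x `^ (2 - d%:R)))%:E < +oo)%E)
    (h4 : {ae P, forall w,
      (\int[lebesgue_measure]_(s in `[0%R, +oo[) ((lam (B s w))^-1)%:E
        = +oo)%E}) :
  forall T : R, 0 < T ->
    weak_cvg_paths T P P'
      (fun (n : nat) t w =>
        (Num.sqrt n%:R)^-1 *: B (fine (time_change lam (B ^~ w) (n%:R * t))) w)
      (fun t w => W (nu_inv la (W ^~ w) t) w).
Proof.
move=> T T0; have T0' := ltW T0.
have [X mX XB] := continuous_version hB; have hX : path_of P B X by split.
have [X' mX' XW] := continuous_version hW; have hX' : path_of P' W X' by split.
(* For n = 0 the prescribed process is null, because the inverse of 0 is 0; the null path is then
   its version. *)
pose Yf (n : nat) (w : Om) : path_space d T :=
  if n is m.+1 then clock T lam_gt0 mlam m.+1%:R (scale_path m.+1%:R (X w)) else cst 0.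
have mYf n : measurable_fun setT (Yf n : Om -> borel (path_space d T)).
  case: n => [|n]; first exact: measurable_cst.
  exact: (measurableT_comp (measurable_clock T0' lam_gt0 mlam n.+1%:R)
    (measurable_scaled hX (ltr0Sn R n))).
have mZf n : measurable_fun setT
    ((fun w => clock T lam_gt0 mlam n%:R (X' w)) : Om' -> borel (path_space d T)).
  exact: (measurableT_comp (measurable_clock T0' lam_gt0 mlam n%:R) mX').
have mLf : measurable_fun setT
    ((fun w => limit_clock T la_gt0 (X' w)) : Om' -> borel (path_space d T)).
  exact: (measurableT_comp (measurable_limit_clock T0' la_gt0) mX').
pose Y n : {RV P >-> borel (path_space d T)} := mfun_Sub (mem_set (mYf n)).
(* The same clocks run along [X']: for n >= 1, [Z n] has the law of [Y n] but lives on the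
   probability space of the limit. *)
pose Z n : {RV P' >-> borel (path_space d T)} := mfun_Sub (mem_set (mZf n)).
pose Y' : {RV P' >-> borel (path_space d T)} := mfun_Sub (mem_set mLf).
exists Y, Y'; split.
- case=> [|n].
    by apply: aeW => w t; rewrite sqrtr0 invr0 scale0r.
  have n1 : 1 <= n.+1%:R :> R by rewrite ler1n.
  exact: (ae_time_change T hd hB hX lam_gt0 mlam la_gt0 h2 h3_2 h3_gt2 h4 n1).
- exact: (ae_limit_clock T hW hX' la_gt0).
move=> f cf [M fM].
have mf : measurable_fun [set: borel (path_space d T)] (f : borel (path_space d T) -> R).
  exact: continuous_borel_measurable.
have intf d0 (S : measurableType d0) (Q : probability S R) (V : {RV Q >-> borel (path_space d T)}) :
    (\int[distribution Q V]_x f x = \int[Q]_w f (V w))%R.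
  rewrite /Rintegral integral_distribution//; first exact/measurable_EFinP.
  apply: (@measurable_bounded_integrable _ S R Q (f \o V)) => //.
  - exact: le_lt_trans (probability_le1 _ measurableT) (ltry _).
  - exact: (measurableT_comp mf).
  - by exists M; split; [exact: num_real|move=> x Mx w _; exact: le_trans (fM _) (ltW Mx)].
have lim := cvg_Rintegral_clock T0' hd hB hW hX hX' lam_gt0 mlam (la_gt0 := la_gt0)
  h2 h3_2 h3_gt2 h4 cf fM.
rewrite intf; apply: cvg_trans lim.
apply: near_eq_cvg; exists 1%N => // -[//|n] _ /=.
rewrite -[LHS](intf _ _ _ (Z n.+1)) /Rintegral; congr fine.
apply: eq_measure_integral => A mA _.
rewrite /distribution /pushforward.
have mE : measurable (clock T lam_gt0 mlam n.+1%:R @^-1` A : set mpath).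
  by rewrite -[X in measurable X]setTI; exact: measurable_clock.
exact/esym/(scaled_law hB hW hX hX' (ltr0Sn R n) mE).
Qed.
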